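(* Let $G$ be a finite simple graph that is $K_{3,3}$-minor-free. Then: (i) $AT(G)\le 5$; (ii) there exists a matching $M$ of $G$ such that $AT(G-M)\le 4$; (iii) there exists a forest $F$ which is a subgraph of $G$ such that $AT(G-E(F))\le 3$.
   Context: All graphs are finite, simple and undirected. A graph $H$ is a minor of $G$ if $H$ can be obtained from $G$ by repeatedly deleting vertices and edges and contracting edges; $G$ is $H$-minor-free if $H$ is not a minor of $G$. $K_{3,3}$ is the complete bipartite graph with both parts of size $3$. For an orientation $D$ of a graph, $d_D^+(v)$ and $d_D^-(v)$ denote the out-degree and in-degree of $v$, and $\Delta^+(D)$ is the maximum out-degree. An Eulerian subdigraph of $D$ is a spanning subdigraph $H$ of $D$ with $d_H^+(v)=d_H^-(v)$ for every vertex $v$ (the subdigraph with no arcs is included). $EE(D)$ (resp. $OE(D)$) is the set of Eulerian subdigraphs of $D$ with an even (resp. odd) number of arcs. The Alon-Tarsi number $AT(G)$ is the minimum integer $k$ such that $G$ has an orientation $D$ with $|EE(D)|\ne|OE(D)|$ and $\Delta^+(D)<k$. $G-M$ and $G-E(F)$ denote the graphs obtained from $G$ by deleting the edges of $M$, respectively of $F$. *)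

(* Defs.v *)
From mathcomp Require Import all_boot.
From Stdlib Require Import Relation_Operators.
Set Implicit Arguments. Unset Strict Implicit. Unset Printing Implicit Defensive.

(* A finite simple graph with vertex set the finType V is given by its edge
   set E : {set {set V}}, each edge being a 2-element subset of V. *)
Definition simple_edges (V : finType) (E : {set {set V}}) : Prop :=
  forall e, e \in E -> #|e| = 2.

Definition gstate (V : finType) := ({set V} * {set {set V}})%type.

Inductive minor_step (V : finType) : gstate V -> gstate V -> Prop :=
| DelVertex (S : {set V}) (E : {set {set V}}) (v : V) : v \in S ->
    minor_step (S, E) (S :\ v, [set e in E | v \notin e])
| DelEdge (S : {set V}) (E : {set {set V}}) (e : {set V}) : e \in E ->
    minor_step (S, E) (S, E :\ e)
| Contract (S : {set V}) (E : {set {set V}}) (u v : V) : [set u; v] \in E -> u != v ->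
    minor_step (S, E)
      (S :\ v, [set e in E | v \notin e] :|:
               [set [set u; w] | w in [set w in S | ([set v; w] \in E) && (w != u)]]).

Definition minor_of (V : finType) (P Q : gstate V) : Prop :=
  @clos_refl_trans (gstate V) (@minor_step V) Q P.

Definition is_K33 (V : finType) (P : gstate V) : Prop :=
  exists f : bool * 'I_3 -> V, injective f /\
    P.1 = f @: [set: bool * 'I_3] /\
    P.2 = [set [set f x; f y] | x in [set: bool * 'I_3],
                                y in [set y : bool * 'I_3 | y.1 != x.1]].

Definition K33_minor_free (V : finType) (E : {set {set V}}) : Prop :=
  ~ exists P, minor_of P ([set: V], E) /\ is_K33 P.

Definition orientation (V : finType) (E : {set {set V}}) (D : {set V * V}) : bool :=
  [forall u : V, forall v : V, ((u, v) \in D) ==> ([set u; v] \in E)] &&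
  [forall u : V, forall v : V,
     (([set u; v] \in E) && (u != v)) ==> (((u, v) \in D) != ((v, u) \in D))].

Definition outdeg (V : finType) (D : {set V * V}) (v : V) : nat :=
  #|[set a in D | a.1 == v]|.
Definition indeg (V : finType) (D : {set V * V}) (v : V) : nat :=
  #|[set a in D | a.2 == v]|.
Definition maxoutdeg (V : finType) (D : {set V * V}) : nat :=
  \max_(v : V) outdeg D v.

(* spanning Eulerian subdigraphs of D, identified with their arc sets *)
Definition eulerian_sub (V : finType) (D H : {set V * V}) : bool :=
  (H \subset D) && [forall v, outdeg H v == indeg H v].

Definition EE (V : finType) (D : {set V * V}) : nat :=
  #|[set H : {set V * V} | eulerian_sub D H && ~~ odd #|H|]|.
Definition OE (V : finType) (D : {set V * V}) : nat :=
  #|[set H : {set V * V} | eulerian_sub D H && odd #|H|]|.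

Definition AT_ok (V : finType) (E : {set {set V}}) (k : nat) : bool :=
  [exists D : {set V * V}, [&& orientation E D, EE D != OE D & maxoutdeg D < k]].

(* AT(G) = minimum admissible k.  Every simple graph has an admissible k
   <= #|V| (acyclic orientation: EE = 1, OE = 0, Delta^+ <= #|V|-1), so the
   minimum is the first admissible element of 0, 1, ..., #|V|+1. *)
Definition AT (V : finType) (E : {set {set V}}) : nat :=
  find (AT_ok E) (iota 0 (#|V|.+2)).

(* Main.v *)
(* By Alon and Tarsi, |EE(D)| - |OE(D)| is, up to sign, the coefficient of
   prod_v x_v^{d(v)} in prod_{uv} (x_u - x_v), where d(v) is the outdegree of v in
   D; so it suffices to find a nonzero coefficient with small exponents.

   For graphs with neither a K33 nor a K5 minor one uses a Thomassen-style
   induction in which an apex a plays the role of the outer face: G - a has a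
   nonzero coefficient with exponent 0 at one vertex, or at both ends of a deleted
   edge xy, in A = N(a), exponent at most 2 (1 for the forest) on A and at most 4,
   3, 2 elsewhere. Cut vertices of G - a and separating adjacent pairs in A are
   handled by multiplying coefficients. Otherwise a vertex of A has at most two
   neighbours in A, since three would give K33 or K5, and some v in A - {x, y} has
   at most one neighbour in A other than a chosen one of x and y, since otherwise
   A - {x, y} contains a cycle, which with a and x gives K33 or K5; then av is
   contracted.

   A K33-minor-free graph is first cut along sets of at most two vertices. In a
   3-connected one, each bag of a spanning K5 model has a vertex whose removal
   leaves components that see at most one other bag, for otherwise the bag splits
   and gives K33; 3-connectivity then makes the bags single, and the graph is K5. *)

Require Import Defs.
From Stdlib Require Import Relation_Operators Classical_Prop.
From mathcomp Require Import all_boot all_order all_algebra zify.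
Set Implicit Arguments. Unset Strict Implicit. Unset Printing Implicit Defensive.

(** The deleted edge [xy] and the exponents 0 at its ends serve the gluing. When a side is attached
    along [pq], the edge [pq] already belongs to the first side, so the second must lack it. As the
    second side puts no exponent on [p] and [q], the fixed total degree leaves only one product of
    coefficients, and nothing can cancel.

    The gap between the bound on the boundary and the bound elsewhere pays for vertices that return.
    A vertex exposed by the deletion of [v] gains one unit of exponent when [v] comes back, or two
    if a cancellation forces [v] to give up an arc. Hence the pairs (2, 4); (2, 3), where a matching
    edge saves the second unit; and (1, 2), where a forest edge replaces the arc that [v] cannot
    send.

    The edge deleted between two sinks is also why K5 must be treated as a graph with an edge [xy]
    missing, and why the forest has to stay acyclic after [xy] is added to it. *)

Lemma eq_set2 (V : finType) (u v x y : V) :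
  ([set u; v] == [set x; y]) = (u == x) && (v == y) || (u == y) && (v == x).
Proof.
apply/eqP/idP => [E|/orP[]/andP[/eqP-> /eqP->] //]; last by rewrite setUC.
have := set21 u v; have := set22 u v; have := set21 x y; have := set22 x y.
rewrite E -{1 2}E !inE ![_ == u]eq_sym ![_ == v]eq_sym.
by case: (eqVneq u x) => [->|]; case: (eqVneq v y) => [->|]; case: (eqVneq u y) => //=;
  case: (eqVneq v x) => //=; rewrite ?eqxx ?orbT //.
Qed.

Definition add_edge (V : finType) (e : rel V) (p q : V) : rel V :=
  fun u v => e u v || ([set u; v] == [set p; q]).

Lemma add_edge_sym (V : finType) (e : rel V) (p q : V) : symmetric e -> symmetric (add_edge e p q).
Proof. by move=> se u v; rewrite /add_edge se setUC. Qed.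

(** * Connected sets and minor models *)

Section Graphs.
Variable V : finType.
Implicit Types (e : rel V) (U A B X Y : {set V}) (s : seq {set V}) (u v x y : V).

Definition adj e X Y := [exists u in X, exists v in Y, e u v].

Lemma adjP e X Y : reflect (exists u v, [/\ u \in X, v \in Y & e u v]) (adj e X Y).
Proof.
apply: (iffP exists_inP) => [[u uX /exists_inP[v vY euv]]|[u [v [uX vY euv]]]].
  by exists u, v.
by exists u => //; apply/exists_inP; exists v.
Qed.

Lemma adj_sym e X Y : symmetric e -> adj e X Y = adj e Y X.
Proof.
by move=> se; apply/adjP/adjP => -[u [v [uX vY euv]]]; exists v, u; rewrite se.
Qed.

Lemma adjS e X X' Y Y' : X \subset X' -> Y \subset Y' -> adj e X Y -> adj e X' Y'.
Proof.
move=> /subsetP sX /subsetP sY /adjP[u [v [/sX uX /sY vY euv]]].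
by apply/adjP; exists u, v.
Qed.

(** Connectivity is stated through cuts rather than paths, which suits unions and contractions. The
    empty set does not count as connected, since bags must be nonempty. *)
Definition conn e B := (B != set0) &&
  [forall X : {set V}, [&& X \subset B, X != set0 & X != B] ==> adj e X (B :\: X)].

Lemma connP e B : reflect (B != set0 /\ forall X, X \subset B -> X != set0 ->
   X != B -> exists u v, [/\ u \in X, v \in B, v \notin X & e u v]) (conn e B).
Proof.
apply: (iffP andP) => [[B0 /forallP cB]|[B0 cB]]; split=> //.
  move=> X sX X0 XB; have := cB X; rewrite sX X0 XB => /adjP[u [v [uX]]].
  by rewrite inE => /andP[vX vB] euv; exists u, v.
apply/forallP => X; apply/implyP => /and3P[sX X0 XB].
have [u [v [uX vB vX euv]]] := cB X sX X0 XB.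
by apply/adjP; exists u, v; rewrite inE vX.
Qed.

Lemma conn0 e B : conn e B -> B != set0. Proof. by case/andP. Qed.

Lemma not_conn e B : B != set0 -> ~~ conn e B -> exists X,
  [/\ X \subset B, X != set0, X != B & ~~ adj e X (B :\: X)].
Proof.
by move=> B0; rewrite /conn B0 => /forallPn[X]; rewrite negb_imply => /andP[/and3P[]]; exists X.
Qed.

Lemma conn1 e u : conn e [set u].
Proof.
apply/connP; split=> [|X]; first by apply/set0Pn; exists u; rewrite inE.
by rewrite subset1 => /orP[]/eqP->; rewrite eqxx.
Qed.

(** A cut of the union that crosses neither [X] nor [Y] separates one from the other, which an edge
    between them or a common vertex rules out. *)
Lemma connU e X Y : symmetric e -> conn e X -> conn e Y ->
  adj e X Y \/ X :&: Y != set0 -> conn e (X :|: Y).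
Proof.
move=> se /connP[X0 cX] /connP[Y0 cY] XY; apply/connP; split=> [|Z sZ Z0 ZXY].
  by apply: contra X0; rewrite setU_eq0 => /andP[].
have half A : A \subset X :|: Y -> (forall W : {set V}, W \subset A -> W != set0 -> W != A ->
     exists u v, [/\ u \in W, v \in A, v \notin W & e u v]) ->
   [\/ A \subset Z, [disjoint A & Z] | exists u v, [/\ u \in Z, v \in X :|: Y, v \notin Z & e u v]].
  move=> sA cA; case: (eqVneq (A :&: Z) set0) => [AZ0|AZ].
    by constructor 2; rewrite -setI_eq0 AZ0.
  case: (eqVneq (A :&: Z) A) => [/setIidPl|AZA]; first by constructor 1.
  have [u [v [uAZ vA vAZ euv]]] := cA _ (subsetIl _ _) AZ AZA; constructor 3; exists u, v.
  move: uAZ vAZ; rewrite !inE => /andP[_ ->]; rewrite vA /= => ->.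
  by have := subsetP sA v vA; rewrite inE.
have [XZ|XZ|//] := half X (subsetUl _ _) cX; have [YZ|YZ|//] := half Y (subsetUr _ _) cY.
- by case/negP: ZXY; rewrite eqEsubset sZ subUset XZ YZ.
- case: XY => [/adjP[u [v [uX vY euv]]]|].
    exists u, v; split=> //; first exact: (subsetP XZ).
      by rewrite inE vY orbT.
    by move: YZ; rewrite disjoint_subset => /subsetP/(_ v vY).
  case/set0Pn => u; rewrite inE => /andP[uX uY].
  by move: YZ; rewrite disjoint_subset => /subsetP/(_ u uY); rewrite inE (subsetP XZ).
- case: XY => [/adjP[u [v [uX vY euv]]]|].
    exists v, u; split=> //; first exact: (subsetP YZ).
    + by rewrite inE uX.
    + by move: XZ; rewrite disjoint_subset => /subsetP/(_ u uX).
    + by rewrite se.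
  case/set0Pn => u; rewrite inE => /andP[uX uY].
  by move: XZ; rewrite disjoint_subset => /subsetP/(_ u uX); rewrite inE (subsetP YZ).
case/set0Pn: Z0 => u uZ; have := subsetP sZ u uZ; rewrite inE => /orP[uX|uY].
  by move: XZ; rewrite disjoint_subset => /subsetP/(_ u uX); rewrite inE uZ.
by move: YZ; rewrite disjoint_subset => /subsetP/(_ u uY); rewrite inE uZ.
Qed.

Definition component e B u : {set V} :=
  [set v | connect (fun a b => [&& a \in B, b \in B & e a b]) u v].

Section Component.
Variables (e : rel V) (B : {set V}) (u : V).
Hypotheses (se : symmetric e) (uB : u \in B).

Lemma component_refl : u \in component e B u. Proof. by rewrite inE. Qed.

Lemma component_closed v w : v \in component e B u -> w \in B -> e v w -> w \in component e B u.
Proof.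
rewrite !inE => uv wB evw; case: (boolP (v \in B)) => vB.
  by apply: connect_trans uv _; apply: connect1; rewrite vB wB.
have cl : closed (fun a b => [&& a \in B, b \in B & e a b]) (mem B).
  by move=> a b /and3P[/= -> -> _].
by have := closed_connect cl uv; rewrite uB (negPf vB).
Qed.

Lemma component_sub : component e B u \subset B.
Proof.
have cl : closed (fun a b => [&& a \in B, b \in B & e a b]) (mem B).
  by move=> a b /and3P[/= -> -> _].
by apply/subsetP=> v; rewrite inE => uv; rewrite -[_ \in _](closed_connect cl uv).
Qed.

Lemma component_conn : conn e (component e B u).
Proof.
apply/connP; split=> [|X sX X0 XC]; first by apply/set0Pn; exists u; exact: component_refl.
case: (boolP (adj e X (component e B u :\: X))) => [/adjP[a [b []]]|nadj].
  by rewrite inE => aX /andP[bX bC] eab; exists a, b.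
have step a b : a \in X -> [&& a \in B, b \in B & e a b] -> b \in X.
  move=> aX /and3P[aB bB eab]; apply: contraR nadj => bX; apply/adjP; exists a, b.
  by rewrite inE bX aX (component_closed _ bB eab) // (subsetP sX).
have cl : closed (fun a b => [&& a \in B, b \in B & e a b]) (mem X).
  move=> a b /= rab; apply/idP/idP => [aX|bX]; first exact: step aX rab.
  by apply: step bX _; move: rab; rewrite se => /and3P[-> -> ->].
case/negP: XC; rewrite eqEsubset sX; apply/subsetP => v; rewrite inE => uv.
case/set0Pn: X0 => w wX; have := subsetP sX w wX; rewrite inE => uw.
by have := closed_connect cl uw; rewrite (closed_connect cl uv) /= wX.
Qed.

End Component.

Lemma component_max e B u X : conn e X -> X \subset B -> u \in X -> X \subset component e B u.
Proof.
move=> /connP[X0 cX] sX uX; apply/setIidPr/eqP; case: eqVneq => // XC.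
have /cX/(_ _)/(_ _)[||a [b []]] : component e B u :&: X \subset X by exact: subsetIr.
- by apply/set0Pn; exists u; rewrite inE component_refl.
- by [].
rewrite inE => /andP[aC aX] bX; rewrite inE bX andbT => /negP bC eab; case: bC.
by apply: (component_closed _ aC) => //; apply: (subsetP sX).
Qed.

Lemma component_eq e B u v : symmetric e -> u \in B -> v \in component e B u -> component e B v = component e B u.
Proof.
move=> se uB vC; have vB := subsetP (component_sub e uB) v vC.
have sub : component e B u \subset component e B v.
  by apply: component_max vC; [exact: component_conn | exact: component_sub].
apply/eqP; rewrite eqEsubset sub andbT; apply: component_max.
- exact: component_conn.
- exact: component_sub.
by apply: (subsetP sub); exact: component_refl.
Qed.

(** Branch sets of a minor model. Models compose more easily than sequences of deletions and
    contractions, to which they are converted only at the end. *)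
Definition bags U e s :=
  [&& all (conn e) s, all (fun B => B \subset U) s
    & pairwise (fun A B : {set V} => [disjoint A & B]) s].

Definition has_K33 U e : Prop := exists s1 s2,
  [/\ size s1 = 3, size s2 = 3, bags U e (s1 ++ s2) & allrel (adj e) s1 s2].

Definition has_K5 U e : Prop := exists s,
  [/\ size s = 5, bags U e s & pairwise (adj e) s].

Section Minors.
Variables (U U' : {set V}) (e e' : rel V) (b : V -> {set V}).
Hypotheses (conn_b : forall t, t \in U' -> conn e (b t))
  (sub_b : forall t, t \in U' -> b t \subset U)
  (dis_b : forall t t', t \in U' -> t' \in U' -> t != t' -> [disjoint b t & b t'])
  (adj_b : forall t t', t \in U' -> t' \in U' -> e' t t' -> adj e (b t) (b t')).

Let lift B := \bigcup_(t in B) b t.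

(** A cut of the union either splits some [b t], and an edge inside [b t] crosses it, or consists of
    whole sets [b t] and so induces a cut of [B] for [e']. *)
Lemma lift_conn B : B \subset U' -> conn e' B -> conn e (lift B).
Proof.
move=> /subsetP sB /connP[B0 cB]; apply/connP; split=> [|X sX X0 XB].
  case/set0Pn: B0 => t tB; case/set0Pn: (conn0 (conn_b (sB t tB))) => u ut.
  by apply/set0Pn; exists u; apply/bigcupP; exists t.
case: (boolP [exists t in B, (b t :&: X != set0) && ~~ (b t \subset X)]).
  case/exists_inP => t tB /andP[tX0 ntX]; have /connP[_ ct] := conn_b (sB t tB).
  have [|u [v [uI vt vI euv]]] := ct _ (subsetIl _ X) tX0.
    by apply: contra ntX => /eqP/setIidPl.
  move: uI vI; rewrite !inE vt /= => /andP[_ uX] vX; exists u, v; split=> //.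
  by apply/bigcupP; exists t.
rewrite negb_exists => /forallP noSplit.
have split t : t \in B -> b t :&: X != set0 -> b t \subset X.
  by move=> tB tX; have := noSplit t; rewrite tB tX /= negbK.
pose T := [set t in B | b t \subset X].
have [|||t [t' [tT t'B t'T ett']]] := cB T.
- by apply/subsetP => t; rewrite inE => /andP[].
- case/set0Pn: X0 => u uX; have /bigcupP[t tB ut] := subsetP sX u uX.
  apply/set0Pn; exists t; rewrite inE tB split //; apply/set0Pn; exists u.
  by rewrite inE ut uX.
- apply: contra XB => /eqP TB; rewrite eqEsubset sX; apply/bigcupsP => t.
  by rewrite -TB inE => /andP[].
move: tT; rewrite inE => /andP[tB tX].
have /adjP[u [v [ut vt' euv]]] := adj_b (sB t tB) (sB t' t'B) ett'.
exists u, v; split=> //; first exact: (subsetP tX).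
  by apply/bigcupP; exists t'.
apply: contra t'T => vX; rewrite inE t'B split //; apply/set0Pn; exists v.
by rewrite inE vt' vX.
Qed.

Lemma lift_sub B : B \subset U' -> lift B \subset U.
Proof. by move=> /subsetP sB; apply/bigcupsP => t /sB; exact: sub_b. Qed.

Lemma lift_disjoint A B : A \subset U' -> B \subset U' -> [disjoint A & B] ->
  [disjoint lift A & lift B].
Proof.
move=> /subsetP sA /subsetP sB; rewrite -!setI_eq0 => /eqP AB; apply/eqP/setP => u.
rewrite !inE; apply/negP => /andP[/bigcupP[t tA ut] /bigcupP[t' t'B ut']].
have : t != t' by apply: contraTneq tA => ->; have := in_set0 t'; rewrite -AB inE t'B andbT => ->.
by move/(dis_b (sA t tA) (sB t' t'B)); rewrite -setI_eq0 => /eqP/setP/(_ u); rewrite !inE ut ut'.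
Qed.

Lemma lift_adj A B : A \subset U' -> B \subset U' -> adj e' A B -> adj e (lift A) (lift B).
Proof.
move=> /subsetP sA /subsetP sB /adjP[t [t' [tA t'B ett']]].
have /adjP[u [v [ut vt' euv]]] := adj_b (sA t tA) (sB t' t'B) ett'.
by apply/adjP; exists u, v; split=> //; apply/bigcupP; [exists t|exists t'].
Qed.

Lemma lift_bags s : bags U' e' s -> bags U e (map lift s).
Proof.
case/and3P=> /allP cs /allP subs ds; apply/and3P; split.
- by apply/allP => _ /mapP[B Bs ->]; apply: lift_conn; [exact: subs | exact: cs].
- by apply/allP => _ /mapP[B Bs ->]; apply: lift_sub; exact: subs.
rewrite pairwise_map; apply: (@sub_in_pairwise _ (mem s)) ds; last exact/allP.
by move=> A B As Bs; apply: lift_disjoint; exact: subs.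
Qed.

Lemma minor_K33 : has_K33 U' e' -> has_K33 U e.
Proof.
move=> [s1 [s2 [z1 z2 bs adj12]]]; exists (map lift s1), (map lift s2).
rewrite !size_map -map_cat; split=> //; first exact: lift_bags.
have /and3P[_ /allP sub _] := bs.
rewrite allrel_mapl allrel_mapr; apply/allrelP => A B As Bs.
by apply: lift_adj; [apply: sub; rewrite mem_cat As |
  apply: sub; rewrite mem_cat Bs orbT | exact: (allrelP adj12)].
Qed.

Lemma minor_K5 : has_K5 U' e' -> has_K5 U e.
Proof.
move=> [s [z bs adjs]]; exists (map lift s).
rewrite size_map; split=> //; first exact: lift_bags.
have /and3P[_ /allP sub _] := bs.
rewrite pairwise_map; apply: (@sub_in_pairwise _ (mem s)) adjs; last exact/allP.
by move=> A B As Bs; apply: lift_adj; exact: sub.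
Qed.

End Minors.

(* By Wagner's theorem; nothing below uses embeddings. *)
Definition planar U e : Prop := ~ has_K33 U e /\ ~ has_K5 U e.

(* Each edge of [e'] that [e] lacks ends in [p] and is recovered by contracting [X] into [p]. *)
Section Absorb.
Variables (U U' X : {set V}) (e e' : rel V) (p : V).
Hypotheses (se : symmetric e) (U'U : U' \subset U) (XU : X \subset U) (pU' : p \in U')
  (UX : [disjoint U' & X]) (cX : conn e (p |: X))
  (ee' : forall u v, u \in U' -> v \in U' -> e' u v ->
     [\/ e u v, u = p /\ adj e (p |: X) [set v] | v = p /\ adj e (p |: X) [set u]]).

Let b t := if t == p then p |: X else [set t].

Let absorb_conn t : t \in U' -> conn e (b t).
Proof. by rewrite /b; case: eqP => // _ _; exact: conn1. Qed.

Let absorb_sub t : t \in U' -> b t \subset U.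
Proof.
move=> tU'; rewrite /b; case: eqP => _; last by rewrite sub1set (subsetP U'U).
by rewrite subUset sub1set XU (subsetP U'U).
Qed.

Let absorb_disjoint t t' : t \in U' -> t' \in U' -> t != t' -> [disjoint b t & b t'].
Proof.
have notX w : w \in U' -> w \notin X.
  by move=> wU'; move: UX; rewrite disjoint_subset => /subsetP/(_ w wU').
move=> tU t'U ntt'; rewrite /b; case: eqP => [tp|_]; case: eqP => [t'p|_].
- by rewrite tp t'p eqxx in ntt'.
- by rewrite disjoint_sym disjoints1 !inE negb_or notX // andbT eq_sym -tp.
- by rewrite disjoints1 !inE negb_or notX // andbT -t'p.
by rewrite disjoints1 inE.
Qed.

Let absorb_adj t t' : t \in U' -> t' \in U' -> e' t t' -> adj e (b t) (b t').
Proof.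
have inb w : w \in b w by rewrite /b; case: eqP => [->|_]; rewrite !inE eqxx.
move=> tU t'U /(ee' tU t'U)[ett'|[tp]|[t'p]].
- by apply/adjP; exists t, t'; rewrite !inb.
- by rewrite /b tp eqxx; apply: adjS => //; rewrite sub1set -/(b t') inb.
rewrite [b t']/b t'p eqxx adj_sym //; apply: adjS => //; by rewrite sub1set.
Qed.

Lemma absorb_K33 : has_K33 U' e' -> has_K33 U e.
Proof. exact: minor_K33 absorb_conn absorb_sub absorb_disjoint absorb_adj. Qed.

Lemma absorb_planar : planar U e -> planar U' e'.
Proof.
case=> n33 n5; split=> [/absorb_K33//|k5]; apply: n5.
exact: minor_K5 absorb_conn absorb_sub absorb_disjoint absorb_adj k5.
Qed.

End Absorb.

Section Subgraph.
Variables (U U' : {set V}) (e e' : rel V).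
Hypotheses (U'U : U' \subset U)
  (ee' : forall u v, u \in U' -> v \in U' -> e' u v -> e u v).

Let sub_sub t : t \in U' -> [set t] \subset U.
Proof. by move=> tU'; rewrite sub1set (subsetP U'U). Qed.

Let sub_disjoint t t' : t \in U' -> t' \in U' -> t != t' -> [disjoint [set t] & [set t']].
Proof. by move=> _ _ ntt'; rewrite disjoints1 inE. Qed.

Let sub_adj t t' : t \in U' -> t' \in U' -> e' t t' -> adj e [set t] [set t'].
Proof. by move=> tU t'U ett'; apply/adjP; exists t, t'; rewrite !inE !eqxx ee'. Qed.

Lemma sub_K33 : has_K33 U' e' -> has_K33 U e.
Proof. by apply: minor_K33 sub_sub sub_disjoint sub_adj => t _; exact: conn1. Qed.

Lemma sub_planar : planar U e -> planar U' e'.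
Proof.
case=> n33 n5; split=> [/sub_K33//|k5]; apply: n5.
by apply: minor_K5 sub_sub sub_disjoint sub_adj k5 => t _; exact: conn1.
Qed.

End Subgraph.

End Graphs.

(** * Configurations around an apex that force a K33 or K5 minor *)

Section Obstructions.
Variable V : finType.
Implicit Types (e : rel V) (U A B C D G S X Y : {set V}) (s : seq {set V}) (u v w x y : V).

(** [X] is a union of components of [G :\: Q], and each of them touches [Q] because [G] is
    connected. *)
Lemma conn_extend e G Q X : symmetric e -> conn e G -> conn e Q -> Q \subset G ->
  X \subset G :\: Q -> ~~ adj e X (G :\: Q :\: X) -> conn e (Q :|: X).
Proof.
move=> se /connP[_ cG] cQ QG /subsetP XG nadj.
have escape (Z : {set V}) : Z \subset X -> Z != set0 ->
    exists u v, [/\ u \in Z, v \in Q :|: X, v \notin Z & e u v].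
  move=> /subsetP ZX Z0; have [||u [v [uZ vG vZ euv]]] := cG Z _ Z0.
  - by apply/subsetP => z /ZX /XG; rewrite inE => /andP[].
  - have [q qQ] := set0Pn _ (conn0 cQ).
    apply: contraTneq (subsetP QG q qQ) => <-; apply/negP => /ZX /XG; by rewrite !inE qQ.
  exists u, v; split=> //; rewrite in_setU; apply: contraNT nadj; rewrite negb_or => /andP[vQ vX].
  apply/adjP; exists u, v; split=> //; first exact: ZX.
  by rewrite !in_setD vX vQ.
have back (Z : {set V}) : Z \subset Q :|: X -> [disjoint Z & Q] -> Z \subset X.
  move=> ZQX ZQ; apply/subsetP => z zZ; have := subsetP ZQX z zZ; rewrite inE => /orP[zQ|//].
  by move: ZQ; rewrite disjoint_subset => /subsetP/(_ z zZ); rewrite inE zQ.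
have /connP[Q0 cQ'] := cQ.
apply/connP; split=> [|Z sZ Z0 ZX].
  by case/set0Pn: Q0 => q qQ; apply/set0Pn; exists q; rewrite inE qQ.
case: (eqVneq (Z :&: Q) set0) => [ZQ0|ZQ].
  by apply: escape => //; apply: back; rewrite // -setI_eq0 ZQ0.
case: (eqVneq (Z :&: Q) Q) => [/setIidPr QZ|ZQQ]; last first.
  have [u [v [uZ vQ vZ euv]]] := cQ' _ (subsetIr _ _) ZQ ZQQ.
  by move: uZ vZ; rewrite !inE vQ andbT => /andP[uZ _] vZ; exists u, v; rewrite inE vQ.
(* Now [Q] lies in [Z], so what [Z] misses lies in [X], and the edge that escapes from there ends in
   [Z]. *)
have [||v [u [vZ uX uZ evu]]] := escape ((Q :|: X) :\: Z).
- apply: back; first exact: subsetDl.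
  rewrite -setI_eq0; apply/set0Pn => -[z]; rewrite !inE => /andP[/andP[/negP zZ _] /(subsetP QZ)].
  by [].
- by rewrite setD_eq0; apply: contra ZX => XZ; rewrite eqEsubset sZ.
exists u, v; move: vZ uZ; rewrite !in_setD uX andbT negbK => /andP[vZ vX] uZ.
by split=> //; rewrite se.
Qed.

Lemma conn_side e G p X : symmetric e -> conn e G -> p \in G ->
  X \subset G :\ p -> ~~ adj e X (G :\ p :\: X) -> conn e (p |: X).
Proof.
by move=> se cG pG XG; apply: (@conn_extend e G [set p]); rewrite ?sub1set //; exact: conn1.
Qed.

(** No separator puts two equal or adjacent vertices on opposite sides, so either [X] or the
    complementary side holds both, up to vertices of [S]. *)
Lemma choose_side e G S X x y : symmetric e -> X \subset G :\: S -> X != set0 ->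
  X != G :\: S -> ~~ adj e X (G :\: S :\: X) -> x \in G -> y \in G -> x = y \/ e x y ->
  exists Z : {set V}, [/\ [/\ Z \subset G :\: S, Z != set0, Z != G :\: S & ~~ adj e Z (G :\: S :\: Z)],
                x \in Z :|: S & y \in Z :|: S].
Proof.
move=> se sX X0 XG nadj xG yG xy.
have co : [/\ G :\: S :\: X \subset G :\: S, G :\: S :\: X != set0, G :\: S :\: X != G :\: S
    & ~~ adj e (G :\: S :\: X) (G :\: S :\: (G :\: S :\: X))].
  split; first exact: subsetDl.
  - by rewrite setD_eq0; apply: contra XG => GX; rewrite eqEsubset sX.
  - apply: contra X0 => /eqP E; rewrite -subset0; apply/subsetP => z zX.
    by have := subsetP sX z zX; rewrite -E inE zX.
  by rewrite setDDr setDv set0U (setIidPr sX) adj_sym.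
have key u v : u \in G :\: S -> v \in G :\: S -> e u v -> (u \in X) = (v \in X).
  move=> uG vG euv; apply/idP/idP => [uX|vX]; apply: contraNT nadj => nX; apply/adjP.
    by exists u, v; rewrite inE nX.
  by exists v, u; rewrite inE nX se.
case: (boolP (x \in S)) => xS.
  case: (boolP (y \in X)) => yX; first by exists X; rewrite !inE xS yX orbT.
  exists (G :\: S :\: X); split=> //; rewrite !inE ?xS ?orbT //.
  by rewrite yX yG /= andbT orNb.
case: (boolP (x \in X)) => xX.
  exists X; split=> //; rewrite inE ?xX //; case: xy => [<-|exy]; first by rewrite xX.
  by case: (boolP (y \in S)) => yS; rewrite ?orbT // -(key x y) ?xX // inE ?xS ?yS.
exists (G :\: S :\: X); split=> //; rewrite !inE ?xX ?xG ?xS //=.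
case: xy => [<-|exy]; first by rewrite xX xG xS.
by case: (boolP (y \in S)) => yS; rewrite ?orbT //= yG andbT orbF -(key x y) ?xX // inE ?xS ?yS.
Qed.

(** Cut [H] around [w1] and the components of the rest that see [w1]: an edge leaving this set can
    only end in [w2]. *)
Lemma conn_link e H w1 w2 : symmetric e -> conn e H -> w1 \in H -> w2 \in H -> w1 != w2 ->
  e w1 w2 \/ exists z, [/\ z \in H :\ w1 :\ w2, adj e (component e (H :\ w1 :\ w2) z) [set w1]
                         & adj e (component e (H :\ w1 :\ w2) z) [set w2]].
Proof.
move=> se /connP[_ cH] w1H w2H w12; set R := H :\ w1 :\ w2.
have [|||u [v [uX vH vX euv]]] := cH (w1 |: [set z in R | adj e (component e R z) [set w1]]).
- by rewrite subUset sub1set w1H; apply/subsetP => z; rewrite !inE => /andP[/and3P[]].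
- by apply/set0Pn; exists w1; rewrite setU11.
- apply: contraTneq w2H => <-; by rewrite !inE eqxx eq_sym (negPf w12).
have vw1 : v != w1 by apply: contraNneq vX => ->; rewrite setU11.
case: (eqVneq v w2) => [vw2|vw2].
  move: uX; rewrite !in_setU1 inE => /orP[/eqP uw|/andP[uR uw1]].
    by left; rewrite -uw -vw2.
  right; exists u; split=> //; apply/adjP; exists u, v.
  by rewrite component_refl // vw2 inE eqxx -vw2.
have vR : v \in R by rewrite !inE vw2 vw1.
case/negP: vX; rewrite in_setU1 (negPf vw1) inE vR /=.
move: uX; rewrite in_setU1 inE => /orP[/eqP uw|/andP[uR /adjP[a [b [aC]]]]].
  by apply/adjP; exists v, w1; rewrite component_refl // inE eqxx se -uw.
rewrite inE => /eqP-> eaw; apply/adjP; exists a, w1; rewrite inE eqxx; split=> //.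
rewrite (@component_eq _ e R u v) //; by apply: (component_closed uR _ vR euv); exact: component_refl.
Qed.

Lemma disjointI A B : (forall z, z \in A -> z \in B -> False) -> [disjoint A & B].
Proof.
by move=> AB; rewrite disjoint_subset; apply/subsetP => z zA; apply/negP; exact: AB zA.
Qed.

Lemma disjoint_setU1l x A B : [disjoint x |: A & B] = (x \notin B) && [disjoint A & B].
Proof. by rewrite -!setI_eq0 setIUl setU_eq0 !setI_eq0 disjoints1. Qed.

Lemma disjoint_setU1r x A B : [disjoint A & x |: B] = (x \notin A) && [disjoint A & B].
Proof. by rewrite disjoint_sym disjoint_setU1l disjoint_sym. Qed.

(** A component of the rest [R] that sees [w1], [w2] and [w3] forms K33 with [a] and [v] against
    these three. Otherwise any two of the three are joined by an edge or through a component that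
    misses the third; added to the three vertices, these components give K5 with [a] and [v]. *)
Lemma three_neighbours U e a v w1 w2 w3 : symmetric e -> irreflexive e ->
  a \in U -> v \in U :\ a -> w1 \in U :\ a -> w2 \in U :\ a -> w3 \in U :\ a ->
  e a v -> e a w1 -> e a w2 -> e a w3 -> e v w1 -> e v w2 -> e v w3 ->
  w1 != w2 -> w2 != w3 -> w3 != w1 ->
  conn e (U :\ a :\ v :\ w1) -> conn e (U :\ a :\ v :\ w2) -> conn e (U :\ a :\ v :\ w3) ->
  has_K33 U e \/ has_K5 U e.
Proof.
move=> se ie aU vG w1G w2G w3G av aw1 aw2 aw3 vw1 vw2 vw3 w12 w23 w31 c1 c2 c3.
have neq p q : e p q -> p != q by move=> epq; apply: contraTneq epq => ->; rewrite ie.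
have nav := neq _ _ av; have naw1 := neq _ _ aw1; have naw2 := neq _ _ aw2.
have naw3 := neq _ _ aw3; have nvw1 := neq _ _ vw1; have nvw2 := neq _ _ vw2.
have nvw3 := neq _ _ vw3.
set R := U :\ a :\ v :\ w1 :\ w2 :\ w3.
have R12 : U :\ a :\ v :\ w3 :\ w1 :\ w2 = R.
  by apply/setP => z; rewrite !inE; do 3 (case: (z == _) => //=); rewrite ?andbF.
have R23 : U :\ a :\ v :\ w1 :\ w2 :\ w3 = R by [].
have R31 : U :\ a :\ v :\ w2 :\ w3 :\ w1 = R.
  by apply/setP => z; rewrite !inE; do 3 (case: (z == _) => //=); rewrite ?andbF.
move: vG w1G w2G w3G; rewrite !inE => /andP[_ vU] /andP[_ w1U] /andP[_ w2U] /andP[_ w3U].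
have subR z : z \in R -> component e R z \subset R by move=> zR; exact: component_sub.
have notR z : z \in R -> [/\ z != a, z != v, z != w1, z != w2 & z != w3].
  by rewrite !inE => /and5P[? ? ? ? /andP[? ?]].
have outR u : u \in [:: a; v; w1; w2; w3] -> u \notin R.
  by rewrite !inE => /or4P[||/eqP->|/orP[]] => [/eqP->|/eqP->||/eqP->|/eqP->];
    rewrite eqxx ?andbF.
case: (boolP [exists z in R, [&& adj e (component e R z) [set w1], adj e (component e R z) [set w2] &
                                adj e (component e R z) [set w3]]]).
  case/exists_inP => z zR /and3P[z1 z2 z3]; left.
  have out u : u \in [:: a; v; w1; w2; w3] -> (u \in component e R z) = false.
    by move=> /outR; apply: contraNF; exact: (subsetP (subR z zR)).
  have cC : conn e (component e R z) by exact: component_conn.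
  have CU : component e R z \subset U.
    by apply: subset_trans (subR z zR) _; apply/subsetP => u; rewrite !inE => /and5P[_ _ _ _ /andP[]].
  move: (component e R z) z1 z2 z3 out cC CU => C z1 z2 z3 out cC CU.
  exists [:: [set a]; [set v]; C], [:: [set w1]; [set w2]; [set w3]]; split=> //.
    rewrite /bags /= !conn1 cC !sub1set aU vU w1U w2U w3U CU /=.
    rewrite ![[disjoint C & _]]disjoint_sym !disjoints1 !inE !out ?inE ?eqxx ?orbT //.
    by rewrite nav naw1 naw2 naw3 nvw1 nvw2 nvw3 w12 w23 eq_sym w31.
  have adj1 p q : e p q -> adj e [set p] [set q].
    by move=> epq; apply/adjP; exists p, q; rewrite !inE !eqxx.
  by rewrite /allrel /= !adj1 ?z1 ?z2 ?z3.
move=> noclaw; right.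
(* [D] is empty when [p] and [q] are adjacent, so the clause on components is guarded by an element
   [z] of [D]. *)
have link p q r : p \in U -> q \in U -> r \in U -> conn e (U :\ a :\ v :\ r) ->
    U :\ a :\ v :\ r :\ p :\ q = R -> p != a -> p != v -> p != r -> q != a -> q != v -> q != r ->
    p != q -> exists D : {set V}, [/\ D \subset R, conn e (p |: D), adj e (p |: D) [set q] & forall z, z \in D ->
        [/\ D = component e R z, adj e D [set p] & adj e D [set q]]].
  move=> pU qU rU cr RE pa pv pr qa qv qr pq.
  have [||epq|[z [zR zp zq]]] := conn_link se cr _ _ pq.
  - by rewrite !inE pa pv pr pU.
  - by rewrite !inE qa qv qr qU.
  - exists set0; split; rewrite ?sub0set ?setU0 ?conn1 //.
    + by apply/adjP; exists p, q; rewrite !inE !eqxx.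
    by move=> z; rewrite inE.
  rewrite RE in zR zp zq; exists (component e R z); split=> //.
  - exact: subR.
  - rewrite setUC; apply: connU => //; [exact: component_conn|exact: conn1|by left].
  - by apply: adjS zq => //; exact: subsetUr.
  by move=> t tz; rewrite (component_eq se zR tz).
have nw1a : w1 != a by rewrite eq_sym. have nw2a : w2 != a by rewrite eq_sym.
have nw3a : w3 != a by rewrite eq_sym. have nw1v : w1 != v by rewrite eq_sym.
have nw2v : w2 != v by rewrite eq_sym. have nw3v : w3 != v by rewrite eq_sym.
have w21 : w2 != w1 by rewrite eq_sym. have w32 : w3 != w2 by rewrite eq_sym.
have w13 : w1 != w3 by rewrite eq_sym.
have [D1 [D1R cD1 aD1 D1E]] := link w1 w2 w3 w1U w2U w3U c3 R12 nw1a nw1v w13 nw2a nw2v w23 w12.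
have [D2 [D2R cD2 aD2 D2E]] := link w2 w3 w1 w2U w3U w1U c1 R23 nw2a nw2v w21 nw3a nw3v w31 w23.
have [D3 [D3R cD3 aD3 D3E]] := link w3 w1 w2 w3U w1U w2U c2 R31 nw3a nw3v w32 nw1a nw1v w12 w31.
(* A component shared by two links would see all three vertices, which [noclaw] excludes. *)
have dis (D D' : {set V}) p q p' q' : D \subset R ->
    (forall z, z \in D -> [/\ D = component e R z, adj e D [set p] & adj e D [set q]]) ->
    (forall z, z \in D' -> [/\ D' = component e R z, adj e D' [set p'] & adj e D' [set q']]) ->
    (forall t, t \in [:: w1; w2; w3] -> t \in [:: p; q; p'; q']) -> [disjoint D & D'].
  move=> DR DE D'E all3; rewrite -setI_eq0; apply/set0Pn => -[z]; rewrite inE => /andP[zD zD'].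
  have [EzD Dp Dq] := DE z zD; have [EzD' D'p D'q] := D'E z zD'.
  have DD' : D' = D by rewrite EzD'.
  case/negP: noclaw; apply/exists_inP; exists z; first exact: (subsetP DR).
  rewrite DD' in D'p D'q; rewrite -EzD; have sees t : t \in [:: w1; w2; w3] -> adj e D [set t].
    by move/all3; rewrite !inE => /or4P[]/eqP->.
  by rewrite !sees ?inE ?eqxx ?orbT.
have d12 : [disjoint D1 & D2].
  by apply: dis D1R D1E D2E _ => t; rewrite !inE => /or3P[]/eqP->; rewrite eqxx ?orbT.
have d23 : [disjoint D2 & D3].
  by apply: dis D2R D2E D3E _ => t; rewrite !inE => /or3P[]/eqP->; rewrite eqxx ?orbT.
have d13 : [disjoint D1 & D3].
  by apply: dis D1R D1E D3E _ => t; rewrite !inE => /or3P[]/eqP->; rewrite eqxx ?orbT.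
have RU : R \subset U by apply/subsetP => u; rewrite !inE => /and5P[_ _ _ _ /andP[]].
have out D u : D \subset R -> u \in [:: a; v; w1; w2; w3] -> (u \in D) = false.
  by move=> DR /outR; apply: contraNF; exact: (subsetP DR).
exists [:: [set a]; [set v]; w1 |: D1; w2 |: D2; w3 |: D3]; split=> //.
  rewrite /bags /= !conn1 cD1 cD2 cD3 !subUset !sub1set aU vU w1U w2U w3U /=.
  rewrite (subset_trans D1R RU) (subset_trans D2R RU) (subset_trans D3R RU) /=.
  rewrite !disjoints1 !disjoint_setU1l !disjoint_setU1r d12 d23 d13 !inE.
  rewrite !(out D1) ?(out D2) ?(out D3) ?inE ?eqxx ?orbT //.
  by rewrite (negPf nav) (negPf naw1) (negPf naw2) (negPf naw3) (negPf nvw1) (negPf nvw2)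
    (negPf nvw3) ?(negPf w12) ?(negPf w21) ?(negPf w13) ?(negPf w31) ?(negPf w23) ?(negPf w32).
have adj1 p q (X Y : {set V}) : e p q -> p \in X -> q \in Y -> adj e X Y.
  by move=> epq pX qY; apply/adjP; exists p, q.
have toward p q D : e p q -> adj e [set p] (q |: D).
  by move=> epq; exact: adj1 epq (set11 p) (setU11 q D).
have big p q (D D' : {set V}) : adj e (p |: D) [set q] -> adj e (p |: D) (q |: D').
  by apply: adjS => //; rewrite sub1set setU11.
rewrite /= (adj1 _ _ _ _ av) ?set11 // !toward // (big _ _ _ _ aD1) (big _ _ _ _ aD2).
by rewrite adj_sym // (big _ _ _ _ aD3).
Qed.

End Obstructions.

(** * Cycles in the neighbourhood of an apex *)

Section Rings.
Variable V : finType.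
Implicit Types (e : rel V) (U A B D G S X Y Z : {set V}) (s : seq {set V}) (u v w x y : V).

Lemma conn_path e h (t : seq V) : symmetric e -> path e h t -> conn e [set z in h :: t].
Proof.
move=> se; elim: t h => [|k t IH] h.
  by move=> _; rewrite (_ : [set z in _] = [set h]) ?conn1 //; apply/setP => z; rewrite !inE.
case/andP => ehk /IH ct; rewrite set_cons; apply: connU => //; first exact: conn1.
by left; apply/adjP; exists h, k; rewrite !inE !eqxx.
Qed.

(** The head of a path has a neighbour in [B] besides its predecessor. This neighbour either
    lengthens the path, which happens finitely often, or closes a cycle. *)
Lemma find_cycle e B : symmetric e -> irreflexive e -> B != set0 ->
  (forall v, v \in B -> 1 < #|[set u in B | e v u]|) ->
  exists c : seq V, [/\ uniq c, 2 < size c, cycle e c & {subset c <= B}].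
Proof.
move=> se ie /set0Pn[b bB] deg2.
suff grow n x (s : seq V) : #|V| <= n + size s -> uniq (x :: s) -> {subset x :: s <= B} ->
    path e x s -> exists c : seq V, [/\ uniq c, 2 < size c, cycle e c & {subset c <= B}].
  by apply: (grow #|V| b [::]) => // [|z]; rewrite ?addn0 // inE => /eqP->.
elim: n x s => [|n IH] x s size_s us sB xs.
  by have := max_card (mem (x :: s)); rewrite (card_uniqP us) /= leqNgt ltnS size_s.
have xB : x \in B by apply: sB; rewrite mem_head.
(* [head x s] is the predecessor of [x]; on a one-vertex path it defaults to [x], which is no
   neighbour of itself. Avoiding it makes the cycle have length at least three. *)
have [z [zB exz zh]] : exists z, [/\ z \in B, e x z & z != head x s].
  have /card_gt1P[z1 [z2 [+ + z12]]] := deg2 x xB.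
  rewrite !inE => /andP[z1B e1] /andP[z2B e2].
  by case: (eqVneq z1 (head x s)) z12 => [<-|h _]; [rewrite eq_sym; exists z2|exists z1].
have zx : z != x by apply: contraTneq exz => ->; rewrite ie.
case: (boolP (z \in s)) => [zs|zs]; last first.
  apply: (IH z (x :: s)); first by rewrite /= addnS.
  - by rewrite cons_uniq us andbT inE negb_or zx.
  - by move=> t; rewrite inE => /orP[/eqP->//|/sB].
  by rewrite /= se exz.
case/splitPr: zs us sB xs zh size_s => s1 s2 us sB xs zh _.
exists (x :: rcons s1 z); split.
- move: us; rewrite -cat_rcons -cat_cons cat_uniq => /andP[] //.
- by rewrite /= size_rcons; case: s1 zh {us sB xs} => //=; rewrite eqxx.
- rewrite /= rcons_path last_rcons se exz andbT.
  by move: xs; rewrite -cat_rcons cat_path => /andP[].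
by move=> t; rewrite inE mem_rcons => tx; apply: sB; move: tx; rewrite !inE mem_cat inE orbCA => /or3P[->|->|->]; rewrite ?orbT.
Qed.

(** Let [D] be the component of [x] off the cycle. Connectivity after deleting nothing, one vertex
    or two adjacent vertices of the cycle gives [D] neighbours [p], [q], [r] on it in turn. Two
    nonadjacent ones cut the cycle into two arcs, and [a], [p], [q] against [D] and the arcs is K33;
    if all are adjacent, they form K5 with [a] and [D]. *)
Lemma ring_obstruction U e a x (c : seq V) : symmetric e -> irreflexive e -> a \in U ->
  uniq c -> 2 < size c -> cycle e c ->
  (forall z, z \in c -> (z \in U) && e a z) -> x \in U -> e a x -> x \notin c ->
  conn e (U :\ a) -> (forall p, p \in c -> conn e (U :\ a :\ p)) ->
  (forall p q, p \in c -> q \in c -> e p q -> conn e (U :\ a :\ p :\ q)) ->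
  has_K33 U e \/ has_K5 U e.
Proof.
move=> se ie aU uc sc cyc cA xU ax xc c0 c1 c2.
have neq p q : e p q -> p != q by move=> epq; apply: contraTneq epq => ->; rewrite ie.
have ca z : z \in c -> z != a by move=> /cA/andP[_ /neq]; rewrite eq_sym.
have cU z : z \in c -> z \in U by move=> /cA/andP[].
pose R := [set z in U | (z != a) && (z \notin c)].
have xR : x \in R by rewrite inE xU xc andbT eq_sym neq.
have DR := subsetP (component_sub e xR).
have cD := component_conn se xR.
have Dcl v w := @component_closed _ e R x xR v w.
have xD : x \in component e R x := component_refl _ _ _.
move: (component e R x) DR cD Dcl xD => D DR cD Dcl xD.
(* [D] is a whole component off the cycle, so an edge that leaves it inside [H] ends on the
   cycle. *)
have escape (H : {set V}) t : conn e H -> D \subset H -> H \subset U :\ a -> t \in c -> t \in H ->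
    exists2 p, p \in c & p \in H /\ adj e D [set p].
  move=> /connP[_ cH] DH /subsetP HU tc tH; have [||u [p [uD pH pD eup]]] := cH D DH.
  - exact: conn0 cD.
  - apply: contraTneq tH => <-; apply/negP => /DR; by rewrite inE tc !andbF.
  have pc : p \in c.
    apply: contraR pD => pc; apply: Dcl uD _ eup.
    by have := HU p pH; rewrite !inE pc => /andP[-> ->].
  by exists p => //; split=> //; apply/adjP; exists u, p; rewrite inE eqxx.
have DU z : z \in D -> [/\ z \in U, z != a & z \notin c].
  by move=> /DR; rewrite inE => /and3P[].
have adj1 p q (X Y : {set V}) : e p q -> p \in X -> q \in Y -> adj e X Y.
  by move=> epq pX qY; apply/adjP; exists p, q.
have far p q : p \in c -> q \in c -> p != q -> ~~ e p q -> adj e D [set p] -> adj e D [set q] ->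
    has_K33 U e.
  move=> pc qc pq npq Dp Dq; have [i s rotc] := rot_to pc.
  have us : uniq (p :: s) by rewrite -rotc rot_uniq.
  have cycs : cycle e (p :: s) by rewrite -rotc rot_cycle.
  have sc' z : z \in p :: s -> z \in c by rewrite -rotc mem_rot.
  have qs : q \in s by have := qc; rewrite -(mem_rot i) rotc inE eq_sym (negPf pq).
  case/splitPr: qs us cycs sc' {rotc} => s1 s2 us cycs sc'.
  move: cycs; rewrite /= rcons_cat cat_path /= rcons_path => /and4P[ps1 es1 ps2 es2].
  (* Both arcs are nonempty because [p] and [q] are not adjacent. *)
  case: s1 ps1 us sc' es1 => [|h1 t1]; first by move=> _ _ _ /=; rewrite (negPf npq).
  case: s2 ps2 es2 => [|h2 t2]; first by move=> _ /=; rewrite se (negPf npq).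
  case/andP=> eqh2 ps2 es2 /andP[eph1 ps1] us sc' es1.
  have cs1 := conn_path se ps1; have cs2 := conn_path se ps2.
  have s1c z : z \in h1 :: t1 -> z \in c by move=> zs; apply: sc'; rewrite inE mem_cat zs orbT.
  have s2c z : z \in h2 :: t2 -> z \in c.
    by move=> zs; apply: sc'; rewrite inE mem_cat [z \in q :: _]inE zs !orbT.
  have ps12 : (p \notin [set z in h1 :: t1]) && (p \notin [set z in h2 :: t2]).
    move: us; rewrite cons_uniq mem_cat negb_or => /andP[/andP[p1 p2] _].
    by rewrite !in_set p1 /=; apply: contra p2 => p2; rewrite inE p2 orbT.
  have qs12 : (q \notin [set z in h1 :: t1]) && (q \notin [set z in h2 :: t2]).
    move: us; rewrite cons_uniq cat_uniq cons_uniq => /and4P[_ _ /hasPn h /andP[q2 _]].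
    by rewrite !in_set q2 andbT; apply: h; rewrite mem_head.
  have d12 : [disjoint [set z in h1 :: t1] & [set z in h2 :: t2]].
    move: us; rewrite cons_uniq cat_uniq => /and4P[_ _ /hasPn h _].
    apply: disjointI => z; rewrite !in_set => z1 z2.
    by have := h z; rewrite inE z2 orbT => /(_ isT) /negP/(_ z1).
  have h1S : h1 \in [set z in h1 :: t1] by rewrite !inE eqxx.
  have h2S : h2 \in [set z in h2 :: t2] by rewrite !inE eqxx.
  have l1S : last h1 t1 \in [set z in h1 :: t1] by rewrite in_set mem_last.
  have l2S : last h2 t2 \in [set z in h2 :: t2] by rewrite in_set mem_last.
  have S1c z : z \in [set z in h1 :: t1] -> z \in c by rewrite in_set => /s1c.
  have S2c z : z \in [set z in h2 :: t2] -> z \in c by rewrite in_set => /s2c.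
  move: [set z in h1 :: t1] [set z in h2 :: t2] cs1 cs2 ps12 qs12 d12 h1S h2S l1S l2S S1c S2c.
  move=> S1 S2 cS1 cS2 /andP[p1 p2] /andP[q1 q2] d12 h1S h2S l1S l2S S1c S2c.
  exists [:: [set a]; [set p]; [set q]], [:: D; S1; S2]; split=> //.
    rewrite /bags /= !conn1 cD cS1 cS2 !sub1set aU !cU //=.
    have -> : D \subset U by apply/subsetP => z /DU[].
    have -> : S1 \subset U by apply/subsetP => z /S1c/cU.
    have -> : S2 \subset U by apply/subsetP => z /S2c/cU.
    rewrite !disjoints1 ![_ \in [set _]]in_set1.
    have aout z : z \in c -> (a == z) = false by move=> /ca; rewrite eq_sym => /negPf.
    have -> : (a \in S1) = false by apply/negP => /S1c/ca; rewrite eqxx.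
    have -> : (a \in S2) = false by apply/negP => /S2c/ca; rewrite eqxx.
    have cout z : z \in c -> (z \in D) = false by move=> zc; apply/negP => /DU[_ _]; rewrite zc.
    have -> : (a \in D) = false by apply/negP => /DU[_]; rewrite eqxx.
    rewrite !aout // !cout // (negPf pq) p1 p2 q1 q2 d12.
    rewrite /= !andbT; apply/andP; split; apply: disjointI => z zD.
      by move=> /S1c zc; move: zD; rewrite cout.
    by move=> /S2c zc; move: zD; rewrite cout.
  have aS z (S : {set V}) : z \in S -> z \in c -> adj e [set a] S.
    by move=> zS /cA/andP[_ eaz]; apply: adj1 eaz _ zS; rewrite inE.
  have toS z w (S : {set V}) : e z w -> w \in S -> adj e [set z] S.
    by move=> ezw; apply: adj1 ezw _; rewrite inE.
  have e1 := aS _ _ h1S (S1c _ h1S); have e2 := aS _ _ h2S (S2c _ h2S).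
  have e3 := toS _ _ _ ax xD; have e4 := toS _ _ _ eph1 h1S; have e5 := toS _ _ _ eqh2 h2S.
  have e6 : adj e [set p] S2 by apply: toS l2S; rewrite se.
  have e7 : adj e [set q] S1 by apply: toS l1S; rewrite se.
  rewrite (@adj_sym _ e D) // in Dp; rewrite (@adj_sym _ e D) // in Dq.
  by rewrite /allrel /= e1 e2 e3 e4 e5 e6 e7 Dp Dq.
have DG : D \subset U :\ a by apply/subsetP => z /DU[zU za _]; rewrite !inE za.
have third p q : exists2 t, t \in c & (t != p) && (t != q).
  apply/hasP; apply: contraLR sc => /hasPn nt; rewrite -leqNgt.
  by apply: (@uniq_leq_size _ c [:: p; q]) => // z /nt; rewrite negb_and !negbK !inE.
have inG z : z \in c -> z \in U :\ a by move=> zc; rewrite !inE ca // cU.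
have inH (H : {set V}) p : D \subset H -> p \in c -> D \subset H :\ p.
  move=> DH pc; apply/subsetP => z zD; rewrite in_setD1 (subsetP DH) // andbT.
  by have [_ _] := DU z zD; apply: contraNneq => ->.
have [t0 t0c _] := third a a.
have [p pc [_ Dp]] := escape _ t0 c0 DG (subxx _) t0c (inG t0 t0c).
have [t1 t1c /andP[t1p _]] := third p p.
have [||q qc [qH Dq]] := escape _ t1 (c1 p pc) (inH _ p DG pc) _ t1c.
- exact: subsetDl.
- by rewrite in_setD1 t1p inG.
have pq : p != q by move: qH; rewrite in_setD1 eq_sym => /andP[].
case: (boolP (e p q)) => epq; last by left; exact: far pc qc pq epq Dp Dq.
have [t2 t2c /andP[t2p t2q]] := third p q.
have [||r rc [rH Dr]] := escape _ t2 (c2 p q pc qc epq) (inH _ q (inH _ p DG pc) qc) _ t2c.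
- by rewrite subDset setUC subsetU // subsetDl.
- by rewrite in_setD1 t2q in_setD1 t2p inG.
move: rH; rewrite !in_setD1 => /and3P[rq rp _].
case: (boolP (e p r)) => epr; last by left; apply: far pc rc _ epr Dp Dr; rewrite eq_sym.
case: (boolP (e q r)) => eqr; last by left; apply: far qc rc _ eqr Dq Dr; rewrite eq_sym.
right; exists [:: [set a]; D; [set p]; [set q]; [set r]]; split=> //.
  rewrite /bags /= !conn1 cD !sub1set aU !cU //=.
  have -> : D \subset U by apply/subsetP => z /DU[].
  have cout z : z \in c -> (z \in D) = false by move=> zc; apply/negP => /DU[_ _]; rewrite zc.
  have aD : (a \in D) = false by apply/negP => /DU[_]; rewrite eqxx.
  rewrite ![[disjoint D & _]]disjoint_sym !disjoints1 !in_set1 aD !cout // (negPf pq).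
  by rewrite ![a == _]eq_sym !(negPf (ca _ _)) // ![_ == r]eq_sym (negPf rp) (negPf rq).
have toward z w : e z w -> adj e [set z] [set w] by move=> ezw; apply: adj1 ezw _ _; rewrite inE.
have aN z : z \in c -> e a z by move=> /cA/andP[].
by rewrite /= !toward ?aN // (adj1 a x) ?inE // Dp Dq Dr.
Qed.

End Rings.

Lemma subset_of_card (T : finType) k (F W : {set T}) : F \subset W -> #|F| + k <= #|W| ->
  exists K : {set T}, [/\ F \subset K, K \subset W & #|K| = #|F| + k].
Proof.
elim: k F => [|k IH] F FW leW; first by exists F; rewrite addn0.
have [t] : exists t, t \in W :\: F.
  apply/set0Pn; rewrite -card_gt0 cardsD (setIidPr FW) subn_gt0.
  by apply: leq_trans leW; rewrite -[X in X < _]addn0 ltn_add2l.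
rewrite inE => /andP[tF tW]; have [||K [FK KW cK]] := IH (t |: F).
- by rewrite subUset sub1set tW.
- by rewrite cardsU1 tF add1n addSnnS.
exists K; split=> //; first by apply: subset_trans FK; exact: subsetUr.
by rewrite cK cardsU1 tF add1n addSnnS.
Qed.

(** * K5 models in 3-connected K33-minor-free graphs *)

Section Hub.
Variable V : finType.
Implicit Types (e : rel V) (U B C D G S X Y Z W : {set V}) (u v w x y p q : V).

Lemma conn_star e Y W : conn e Y -> Y \subset W ->
  (forall w, w \in W -> exists C, [/\ conn e C, w \in C, C \subset W & C :&: Y != set0]) ->
  conn e W.
Proof.
move=> /connP[Y0 cY] YW star; apply/connP; split=> [|Z ZW Z0 ZnW].
  by case/set0Pn: Y0 => y yY; apply/set0Pn; exists y; exact: (subsetP YW).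
have through C : conn e C -> C \subset W -> Z :&: C != set0 -> ~~ (C \subset Z) ->
    exists u v, [/\ u \in Z, v \in W, v \notin Z & e u v].
  move=> /connP[_ cC] CW ZC0 nCZ; have [|u [v [uZC vC vZC euv]]] := cC _ (subsetIr Z C) ZC0.
    by apply: contra nCZ => /eqP/setIidPr.
  exists u, v; move: uZC vZC; rewrite !inE vC andbT => /andP[uZ _] vZ; split=> //.
  exact: (subsetP CW).
have cYY : conn e Y by apply/connP.
case: (eqVneq (Z :&: Y) set0) => [ZY0|ZY].
  case/set0Pn: Z0 => w wZ; have [C [cC wC CW]] := star w (subsetP ZW w wZ).
  case/set0Pn => y; rewrite inE => /andP[yC yY]; apply: (through C) => //.
    by apply/set0Pn; exists w; rewrite inE wZ.
  apply/negP => /subsetP/(_ y yC) yZ; have := in_set0 y; by rewrite -ZY0 inE yZ yY.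
case: (boolP (Y \subset Z)) => YZ; last by case/set0Pn: Y0 => y _; exact: (through Y).
have [w wW wZ] : exists2 w, w \in W & w \notin Z.
  by apply/subsetPn; apply: contra ZnW => WZ; rewrite eqEsubset ZW.
have [C [cC wC CW]] := star w wW; case/set0Pn => y; rewrite inE => /andP[yC yY].
apply: (through C) => //; first by apply/set0Pn; exists y; rewrite inE yC (subsetP YZ).
by apply/negP => /subsetP/(_ w wC); rewrite (negPf wZ).
Qed.

Variables (I : finType) (J : {set I}) (e : rel V) (t : I -> {set V}) (B : {set V}).
Let sees D := [set j in J | adj e D (t j)].
Hypotheses (se : symmetric e) (J4 : #|J| = 4) (cB : conn e B) (seesB : sees B = J).
(** In a bag of a K5 model such a split is a K33: [X] and the two targets outside [K] against [Y]
    and the two in [K]. *)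
Hypothesis no_split : forall X Y (K : {set I}), conn e X -> conn e Y -> X \subset B ->
  Y \subset B -> [disjoint X & Y] -> adj e X Y -> K \subset J -> #|K| = 2 ->
  K \subset sees X -> J :\: K \subset sees Y -> False.

Let seesU X Y : sees (X :|: Y) = sees X :|: sees Y.
Proof.
apply/setP => j; rewrite !inE; case: (j \in J) => //=; apply/adjP/orP.
  by move=> [u [v [+ vt euv]]]; rewrite inE => /orP[]uX; [left|right]; apply/adjP; exists u, v.
by case=> /adjP[u [v [uX vt euv]]]; exists u, v; rewrite inE uX ?orbT.
Qed.

Let seesJ X : sees X \subset J. Proof. by apply/subsetP => j; rewrite inE => /andP[]. Qed.

(** If both parts saw two targets, a pair [K] with [J :\: sees Y] inside [K] and [K] inside [sees X]
    would give the excluded split. *)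
Let small_other X Y : conn e X -> conn e Y -> X :|: Y = B -> [disjoint X & Y] ->
  1 < #|sees X| -> #|sees Y| <= 1.
Proof.
move=> cX cY XY dXY sX; rewrite leqNgt; apply/negP => sY.
have XB : X \subset B by rewrite -XY subsetUl.
have YB : Y \subset B by rewrite -XY subsetUr.
have seesXY : sees X :|: sees Y = J by rewrite -seesU XY.
have aXY : adj e X Y.
  have /connP[_ /(_ X XB (conn0 cX))[|u [v [uX vB vX euv]]]] := cB.
    apply: contraTneq cY => XE; apply/negP => /conn0/set0Pn[y yY].
    by move: dXY; rewrite XE disjoint_subset => /subsetP/(_ y (subsetP YB y yY)); rewrite inE yY.
  by apply/adjP; exists u, v; split=> //; move: vB; rewrite -XY inE (negPf vX).
have F2 : #|J :\: sees Y| <= 2 by rewrite cardsD (setIidPr (seesJ Y)) J4 leq_subLR (leq_add sY).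
have FX : J :\: sees Y \subset sees X by rewrite -seesXY setDUl setDv setU0 subsetDl.
have [|K [FK KX K2]] := @subset_of_card _ (2 - #|J :\: sees Y|) _ _ FX; first by rewrite subnKC.
rewrite subnKC // in K2; apply: no_split cX cY XB YB dXY aXY (subset_trans KX (seesJ X)) K2 KX _.
by rewrite subDset setUC -subDset.
Qed.

(** A core of one vertex is the hub that is sought; [B] is trivially a core, so minimal ones
    exist. *)
Definition core X := [&& conn e X, X \subset B &
  [forall D : {set V}, conn e D && (D \subset B :\: X) ==> (#|sees D| <= 1)]].

Let coreP X D : core X -> conn e D -> D \subset B :\: X -> #|sees D| <= 1.
Proof. by case/and3P=> _ _ /forallP/(_ D)/implyP h cD DX; apply: h; rewrite cD. Qed.

Let not_core X : conn e X -> X \subset B -> ~~ core X ->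
  exists D, [/\ conn e D, D \subset B :\: X & 1 < #|sees D|].
Proof.
move=> cX XB; rewrite /core cX XB => /forallPn[D]; rewrite negb_imply -ltnNge.
by case/andP=> /andP[cD DX] sD; exists D.
Qed.

(* Two halves which see at most one target each, separated by pieces with the same
   property, which can be distributed arbitrarily. *)
Let distribute Y1 Y2 : conn e Y1 -> conn e Y2 -> Y1 \subset B -> Y2 \subset B ->
  [disjoint Y1 & Y2] -> #|sees Y1| <= 1 -> #|sees Y2| <= 1 ->
  (forall z, z \in B :\: Y1 :\: Y2 -> let C := component e (B :\: Y1 :\: Y2) z in
     [/\ #|sees C| <= 1, adj e C Y1 & adj e C Y2]) -> False.
Proof.
move=> c1 c2 Y1B Y2B d12 s1 s2; set M := B :\: Y1 :\: Y2 => mid.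
pose seenM k := [exists z in M, adj e [set z] (t k)].
(* [F1] and [F2] are the targets seen by [Y1] alone and by [Y2] alone. The pair [K] assigned to [Y1]
   must contain [F1] and avoid [F2]; every other target can be served from either side. *)
pose F1 := [set k in J | (k \notin sees Y2) && ~~ seenM k].
pose F2 := [set k in J | (k \notin sees Y1) && ~~ seenM k].
have seen k : k \in J -> [|| k \in sees Y1, k \in sees Y2 | seenM k].
  move=> kJ; have := kJ; rewrite -{1}seesB inE kJ => /adjP[u [v [uB vt euv]]].
  rewrite !inE kJ /=; case: (boolP (u \in Y1)) => u1.
    by apply/or3P; constructor 1; apply/adjP; exists u, v.
  case: (boolP (u \in Y2)) => u2; first by apply/or3P; constructor 2; apply/adjP; exists u, v.
  apply/or3P; constructor 3; apply/exists_inP; exists u; first by rewrite !inE u1 u2.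
  by apply/adjP; exists u, v; rewrite inE eqxx.
have F1s : F1 \subset sees Y1.
  apply/subsetP => k; rewrite [_ \in F1]inE => /and3P[/seen + n2 nM].
  by rewrite (negPf n2) (negPf nM) !orbF.
have F2s : F2 \subset sees Y2.
  apply/subsetP => k; rewrite [_ \in F2]inE => /and3P[/seen + n1 nM].
  by rewrite (negPf n1) (negPf nM) !orbF.
have F1J : F1 \subset J := subset_trans F1s (seesJ _).
have F2J : F2 \subset J := subset_trans F2s (seesJ _).
have F12 : F1 \subset J :\: F2.
  apply/subsetP => k kF1; rewrite inE (subsetP F1J) // andbT; apply/negP => kF2.
  move: kF1 kF2; rewrite [_ \in F1]inE [_ \in F2]inE => /and3P[/seen + n2 nM] /and3P[_ n1 _].
  by rewrite (negPf n1) (negPf n2) (negPf nM).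
have cF1 : #|F1| <= 1 := leq_trans (subset_leq_card F1s) s1.
have cF2 : #|F2| <= 1 := leq_trans (subset_leq_card F2s) s2.
have [|K [FK KF K2]] := @subset_of_card _ (2 - #|F1|) _ _ F12.
  rewrite subnKC ?(leq_trans cF1) // cardsD (setIidPr F2J) J4.
  by apply: leq_trans (leq_sub2l 4 cF2).
rewrite subnKC ?(leq_trans cF1) // in K2.
have KJ : K \subset J := subset_trans KF (subsetDl _ _).
(* The middle components that see a target in [K'] join the half to which [K'] is assigned; seeing
   at most one target, none is claimed by both halves. *)
pose Cs (K' : {set I}) := [set z in M | [exists k in K', (k \in J) && adj e (component e M z) (t k)]].
have CsM K' : Cs K' \subset M by apply/subsetP => z; rewrite inE => /andP[].
have compCs K' z : z \in Cs K' -> component e M z \subset Cs K'.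
  rewrite inE => /andP[zM /exists_inP[k kK' kz]]; apply/subsetP => z' z'C.
  rewrite inE (subsetP (component_sub e zM) z' z'C) /=; apply/exists_inP; exists k => //.
  by rewrite (component_eq se zM z'C).
have cX K' Y : conn e Y -> (forall z, z \in M -> adj e (component e M z) Y) -> conn e (Y :|: Cs K').
  move=> cY aY; apply: (@conn_star e Y) => //; first exact: subsetUl.
  move=> w; rewrite inE => /orP[wY|wC].
    by exists Y; rewrite setIid (conn0 cY) subsetUl.
  have wM := subsetP (CsM K') w wC; exists (component e M w :|: Y); split.
  - by apply: connU => //; [exact: component_conn | left; exact: aY].
  - by rewrite inE component_refl.
  - by rewrite setUC setUS // compCs.
  by case/set0Pn: (conn0 cY) => y yY; apply/set0Pn; exists y; rewrite !inE yY orbT.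
have midM z : z \in M -> #|sees (component e M z)| <= 1 by case/mid.
have mid1 z : z \in M -> adj e (component e M z) Y1 by case/mid.
have mid2 z : z \in M -> adj e (component e M z) Y2 by case/mid.
have MY1 z : z \in M -> z \notin Y1 by rewrite !inE => /and3P[].
have MY2 z : z \in M -> z \notin Y2 by rewrite !inE => /andP[].
have MB : M \subset B by apply: subset_trans (subsetDl _ _) (subsetDl _ _).
have seenCs (K' : {set I}) k : k \in K' -> k \in J -> seenM k -> k \in sees (Cs K').
  move=> kK' kJ /exists_inP[z zM /adjP[z' [v [z'z vt zv]]]].
  move: z'z; rewrite inE => /eqP z'z; rewrite {}z'z in zv; rewrite inE kJ /=.
  apply/adjP; exists z, v; split=> //; rewrite inE zM; apply/exists_inP; exists k => //.
  by rewrite kJ; apply/adjP; exists z, v; rewrite component_refl.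
apply: (@no_split (Y1 :|: Cs K) (Y2 :|: Cs (J :\: K)) K) => //.
- exact: cX.
- exact: cX.
- by rewrite subUset Y1B (subset_trans (CsM _) MB).
- by rewrite subUset Y2B (subset_trans (CsM _) MB).
- apply: disjointI => z; rewrite !in_setU.
  have nY z' : z' \in Y1 -> z' \notin Y2.
    by move: d12; rewrite disjoint_subset => /subsetP/(_ z'); rewrite inE.
  have CsP (K' : {set I}) : z \in Cs K' -> exists k, [/\ z \in M, k \in K' & k \in sees (component e M z)].
    by rewrite inE => /andP[zM /exists_inP[k kK kz]]; exists k; split; rewrite ?[k \in _]inE.
  case/orP=> [z1|/CsP[k [zM kK kz]]].
    case/orP=> [|/CsP[k [zM _ _]]]; first by rewrite (negPf (nY z z1)).
    by have := MY1 z zM; rewrite z1.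
  case/orP=> [|/CsP[k' [_ + k'z]]]; first by rewrite (negPf (MY2 z zM)).
  by rewrite inE (card_le1_eqP (midM z zM) k k') // kK.
(* The two halves see at most two of the four targets, so some middle component sees a target;
   whichever half it joins, it is adjacent to the other. *)
- have [k kJ kM] : exists2 k, k \in J & seenM k.
    apply/exists_inP; apply: contraT => /exists_inPn nM.
    have : #|J| <= 2.
      apply: leq_trans (leq_add s1 s2); apply: leq_trans (leq_card_setU _ _).
      apply: subset_leq_card; apply/subsetP => k kJ; rewrite inE.
      by have := seen k kJ; rewrite (negPf (nM k kJ)) orbF.
    by rewrite J4.
  have witness (K' : {set I}) : k \in K' -> exists2 z, z \in Cs K' & z \in M.
    move=> kK'; have := seenCs K' k kK' kJ kM; rewrite inE kJ => /adjP[z [v [zC _ _]]].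
    by exists z => //; exact: (subsetP (CsM K')).
  case: (boolP (k \in K)) => kK.
    have [z zC zM] := witness K kK; apply: adjS (mid2 z zM); last exact: subsetUl.
    by apply: subset_trans (compCs _ _ zC) _; exact: subsetUr.
  have [|z zC zM] := witness (J :\: K); first by rewrite inE kK.
  rewrite adj_sym //; apply: adjS (mid1 z zM); last exact: subsetUl.
  by apply: subset_trans (compCs _ _ zC) _; exact: subsetUr.
- rewrite seesU; apply/subsetP => k kK; have kJ := subsetP KJ k kK; rewrite inE.
  case: (boolP (seenM k)) => kM; first by rewrite [k \in sees (Cs K)]seenCs ?orbT.
  apply/orP; left; have := subsetP KF k kK; rewrite inE [k \in F2]inE kJ kM andbT /=.
  by rewrite andbT negbK => ->.
rewrite seesU; apply/subsetP => k kJK; have := kJK; rewrite inE => /andP[kK kJ]; rewrite inE.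
case: (boolP (seenM k)) => kM; first by rewrite [k \in sees (Cs _)]seenCs ?orbT.
apply/orP; left; apply: contraNT kK => n2; apply: (subsetP FK).
by rewrite inE kJ n2.
Qed.

Let component_isolated G z : z \in G -> ~~ adj e (component e G z) (G :\: component e G z).
Proof.
move=> zG; apply/adjP => -[u [v [uC + euv]]]; rewrite inE => /andP[/negP vC vG]; apply: vC.
exact: (component_closed zG uC vG euv).
Qed.

(* Otherwise cut a minimal core into two connected parts [X1], [X2]; neither is
   a core, which isolates small sets [Y1] and [Y2] around them. *)
Lemma hub_exists : exists2 u, u \in B & forall D, conn e D -> D \subset B :\ u -> #|sees D| <= 1.
Proof.
have coreB : core B.
  rewrite /core cB subxx; apply/forallP => D; apply/implyP => /andP[/conn0 D0].
  by rewrite setDv subset0 (negPf D0).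
pose X0 := [arg min_(X < B | core X) #|X|].
have [coreX minX] : core X0 /\ forall X, core X -> #|X0| <= #|X|.
  by rewrite /X0; case: arg_minnP.
have /and3P[cX0 X0B _] := coreX; have [u uX] := set0Pn _ (conn0 cX0).
case: (set_0Vmem (X0 :\ u)) => [X1|[w wX]].
  exists u; first exact: (subsetP X0B).
  by move=> D cD DB; apply: (coreP coreX cD); rewrite -(setD1K uX) X1 setU0.
pose X2 := component e (X0 :\ u) w; pose X1 := u |: (X0 :\ u :\: X2).
have X2X : X2 \subset X0 :\ u by exact: component_sub.
have uX2 : u \notin X2 by apply/negP => /(subsetP X2X); rewrite !inE eqxx.
have cX2 : conn e X2 by exact: component_conn.
have cX1 : conn e X1.
  apply: (@conn_side _ e X0) => //; first exact: subsetDl.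
  rewrite setDDr setDv set0U (setIidPr X2X) adj_sym //; exact: component_isolated.
have inX1 z : (z \in X1) = (z \in X0) && (z \notin X2).
  rewrite in_setU1 2!in_setD in_set1; case: eqVneq => [->|_] /=; first by rewrite uX uX2.
  by rewrite andbC.
have wX2 : w \in X2 by exact: component_refl.
have uX1 : u \in X1 by rewrite inX1 uX uX2.
have X1X : X1 \subset X0 by apply/subsetP => z; rewrite inX1 => /andP[].
have X2X0 : X2 \subset X0 := subset_trans X2X (subsetDl _ _).
have X1B := subset_trans X1X X0B; have X2B := subset_trans X2X0 X0B.
have nX1 : ~~ core X1.
  apply/negP => /minX; rewrite leqNgt proper_card //; apply/properP; split=> //.
  by exists w; [exact: (subsetP X2X0)|rewrite inX1 wX2 andbF].
have nX2 : ~~ core X2.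
  apply/negP => /minX; rewrite leqNgt proper_card //; apply/properP; split=> //.
  by exists u.
(* [E2] is what stays attached to [X2] without [X1], and [E1] what stays attached to [X1] without
   [X2]; their complements in [B] become [Y1] and [Y2]. *)
pose E2 := component e (B :\: X1) w; pose E1 := component e (B :\: X2) u.
have wB1 : w \in B :\: X1 by rewrite in_setD inX1 wX2 andbF (subsetP X2B).
have uB2 : u \in B :\: X2 by rewrite in_setD uX2 (subsetP X1B).
have E2B : E2 \subset B :\: X1 := component_sub e wB1.
have E1B : E1 \subset B :\: X2 := component_sub e uB2.
have cE2 : conn e E2 := component_conn se wB1.
have cE1 : conn e E1 := component_conn se uB2.
have X2E2 : X2 \subset E2.
  by apply: component_max => //; apply/subsetP => z z2; rewrite in_setD inX1 z2 andbF (subsetP X2B).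
have X1E1 : X1 \subset E1.
  by apply: component_max => //; apply/subsetP => z; rewrite in_setD => z1;
    rewrite (subsetP X1B) // andbT; move: z1; rewrite inX1 => /andP[].
(* As [X] is not a core, some connected [D] off [X] sees two targets. Since [X0] is a core, [D]
   meets the other half [Xo], hence lies in [E]. *)
have big X (Xo E : {set V}) z : z \in B :\: X -> E = component e (B :\: X) z -> Xo \subset E ->
    (forall z', z' \in X0 -> (z' \in X) || (z' \in Xo)) ->
    (exists D, [/\ conn e D, D \subset B :\: X & 1 < #|sees D|]) -> 1 < #|sees E|.
  move=> zB EE XoE cover [D [cD DB sD]]; apply: leq_trans (sD) _.
  suff DE : D \subset E.
    apply: subset_leq_card; apply/subsetP => j; rewrite !inE => /andP[-> /=].
    by apply: adjS.
  case: (boolP (D \subset B :\: X0)) => [DX0|].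
    by have := coreP coreX cD DX0; rewrite leqNgt sD.
  case/subsetPn => d dD; rewrite in_setD (subsetP (subset_trans DB (subsetDl _ _))) // andbT negbK.
  move/cover; have := subsetP DB d dD; rewrite in_setD => /andP[/negPf-> dB] /= dXo.
  have := subsetP XoE d dXo; rewrite EE => dE; rewrite -(component_eq se zB dE).
  exact: component_max.
have bE2 : 1 < #|sees E2|.
  apply: (big X1 X2 E2 w) => //; last exact: not_core.
  by move=> z; rewrite inX1 => ->; rewrite orNb.
have bE1 : 1 < #|sees E1|.
  apply: (big X2 X1 E1 u) => //; last exact: not_core.
  by move=> z; rewrite inX1 => ->; rewrite orbN.
have rest X (E : {set V}) z : conn e X -> X \subset B -> z \in B :\: X -> E = component e (B :\: X) z ->
    conn e E -> E \subset B :\: X -> 1 < #|sees E| -> conn e (B :\: E) /\ #|sees (B :\: E)| <= 1.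
  move=> cX XB zB EE cE EB sE.
  have EX : B :\: E = X :|: (B :\: X :\: E).
    apply/setP => y; rewrite in_setU !in_setD; case: (boolP (y \in X)) => yX //=.
    by rewrite (subsetP XB) // andbT; apply/negP => /(subsetP EB); rewrite in_setD yX.
  have cBE : conn e (B :\: E).
    rewrite EX; apply: (@conn_extend _ e B) => //; first exact: subsetDl.
    rewrite setDDr setDv set0U (setIidPr EB) adj_sym // EE; exact: component_isolated.
  split=> //; apply: small_other sE => //.
    apply/setP => y; rewrite in_setU in_setD; case: (boolP (y \in E)) => //= yE.
    by have := subsetP EB y yE; rewrite in_setD => /andP[_ ->].
  by apply: disjointI => y yE; rewrite in_setD yE.
have [cY1 sY1] := rest X1 E2 w cX1 X1B wB1 erefl cE2 E2B bE2.
have [cY2 sY2] := rest X2 E1 u cX2 X2B uB2 erefl cE1 E1B bE1.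
(* An edge that leaves the set missed by both components ends in one of them, which then contains
   its other end too. *)
have cover z : z \in B -> (z \in E1) || (z \in E2).
  move=> zB; apply: contraT; rewrite negb_or => /andP[z1 z2].
  have /connP[_ cBB] := cB; have [|||y [y' [+ y'B + eyy']]] := cBB (B :\: E1 :\: E2).
  - by apply: subset_trans (subsetDl _ _) (subsetDl _ _).
  - by apply/set0Pn; exists z; rewrite 2!in_setD z1 z2.
  - apply/eqP => E; have := subsetP X1B u uX1; rewrite -E 2!in_setD => /and3P[_ /negP uE1 _].
    by apply: uE1; exact: (subsetP X1E1).
  rewrite 2!in_setD => /and3P[y2 y1 yB]; rewrite 2!in_setD y'B andbT negb_and !negbK.
  case/orP=> y'E.
    case/negP: y2; apply: (component_closed wB1 y'E); last by rewrite se.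
    by rewrite in_setD yB andbT; apply: contra y1; exact: (subsetP X1E1).
  case/negP: y1; apply: (component_closed uB2 y'E); last by rewrite se.
  by rewrite in_setD yB andbT; apply: contra y2; exact: (subsetP X2E2).
exfalso; apply: (distribute cY1 cY2) => //; try exact: subsetDl.
  apply: disjointI => z; rewrite !in_setD => /andP[/negPf z2 zB] /andP[/negPf z1 _].
  by have := cover z zB; rewrite z1 z2.
have midE z : (z \in B :\: (B :\: E2) :\: (B :\: E1)) = (z \in E1) && (z \in E2).
  rewrite !in_setD; case: (boolP (z \in B)) => zB; rewrite ?andbT ?andbF ?negbK //=.
  by apply/esym/negP => /andP[/(subsetP E1B)]; rewrite in_setD (negPf zB) andbF.
(* The middle [E1 :&: E2] avoids [X0], so a component of it sees at most one target. An edge leaving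
   it inside [E1] ends in [Y1], and one inside [E2] ends in [Y2]. *)
move=> z zM C; have CM := component_sub e zM; have cC : conn e C := component_conn se zM.
have leave (E : {set V}) X : conn e E -> (forall y, y \in C -> y \in E) -> X != set0 -> X \subset E ->
    (forall y, y \in X -> y \notin C) ->
    exists y y', [/\ y \in C, y' \in E, ~~ ((y' \in E1) && (y' \in E2)) & e y y'].
  move=> /connP[_ cE] CE /set0Pn[x xX] XE XC.
  have [|||y [y' [yC y'E y'C eyy']]] := cE C.
  - by apply/subsetP.
  - exact: conn0 cC.
  - by apply/eqP => CEE; have := XC x xX; rewrite CEE (subsetP XE).
  exists y, y'; split=> //; apply: contra y'C => y'M.
  by apply: (component_closed zM yC _ eyy'); rewrite midE.
have CE1 y : y \in C -> y \in E1 by move=> /(subsetP CM); rewrite midE => /andP[].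
have CE2 y : y \in C -> y \in E2 by move=> /(subsetP CM); rewrite midE => /andP[].
split.
- apply: (coreP coreX cC); apply/subsetP => y yC; rewrite in_setD.
  have := subsetP E1B y (CE1 y yC); rewrite in_setD => /andP[y2 ->]; rewrite andbT.
  by have := subsetP E2B y (CE2 y yC); rewrite in_setD inX1 => /andP[+ _]; rewrite y2 andbT.
- have [y|y [y' [yC y'E y'M eyy']]] := leave E1 X1 cE1 CE1 (conn0 cX1) X1E1.
    by move=> y1; apply/negP => /CE2/(subsetP E2B); rewrite in_setD y1.
  apply/adjP; exists y, y'; split=> //; move: y'M; rewrite y'E /= in_setD => ->.
  by have := subsetP E1B y' y'E; rewrite in_setD => /andP[].
have [y|y [y' [yC y'E y'M eyy']]] := leave E2 X2 cE2 CE2 (conn0 cX2) X2E2.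
  by move=> y2; apply/negP => /CE1/(subsetP E1B); rewrite in_setD y2.
apply/adjP; exists y, y'; split=> //; move: y'M; rewrite y'E andbT in_setD => ->.
by have := subsetP E2B y' y'E; rewrite in_setD => /andP[].
Qed.

End Hub.

Section K5.
Variable V : finType.
Implicit Types (e : rel V) (U B C D G S X Y Z W : {set V}) (u v w x y p q : V).
Variables (U : {set V}) (e : rel V).
Hypotheses (se : symmetric e) (ie : irreflexive e) (noK33 : ~ has_K33 U e).

Definition K5_model (b : 'I_5 -> {set V}) : Prop :=
  [/\ forall i, conn e (b i), forall i, b i \subset U,
      forall i j, i != j -> [disjoint b i & b j] & forall i j, i != j -> adj e (b i) (b j)].

Lemma K5_model_of : has_K5 U e -> exists b, K5_model b.
Proof.
move=> [s [s5 /and3P[/allP cs /allP sU /(pairwiseP set0) ds] /(pairwiseP set0) adjs]].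
have mem_s (i : 'I_5) : nth set0 s i \in s by apply: mem_nth; rewrite s5.
have lt_s (i : 'I_5) : (i : nat) \in gtn (size s) by rewrite inE s5.
exists (fun i => nth set0 s i); split=> [i|i|i j ij|i j ij].
- exact: cs.
- exact: sU.
- case: (ltngtP i j) => [lt|lt|/val_inj E]; last by rewrite E eqxx in ij.
    exact: ds (lt_s i) (lt_s j) lt.
  by rewrite disjoint_sym; exact: ds (lt_s j) (lt_s i) lt.
case: (ltngtP i j) => [lt|lt|/val_inj E]; last by rewrite E eqxx in ij.
  exact: adjs (lt_s i) (lt_s j) lt.
by rewrite adj_sym //; exact: adjs (lt_s j) (lt_s i) lt.
Qed.

(** As long as vertices are left over, connectivity of [U] yields one adjacent to some bag, which
    takes it in. *)
Lemma K5_model_spanning b : conn e U -> K5_model b ->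
  exists2 b', K5_model b' & forall u, u \in U -> exists i, u \in b' i.
Proof.
move=> cU; have [n] := ubnP #|U :\: \bigcup_i b i|; elim: n b => // n IH b; rewrite ltnS => bn mb.
have [cb bU db ab] := mb.
case: (set_0Vmem (U :\: \bigcup_i b i)) => [U0|[r rU]].
  exists b => // u uU; have : u \in \bigcup_i b i.
    by apply: contraT => nu; have := in_set0 u; rewrite -U0 inE nu uU.
  by case/bigcupP => i _ ui; exists i.
have /connP[_ cUU] := cU; have [|||u [v [ub vU vb euv]]] := cUU (\bigcup_i b i).
- by apply/bigcupsP.
- have [z zb] := set0Pn _ (conn0 (cb ord0)); apply/set0Pn; exists z.
  by apply/bigcupP; exists ord0.
- by apply: contraTneq rU => ->; rewrite setDv inE.
case/bigcupP: ub => i _ ui.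
have nvb j : v \notin b j by apply: contra vb => vj; apply/bigcupP; exists j.
pose b' j := if j == i then v |: b i else b j.
have bb' j : b j \subset b' j.
  by rewrite /b'; case: eqP => [->|_]; [exact: subsetUr|exact: subxx].
apply: (IH b').
  apply: leq_trans bn; apply: proper_card; apply/properP; split.
    by apply: setDS; apply/bigcupsP => j _; apply: subset_trans (bb' j) _; exact: bigcup_sup.
  exists v; first by rewrite inE vb vU.
  rewrite inE negb_and negbK; apply/orP; left; apply/bigcupP; exists i => //.
  by rewrite /b' eqxx setU11.
split.
- move=> j; rewrite /b'; case: eqP => _ //; apply: connU => //; first exact: conn1.
  by left; apply/adjP; exists v, u; rewrite inE eqxx se.
- by move=> j; rewrite /b'; case: eqP => _ //; rewrite subUset sub1set vU bU.
- move=> j k jk; rewrite /b'; case: eqP => [ji|_]; case: eqP => [ki|_].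
  + by rewrite ji ki eqxx in jk.
  + by rewrite disjoint_setU1l nvb db // -ji.
  + by rewrite disjoint_setU1r nvb db // -ki.
  exact: db.
by move=> j k jk; apply: adjS (ab j k jk); exact: bb'.
Qed.

Lemma K5_hub b i : K5_model b -> exists2 u, u \in b i &
  forall D, conn e D -> D \subset b i :\ u -> #|[set j in [set~ i] | adj e D (b j)]| <= 1.
Proof.
move=> [cb bU db ab]; apply: hub_exists => //.
- by rewrite cardsC1 card_ord.
- by apply/setP => j; rewrite !inE; case: eqVneq => //= ji; apply: ab; rewrite eq_sym.
move=> X Y K cX cY XB YB dXY aXY KJ K2 KX KY; apply: noK33.
have /cards2P[j1 [j2 [j12 KE]]] : #|K| == 2 by rewrite K2.
have /cards2P[j3 [j4 [j34 KE']]] : #|[set~ i] :\: K| == 2.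
  by rewrite cardsD (setIidPr KJ) K2 cardsC1 card_ord.
have [k1 k2] : j1 \in K /\ j2 \in K by rewrite KE !inE !eqxx orbT.
have [k3 k4] : j3 \in [set~ i] :\: K /\ j4 \in [set~ i] :\: K by rewrite KE' !inE !eqxx orbT.
have [i1 i2] : j1 != i /\ j2 != i by split; [have := subsetP KJ j1 k1|have := subsetP KJ j2 k2]; rewrite !inE.
have [i3 i4] : j3 != i /\ j4 != i by move: k3 k4; rewrite !inE => /andP[_ ->] /andP[_ ->].
have diff k l : k \in K -> l \in [set~ i] :\: K -> k != l.
  by move=> kK; apply: contraTneq => <-; rewrite inE kK.
have a1 : adj e X (b j1) by have := subsetP KX j1 k1; rewrite !inE => /andP[].
have a2 : adj e X (b j2) by have := subsetP KX j2 k2; rewrite !inE => /andP[].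
have a3 : adj e Y (b j3) by have := subsetP KY j3 k3; rewrite [_ \in [set _ in _ | _]]inE => /andP[].
have a4 : adj e Y (b j4) by have := subsetP KY j4 k4; rewrite [_ \in [set _ in _ | _]]inE => /andP[].
have dX j : j != i -> [disjoint X & b j].
  by move=> ji; apply: disjointWl XB _; apply: db; rewrite eq_sym.
have dY j : j != i -> [disjoint Y & b j].
  by move=> ji; apply: disjointWl YB _; apply: db; rewrite eq_sym.
exists [:: X; b j3; b j4], [:: Y; b j1; b j2]; split=> //.
  rewrite /bags /= cX cY !cb !bU (subset_trans XB) // (subset_trans YB) //= dXY !dX //.
  rewrite ![[disjoint _ & Y]]disjoint_sym !dY // !db // 1?eq_sym ?diff //.
by rewrite /allrel /= aXY a1 a2 ![adj e _ Y]adj_sym // a3 a4 !ab // eq_sym diff.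
Qed.

(** Suppose some vertex is not a hub. Collect, from two bags [b i] and [b j], the components off the
    hubs that see no other bag than the other one of the two. The only neighbours of this set [Q]
    outside it are [h i] and [h j], which thus separate it from a third hub. *)
Lemma three_connected_K5 : conn e U ->
  (forall p q, p \in U -> q \in U -> p != q -> U :\ p :\ q != set0 -> conn e (U :\ p :\ q)) ->
  has_K5 U e -> #|U| = 5 /\ {in U &, forall u v, u != v -> e u v}.
Proof.
move=> cU c3 /K5_model_of[b0 /(K5_model_spanning cU)[b mb span]].
have [cb bU db ab] := mb.
have hubs i : exists u, (u \in b i) && [forall D : {set V}, conn e D && (D \subset b i :\ u) ==>
    (#|[set j in [set~ i] | adj e D (b j)]| <= 1)].
  have [u ui hu] := K5_hub i mb; exists u; rewrite ui; apply/forallP => D.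
  by apply/implyP => /andP[]; exact: hu.
pose h i := xchoose (hubs i).
have hb i : h i \in b i by have /andP[] := xchooseP (hubs i).
have small i D : conn e D -> D \subset b i :\ h i -> #|[set j in [set~ i] | adj e D (b j)]| <= 1.
  move=> cD DB; have /andP[_ /forallP/(_ D)] := xchooseP (hubs i).
  by rewrite cD DB.
have uniq_bag i j u : u \in b i -> u \in b j -> i = j.
  move=> ui uj; apply: contraTeq isT => ij; have := db i j ij.
  by rewrite disjoint_subset => /subsetP/(_ u ui); rewrite inE uj.
have hinj : injective h by move=> i j hij; apply: (uniq_bag i j (h i)) => //; rewrite hij.
have hU i : h i \in U := subsetP (bU i) _ (hb i).
pose S := [set h i | i : 'I_5].
have SU : S \subset U by apply/subsetP => _ /imsetP[i _ ->].
have hS i : h i \in S by apply: imset_f.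
have cS : #|S| = 5 by rewrite card_imset // card_ord.
have bS i u : u \in b i -> u \notin S -> u \in b i :\ h i.
  by move=> ui uS; rewrite !inE ui andbT; apply: contraNneq uS => ->.
case: (set_0Vmem (U :\: S)) => [US0|[r]].
  have US : U = S by apply/eqP; rewrite eqEsubset SU -setD_eq0 US0 eqxx.
  split=> [|u v]; first by rewrite US.
  rewrite US => /imsetP[i _ ->] /imsetP[j _ ->] hij.
  have ij : i != j by apply: contraNneq hij => ->.
  have only k z : z \in b k -> z = h k.
    move=> zk; have : z \in S by rewrite -US (subsetP (bU k)).
    by case/imsetP => l _ zl; rewrite zl (uniq_bag k l z) // zl.
  by have /adjP[y [z [/only-> /only->]]] := ab i j ij.
rewrite inE => /andP[rS rU]; exfalso; have [i ri] := span r rU.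
pose C k z := component e (b k :\ h k) z.
have Cin k z : z \in b k -> z \notin S -> z \in C k z by move=> _ _; exact: component_refl.
(* If the component of [r] sees no other bag, any [j] will do. *)
have [j ij typ] : exists2 j, j != i &
    forall k, k != i -> adj e (C i r) (b k) -> k = j.
  have ribi := bS i r ri rS; have := small i (C i r) (component_conn se ribi) (component_sub e ribi).
  case: (set_0Vmem [set k in [set~ i] | adj e (C i r) (b k)]) => [none _|[j jP] /card_le1_eqP le1].
    have [j ji] : exists j, j \in [set~ i] by apply/set0Pn; rewrite -card_gt0 cardsC1 card_ord.
    exists j; first by move: ji; rewrite !inE.
    by move=> k ki ak; have := in_set0 k; rewrite -none !inE ki ak.
  exists j; first by move: jP; rewrite !inE => /andP[].
  by move=> k ki ak; apply: le1 => //; rewrite !inE ki.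
pose Q := [set z in U :\: S | ((z \in b i) && [forall k, (k != i) && adj e (C i z) (b k) ==> (k == j)])
                        || ((z \in b j) && [forall k, (k != j) && adj e (C j z) (b k) ==> (k == i)])].
have QP z : z \in Q -> exists k l, [/\ (k = i /\ l = j) \/ (k = j /\ l = i), z \in b k, z \notin S, z \in U &
    forall m, m != k -> adj e (C k z) (b m) -> m = l].
  rewrite inE inE => /andP[/andP[zS zU]] /orP[]/andP[zk /forallP h'].
    exists i, j; split=> // [|m mi am]; first by left.
    by apply/eqP; have := h' m; rewrite mi am.
  exists j, i; split=> // [|m mi am]; first by right.
  by apply/eqP; have := h' m; rewrite mi am.
have inQ k l z : (k = i /\ l = j) \/ (k = j /\ l = i) -> z \in b k -> z \notin S -> z \in U ->
    (forall m, m != k -> adj e (C k z) (b m) -> m = l) -> z \in Q.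
  move=> kl zk zS zU h'; rewrite inE inE zS zU /=; apply/orP.
  case: kl => -[kE lE]; [left|right]; rewrite -kE -lE zk; apply/forallP => m;
    by apply/implyP => /andP[mk am]; apply/eqP; exact: h'.
have rQ : r \in Q by apply: (inQ i j) => //; left.
(* An edge within a bag stays in one component. An edge into another bag shows that the component at
   its far end sees the bag of [z], hence no third one. *)
have step z z' : z \in Q -> z' \in U -> z' \notin S -> e z z' -> z' \in Q.
  move=> /QP[k [l [kl zk zS zU h']]] z'U z'S ezz'; have [m z'm] := span z' z'U.
  have zbk := bS k z zk zS; have z'bm := bS m z' z'm z'S.
  have zC := component_refl e (b k :\ h k) z.
  case: (eqVneq m k) => [mk|mk].
    apply: (inQ k l) => //; first by rewrite -mk.
    rewrite /C (component_eq se zbk (v := z')) //.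
    by apply: (component_closed zbk zC _ ezz'); rewrite -mk.
  have ml : m = l by apply: h' => //; apply/adjP; exists z, z'.
  apply: (inQ m k) => //; first by case: kl => -[-> lE]; rewrite ml lE; [right|left].
  have z'C := component_refl e (b m :\ h m) z'.
  move=> n nm an; have /card_le1_eqP := small m (C m z') (component_conn se z'bm) (component_sub e z'bm).
  apply; rewrite !inE; first by rewrite eq_sym mk; apply/adjP; exists z', z; rewrite se.
  by rewrite nm.
have stepS z k : z \in Q -> e z (h k) -> k = i \/ k = j.
  move=> /QP[k' [l [kl zk zS zU h']]] ezh; case: (eqVneq k k') => [->|kk'].
    by case: kl => -[-> _]; [left|right].
  have -> : k = l.
    apply: h' => //; apply/adjP; exists z, (h k); split=> //; exact: component_refl.
  by case: kl => -[_ ->]; [right|left].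
have QU : Q \subset U by apply/subsetP => z /QP[? [? []]].
have hij : h i != h j by rewrite (inj_eq hinj) eq_sym.
have notQ k : h k \notin Q by apply/negP => /QP[? [? [_ _ /negP]]].
have [k [ki kj]] : exists k, k != i /\ k != j.
  have : 0 < #|~: [set i; j]| by rewrite cardsCs setCK cards2 card_ord eq_sym ij.
  by rewrite card_gt0 => /set0Pn[k]; rewrite !inE negb_or => /andP[]; exists k.
have kH : h k \in U :\ h i :\ h j by rewrite 2!in_setD1 hU !(inj_eq hinj) kj ki.
have /connP[_ cH] : conn e (U :\ h i :\ h j) by apply: c3 => //; apply/set0Pn; exists (h k).
have [|||u [v [uQ vH vQ euv]]] := cH Q.
- apply/subsetP => z zQ; rewrite 2!in_setD1 (subsetP QU) // andbT.
  by apply/andP; split; apply: contraTneq zQ => ->.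
- by apply/set0Pn; exists r.
- by apply: contraNneq (notQ k) => ->.
move: vH; rewrite 2!in_setD1 => /and3P[vj vi vU].
case: (boolP (v \in S)) => [/imsetP[m _ vm]|vS]; last by case/negP: vQ; exact: step euv.
by case: (stepS u m uQ); rewrite -?vm // => mE; [move: vi|move: vj]; rewrite vm mE eqxx.
Qed.

End K5.

(** * The induction on the graph *)

Section Induction.
Variable V : finType.
Implicit Types (e : rel V) (U A B D G S X Y Z : {set V}) (u v w x y p q : V).
(** [P U e A x y] stands for a nonzero coefficient with bounded exponents on the graph induced by
    [U], with boundary [A] and sinks [x], [y]. It is abstract because one induction serves all three
    bounds. *)
Variable P : {set V} -> rel V -> {set V} -> V -> V -> Prop.

Hypothesis P_sym : forall U e A x y, symmetric e -> P U e A x y -> P U e A y x.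
Hypothesis P_mono : forall U e e' A A' x y, P U e A x y -> symmetric e' ->
  (forall u v, u \in U -> v \in U -> e' u v -> e u v) ->
  (forall u, u \in A' -> u \in U -> u \in [set x; y] :|: A) -> P U e' A' x y.
Hypothesis P_glue : forall U1 U2 e A x y p q, symmetric e -> irreflexive e ->
  x \in U1 -> y \in U1 -> p \in U2 -> q \in U2 ->
  (forall u, u \in U1 -> u \in U2 -> u \in [set p; q]) ->
  p = q \/ p \in U1 /\ q \in U1 ->
  (forall u v, u \in U1 :\: U2 -> v \in U2 :\: U1 -> ~~ e u v) ->
  P U1 e A x y -> P U2 e A p q -> P (U1 :|: U2) e A x y.
Hypothesis P_sink : forall U e x y z, symmetric e -> irreflexive e ->
  x \in U -> z \in U -> e x z -> y = z \/ y = x ->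
  P (U :\ x) e [set u | e x u] z z -> P U e set0 x y.
(** The deletion of [v] exposes its neighbours, which join the boundary. The boundary neighbours, at
    most [x] and [w], are the ones that have no room for an additional unit when [v] returns. *)
Hypothesis P_vertex : forall U e A x y v w, symmetric e -> irreflexive e ->
  v \in U -> x \in A -> y \in A -> v != x -> v != y -> w \in U ->
  (forall u, u \in U -> u \in A -> e v u -> u \in [set x; w]) ->
  P (U :\ v) e (A :|: [set u | e v u]) x y -> P U e A x y.
Hypothesis P_single : forall e A x, irreflexive e -> P [set x] e A x x.

(* [nice_near] is the graph minus the apex [a], with boundary the neighbours of [a];
   the removal of [a] replaces the outer face of a plane near-triangulation. *)
Definition nice_near U : Prop := forall e a x y, symmetric e -> irreflexive e ->
  planar U e -> a \in U -> x \in U -> y \in U -> e a x -> e a y -> x = y \/ e x y ->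
  P (U :\ a) e [set u | e a u] x y.

Definition nice_far U : Prop := forall e x y, symmetric e -> irreflexive e ->
  planar U e -> x \in U -> y \in U -> x = y \/ e x y -> P U e set0 x y.

(** Without an apex, [x] itself becomes one, with a neighbour [z] as sink. If [x] is isolated, it is
    glued to the rest as a separate component. *)
Lemma far_of_near U : nice_near U -> (forall U', #|U'| < #|U| -> nice_far U') -> nice_far U.
Proof.
move=> near far e x y se ie pl xU yU xy.
case: (boolP [exists z in U, e x z]) => [|nz].
  case/exists_inP => z0 z0U exz0.
  have [z [zU exz yz]] : exists z, [/\ z \in U, e x z & y = z \/ y = x].
    by case: xy => [xy|exy]; [exists z0|exists y]; split; auto.
  by apply: (P_sink se ie xU zU exz yz); apply: near => //; left.
have xy' : x = y.
  by case: xy => // exy; case/exists_inP: nz; exists y.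
rewrite -xy' {yU xy xy' y}; case: (set_0Vmem (U :\ x)) => [Ux|[z zUx]].
  by rewrite (_ : U = [set x]); [exact: P_single | rewrite -(setD1K xU) Ux setU0].
rewrite -(setD1K xU); apply: (P_glue (p := z) (q := z)) => //; try exact: set11.
- by move=> u; rewrite !inE => /eqP->; rewrite eqxx.
- by left.
- move=> u v; rewrite !inE => /andP[_ /eqP->] /and3P[_ _ vU].
  by apply: contra nz => exv; apply/exists_inP; exists v.
- exact: P_single.
apply: far => //; last by left.
  by rewrite (cardsD1 x U) xU.
by apply: sub_planar pl => //; exact: subsetDl.
Qed.

(** The side [Z :|: S] keeps [x] and [y]; the other side is used with sinks [p] and [q], so it adds
    nothing on the separator. *)
Lemma side_glue G S Z e A x y p q : symmetric e -> irreflexive e -> S \subset G ->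
  Z \subset G :\: S -> ~~ adj e Z (G :\: S :\: Z) -> S \subset [set p; q] ->
  p \in G :\: Z -> q \in G :\: Z -> p = q \/ p \in S /\ q \in S ->
  x \in Z :|: S -> y \in Z :|: S ->
  P (Z :|: S) e A x y -> P (G :\: Z) e A p q -> P G e A x y.
Proof.
move=> se ie /subsetP SG /subsetP ZG nadj /subsetP Spq pU qU pq xZ yZ P1 P2.
have -> : G = (Z :|: S) :|: (G :\: Z).
  apply/setP => u; rewrite in_setU in_setD in_setU; case: (boolP (u \in Z)) => [/ZG|_] /=.
    by rewrite inE => /andP[].
  by case: (boolP (u \in S)) => [/SG|].
apply: (P_glue (p := p) (q := q)) => //.
- move=> u; rewrite in_setU in_setD => /orP[->//|uS _]; exact: Spq.
- by case: pq => [|[pS qS]]; [left|right; rewrite !in_setU pS qS !orbT].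
move=> u v; rewrite !in_setD !in_setU negb_and negbK negb_or => /andP[uGZ uZS].
move=> /andP[/andP[vZ vS] /andP[_ vG]]; apply: contra nadj => euv; apply/adjP; exists u, v.
rewrite !in_setD vZ vS vG; split=> //; case/orP: uGZ => // uG.
by case/orP: uZS => // /SG; rewrite (negPf uG).
Qed.

Lemma side_choose G S X e x y : symmetric e -> x \in G -> y \in G -> x = y \/ e x y ->
  X \subset G :\: S -> X != set0 -> X != G :\: S -> ~~ adj e X (G :\: S :\: X) ->
  exists Z : {set V}, [/\ [/\ Z \subset G :\: S, Z != set0 & ~~ adj e Z (G :\: S :\: Z)],
    exists2 t, t \in G & t \notin Z :|: S, x \in Z :|: S & y \in Z :|: S].
Proof.
move=> se xG yG xy XG X0 XnG nadj.
have [Z [[ZG Z0 ZnG nZ] xZ yZ]] := choose_side se XG X0 XnG nadj xG yG xy.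
exists Z; split=> //.
have [t] : exists t, t \in G :\: S :\: Z.
  by apply/set0Pn; rewrite setD_eq0; apply: contra ZnG => GZ; rewrite eqEsubset ZG.
by rewrite 2!in_setD => /and3P[tZ tS tG]; exists t => //; rewrite inE negb_or tZ.
Qed.

(** * The induction step at an apex *)

Section Near.
Variables (U : {set V}) (e : rel V) (a x y : V).
Hypotheses (IHnear : forall U', #|U'| < #|U| -> nice_near U')
  (IHfar : forall U', #|U'| < #|U| -> nice_far U').
Hypotheses (se : symmetric e) (ie : irreflexive e) (pl : planar U e)
  (aU : a \in U) (xU : x \in U) (yU : y \in U) (ax : e a x) (ay : e a y)
  (xy : x = y \/ e x y).
Let G := U :\ a.
Let A : {set V} := [set u | e a u].

Let neq p q : e p q -> p != q.
Proof. by move=> epq; apply: contraTneq epq => ->; rewrite ie. Qed.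
Let xG : x \in G. Proof. by rewrite !inE eq_sym neq. Qed.
Let yG : y \in G. Proof. by rewrite !inE eq_sym neq. Qed.

Let smaller B t : B \subset G -> t \in G -> t \notin B -> #|a |: B| < #|U|.
Proof.
move=> /subsetP BG tG tB; apply: proper_card; apply/properP; split.
  by rewrite subUset sub1set aU; apply/subsetP => z /BG; rewrite inE => /andP[].
exists t; first by move: tG; rewrite inE => /andP[].
by rewrite !inE (negPf tB) orbF; move: tG; rewrite !inE => /andP[].
Qed.

Let near_sub B t p q : B \subset G -> t \in G -> t \notin B -> p \in B -> q \in B ->
  e a p -> e a q -> p = q \/ e p q -> P B e A p q.
Proof.
move=> BG tG tB pB qB ap aq pq; have aB : a \notin B.
  by apply/negP => /(subsetP BG); rewrite !inE eqxx.
rewrite -(setU1K aB); apply: (IHnear (smaller BG tG tB)) => //.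
- apply: sub_planar pl => //; rewrite subUset sub1set aU.
  by apply/subsetP => z /(subsetP BG); rewrite inE => /andP[].
- exact: setU11.
- by rewrite inE pB orbT.
by rewrite inE qB orbT.
Qed.

Lemma near_disconnected : ~~ conn e G -> P G e A x y.
Proof.
have G0 : G != set0 by apply/set0Pn; exists x.
case/(not_conn G0) => X [XG X0 XnG nadj].
have := @side_choose G set0 X e x y se xG yG xy; rewrite setD0 => -[] // Z [[ZG Z0 nZ] [t tG tZ] xZ yZ].
have tGZ : t \in G :\: Z by move: tZ; rewrite setU0 inE tG andbT.
rewrite setU0 in tZ xZ yZ.
have [w [wGZ P2]] : exists w, w \in G :\: Z /\ P (G :\: Z) e A w w.
  (* The sink of the second side has to be a neighbour of [a]; if there is none on that side, its
     boundary is empty and the hypothesis without apex applies. *)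
  case: (set_0Vmem (A :&: (G :\: Z))) => [A0|[w]].
    exists t; split=> //; have Pt : P (G :\: Z) e set0 t t.
      apply: IHfar => //; last by left.
      - by apply: leq_ltn_trans (subset_leq_card (subsetDl G Z)) _; rewrite [X in _ < X](cardsD1 a) aU ltnSn.
      - by apply: sub_planar pl => //; apply: subset_trans (subsetDl _ _) (subsetDl _ _).
    by apply: P_mono Pt _ _ _ => // u uA uGZ; have := in_set0 u; rewrite -A0 inE uA uGZ.
  rewrite inE => /andP[]; rewrite inE => aw wGZ; exists w; split=> //.
  apply: (@near_sub _ x) => //; first exact: subsetDl.
    by rewrite inE xZ.
  by left.
apply: (@side_glue G set0 Z e A x y w w); rewrite ?sub0set ?setD0 ?setU0 //; first by left.
exact: (@near_sub _ t).
Qed.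

(** The cut vertex [p] need not be a neighbour of [a]. If it is not, the side [Z] contains the
    neighbour [x], and contracting [Z] into [p] creates the edge [ap]. *)
Lemma near_cut_vertex p : conn e G -> p \in G -> G :\ p != set0 -> ~~ conn e (G :\ p) ->
  P G e A x y.
Proof.
move=> cG pG G0; case/(not_conn G0) => X [XG X0 XnG nadj].
have [Z [[ZG Z0 nZ] [t tG tZ] xZ yZ]] := @side_choose G [set p] X e x y se xG yG xy XG X0 XnG nadj.
have pZ : p \notin Z by apply/negP => /(subsetP ZG); rewrite !inE eqxx.
have ZG' : Z \subset G := subset_trans ZG (subsetDl _ _).
have pGZ : p \in G :\: Z by rewrite inE pZ.
have [z zZ] := set0Pn _ Z0.
apply: (@side_glue G [set p] Z e A x y p p) => //.
- by rewrite sub1set.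
- by rewrite sub1set set21.
- by left.
- by apply: (@near_sub _ t) => //; rewrite subUset ZG' sub1set.
case: (boolP (e a p)) => ap.
  apply: (@near_sub _ z) => //; [exact: subsetDl|exact: (subsetP ZG')|by rewrite inE zZ|by left].
have xZ' : x \in Z by move: xZ; rewrite !inE => /orP[//|/eqP xp]; move: ap; rewrite -xp ax.
pose e' := [rel u v | e u v || (u == a) && (v == p) || (u == p) && (v == a)].
have [npa pU] : p != a /\ p \in U by move: pG; rewrite !inE => /andP[].
have aGZ : a \notin G :\: Z by rewrite !inE eqxx andbF.
have Pp : P ((a |: (G :\: Z)) :\ a) e' [set u | e' a u] p p.
  apply: (@IHnear (a |: (G :\: Z))); rewrite ?inE ?eqxx ?orbT //.
  - apply: (@smaller _ z); [exact: subsetDl|exact: (subsetP ZG')|by rewrite inE zZ].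
  - by move=> u v /=; rewrite se ![_ && (u == _)]andbC -!orbA; congr (_ || _); rewrite orbC.
  - by move=> u /=; rewrite ie [_ && (u == p)]andbC orbb; apply/negP => /andP[/eqP->]; rewrite (negPf npa).
  - apply: (@absorb_planar _ U _ Z e e' p) => //.
    + by rewrite subUset sub1set aU; apply/subsetP => u; rewrite !inE => /and3P[].
    + by apply: subset_trans ZG' _; exact: subsetDl.
    + by rewrite !inE pZ npa pU orbT.
    + rewrite disjoint_setU1l; apply/andP; split.
        by apply/negP => /(subsetP ZG'); rewrite !inE eqxx.
      by apply: disjointI => u; rewrite inE => /andP[/negP].
    + exact: conn_side nZ.
    + move=> u v _ _ /= /orP[/orP[|]|]; first by constructor 1.
        move=> /andP[/eqP-> /eqP->]; constructor 3; split=> //.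
        by apply/adjP; exists x, a; rewrite !inE xZ' orbT eqxx se.
      move=> /andP[/eqP-> /eqP->]; constructor 2; split=> //.
      by apply/adjP; exists x, a; rewrite !inE xZ' orbT eqxx se.
  - by rewrite ?inE npa pU pZ ?orbT.
  - by rewrite ?inE npa pU pZ ?orbT.
  - by rewrite /= !eqxx orbT.
  - by rewrite /= !eqxx orbT.
  by left.
rewrite setU1K // in Pp; apply: P_mono Pp _ _ _ => //.
  by move=> u v _ _ /= ->.
by move=> u; rewrite !inE /= => -> _; rewrite orbT.
Qed.

Lemma near_chord v w : v \in G -> w \in G -> e a v -> e a w -> e v w ->
  G :\ v :\ w != set0 -> ~~ conn e (G :\ v :\ w) -> P G e A x y.
Proof.
have GE : G :\ v :\ w = G :\: [set v; w].
  by apply/setP => u; rewrite !inE negb_or andbA [(u != w) && _]andbC.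
move=> vG wG av aw evw; rewrite GE => G0; case/(not_conn G0) => X [XG X0 XnG nadj].
have [Z [[ZG Z0 nZ] [t tG tZ] xZ yZ]] := side_choose se xG yG xy XG X0 XnG nadj.
have ZG' : Z \subset G := subset_trans ZG (subsetDl _ _).
have vZ : v \notin Z by apply/negP => /(subsetP ZG); rewrite !inE eqxx.
have wZ : w \notin Z by apply/negP => /(subsetP ZG); rewrite !inE eqxx orbT.
have [z zZ] := set0Pn _ Z0.
have vwG : [set v; w] \subset G by rewrite subUset !sub1set vG.
apply: (@side_glue G [set v; w] Z e A x y v w) => //; try by rewrite inE ?vZ ?wZ.
- by right; rewrite !inE !eqxx orbT.
- by apply: (@near_sub _ t) => //; rewrite subUset ZG'.
apply: (@near_sub _ z) => //.
- exact: subsetDl.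
- exact: (subsetP ZG').
- by rewrite inE zZ.
- by rewrite inE vZ.
- by rewrite inE wZ.
by right.
Qed.

(** After the contraction of [av] the neighbours of [a] are the old ones without [v] together with
    those of [v], which is the boundary that [P_vertex] requires. *)
Lemma near_contract v w : v \in G -> e a v -> v != x -> v != y -> w \in G ->
  (forall u, u \in G -> e a u -> e v u -> u \in [set x; w]) -> P G e A x y.
Proof.
move=> vG av vx vy wG Nv; apply: (P_vertex (w := w) se ie vG _ _ vx vy wG); rewrite ?inE //.
  by move=> u uG; rewrite inE; exact: Nv.
have vU : v \in U by move: vG; rewrite inE => /andP[].
have nva : v != a by move: vG; rewrite !inE => /andP[].
pose e' := [rel s t | e s t || (s == a) && (t != a) && e v t || (t == a) && (s != a) && e v s].
have Pv : P (U :\ v :\ a) e' [set u | e' a u] x y.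
  apply: (@IHnear (U :\ v)); rewrite ?inE ?eqxx ?ax ?ay //= ?(eq_sym a) ?(eq_sym x) ?(eq_sym y) ?nva ?vx ?vy //.
  - by rewrite [X in _ < X](cardsD1 v) vU.
  - by move=> s t /=; rewrite se -!orbA; congr (_ || _); rewrite orbC.
  - by move=> s /=; rewrite ie; case: eqP.
  - apply: (@absorb_planar _ U _ [set v] e e' a) => //.
    + exact: subsetDl.
    + by rewrite sub1set.
    + by rewrite !inE eq_sym nva.
    + by rewrite disjoint_sym disjoints1 !inE eqxx.
    + apply: connU => //; try exact: conn1.
      by left; apply/adjP; exists a, v; rewrite !inE !eqxx.
    + move=> s t _ _ /= /orP[/orP[|]|]; first by constructor 1.
        move=> /andP[/andP[/eqP-> _] evt]; constructor 2; split=> //.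
        by apply/adjP; exists v, t; rewrite !inE !eqxx orbT.
      move=> /andP[/andP[/eqP-> _] evt]; constructor 3; split=> //.
      by apply/adjP; exists v, s; rewrite !inE !eqxx orbT.
  - by rewrite ax.
  - by rewrite ay.
  - by case: xy => [->|exy]; [left|right; rewrite /= exy].
have -> : G :\ v = U :\ v :\ a by apply/setP => u; rewrite !inE andbCA.
apply: P_mono Pv _ _ _ => //; first by move=> s t _ _ /= ->.
move=> u; rewrite !inE eqxx /= => + /andP[-> _] /=.
by case/orP => ->; rewrite ?orbT.
Qed.

End Near.

Lemma near_step U : (forall U', #|U'| < #|U| -> nice_near U') ->
  (forall U', #|U'| < #|U| -> nice_far U') -> nice_near U.
Proof.
move=> IHn IHf e a x y se ie pl aU xU yU ax ay xy.
have neq p q : e p q -> p != q by move=> epq; apply: contraTneq epq => ->; rewrite ie.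
have [yx Pswap] : (y = x \/ e y x) /\
    (P (U :\ a) e [set u | e a u] y x -> P (U :\ a) e [set u | e a u] x y).
  by split; [case: xy => [->|]; [left|rewrite se; right] | exact: P_sym].
have xG : x \in U :\ a by rewrite !inE eq_sym neq.
have yG : y \in U :\ a by rewrite !inE eq_sym neq.
case: (boolP (conn e (U :\ a))) => [cG|ncG]; last exact: near_disconnected ncG.
case: (boolP [exists p in U :\ a, (U :\ a :\ p != set0) && ~~ conn e (U :\ a :\ p)]) => [|nocut].
  by case/exists_inP => p pG /andP[G0 nc]; exact: near_cut_vertex cG pG G0 nc.
case: (boolP [exists v in U :\ a, [exists w in U :\ a, [&& e a v, e a w, e v w,
    U :\ a :\ v :\ w != set0 & ~~ conn e (U :\ a :\ v :\ w)]]]) => [|nochord].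
  case/exists_inP => v vG /exists_inP[w wG /and5P[av aw evw G0 nc]].
  exact: near_chord vG wG av aw evw G0 nc.
have conn1' p z : p \in U :\ a -> z \in U :\ a -> z != p -> conn e (U :\ a :\ p).
  move=> pG zG zp; apply: contraR nocut => nc; apply/exists_inP; exists p => //.
  by rewrite nc andbT; apply/set0Pn; exists z; rewrite in_setD1 zp.
have conn2 v w z : v \in U :\ a -> w \in U :\ a -> e a v -> e a w -> e v w ->
    z \in U :\ a -> z != v -> z != w -> conn e (U :\ a :\ v :\ w).
  move=> vG wG av aw evw zG zv zw; apply: contraR nochord => nc.
  apply/exists_inP; exists v => //; apply/exists_inP; exists w => //.
  by rewrite av aw evw nc andbT /=; apply/set0Pn; exists z; rewrite 2!in_setD1 zw zv.
pose N v := [set u in U :\ a | e a u && e v u].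
have N2 v : v \in U :\ a -> e a v -> #|N v| <= 2.
  move=> vG av; rewrite leqNgt; apply/negP => /card_gt2P[w1 [w2 [w3 [[+ + +] [w12 w23 w31]]]]].
  rewrite ![_ \in N v]inE => /and3P[w1G aw1 vw1] /and3P[w2G aw2 vw2] /and3P[w3G aw3 vw3].
  have [k33 k5] := pl.
  have [|||//|//] := three_neighbours se ie aU vG w1G w2G w3G av aw1 aw2 aw3 vw1 vw2 vw3 w12 w23 w31 _ _ _.
  - by apply: (@conn2 v w1 w2); rewrite // eq_sym // neq.
  - by apply: (@conn2 v w2 w3); rewrite // eq_sym // neq.
  - by apply: (@conn2 v w3 w1); rewrite // eq_sym // neq.
have pair v z : v \in U :\ a -> e a v -> z \in N v -> exists2 w, w \in U :\ a &
    forall u, u \in U :\ a -> e a u -> e v u -> u \in [set z; w].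
  move=> vG av zN; case: (set_0Vmem (N v :\ z)) => [N0|[w]].
    exists z => [|u uG au vu]; first by move: zN; rewrite inE => /andP[].
    apply: contraT; rewrite !inE orbb => uz; have := in_set0 u.
    by rewrite -N0 in_setD1 uz inE uG au vu.
  rewrite in_setD1 => /andP[wz wN]; exists w => [|u uG au vu].
    by move: wN; rewrite inE => /andP[].
  apply: contraLR (N2 v vG av); rewrite !inE negb_or => /andP[uz uw].
  rewrite -ltnNge; apply/card_gt2P; exists z, w, u; split; first by split; rewrite // inE uG au.
  by split; rewrite // eq_sym.
pose B := [set v in U :\ a | [&& e a v, v != x & v != y]].
have BP v : v \in B -> [/\ v \in U :\ a, e a v, v != x & v != y].
  by rewrite inE => /and4P[].
(* With no boundary vertex besides [x] and [y], an empty boundary says as much, because sinks obey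
   every bound. *)
case: (set_0Vmem B) => [B0|[b bB]].
  have Pf : P (U :\ a) e set0 x y.
    apply: IHf => //; first by rewrite [X in _ < X](cardsD1 a) aU.
    by apply: sub_planar pl => //; exact: subsetDl.
  apply: P_mono Pf _ _ _ => // u; rewrite inE => au uG; apply: contraT.
  rewrite setU0 in_set2 negb_or => /andP[ux uy].
  by have : u \in B; [rewrite inE uG au ux | rewrite B0 inE].
(* A vertex adjacent to [x] has at most one other boundary neighbour, which serves as [w]. *)
case: (boolP [exists v in B, e v x]) => [|nBx].
  case/exists_inP => v /BP[vG av vx vy] evx.
  have [|w wG wN] := pair v x vG av; first by rewrite inE xG ax.
  exact: (@near_contract U e a x y IHn se ie pl aU xU yU ax ay xy v w).
case: (boolP [exists v in B, e v y]) => [|nBy].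
  case/exists_inP => v /BP[vG av vx vy] evy.
  have [|w wG wN] := pair v y vG av; first by rewrite inE yG ay.
  by apply: Pswap; exact: (@near_contract U e a y x IHn se ie pl aU yU xU ay ax yx v w).
case: (boolP [exists v in B, #|N v| <= 1]) => [|N1].
  case/exists_inP => v /BP[vG av vx vy] Nv.
  have [w wG wN] : exists2 w, w \in U :\ a &
      forall u, u \in U :\ a -> e a u -> e v u -> u \in [set x; w].
    case: (set_0Vmem (N v)) => [N0|[z zN]].
      exists x => // u uG au vu; have := in_set0 u; by rewrite -N0 inE uG au vu.
    exists z => [|u uG au vu]; first by move: zN; rewrite inE => /andP[].
    by rewrite (card_le1_eqP Nv u z _ zN) ?set22 // inE uG au.
  exact: (@near_contract U e a x y IHn se ie pl aU xU yU ax ay xy v w).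
(* Every vertex of [B] now has two boundary neighbours, and since [x] and [y] are not among them,
   both lie in [B]. *)
have [||c [uc sc cyc cB]] := @find_cycle _ e B se ie.
- by apply/set0Pn; exists b.
- move=> v vB; have : 1 < #|N v|.
    by rewrite ltnNge; apply: contra N1 => Nv; apply/exists_inP; exists v.
  move/leq_trans; apply; apply: subset_leq_card; apply/subsetP => u.
  rewrite [u \in N v]inE => /and3P[uG au vu]; rewrite !(inE, vu) au andbT /=.
  move: uG; rewrite !inE => /andP[-> ->] /=; apply/andP; split.
    by apply: contraNneq nBx => ux; apply/exists_inP; exists v; rewrite // -ux.
  by apply: contraNneq nBy => uy; apply/exists_inP; exists v; rewrite // -uy.
have cP z : z \in c -> [/\ z \in U :\ a, e a z & z != x] by move/cB/BP => [].
have [k33 k5] := pl.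
have [||||//|//] := @ring_obstruction _ U e a x c se ie aU uc sc cyc _ xU ax _ cG.
- by move=> z /cP[]; rewrite !inE => /andP[_ ->].
- by apply/negP => /cP[_ _]; rewrite eqxx.
- by move=> p /cP[pG _ px]; apply: (conn1' p x); rewrite // eq_sym.
- by move=> p q /cP[pG ap px] /cP[qG aq qx] epq; apply: (conn2 p q x); rewrite // eq_sym.
Qed.

Theorem planar_nice U : nice_far U.
Proof.
suff: nice_near U /\ nice_far U by case.
elim: {U}_.+1 {-2}U (ltnSn #|U|) => // n IH U; rewrite ltnS => Un.
have IHn U' : #|U'| < #|U| -> nice_near U' by move=> UU; apply: (IH U' _).1; exact: leq_trans UU Un.
have IHf U' : #|U'| < #|U| -> nice_far U' by move=> UU; apply: (IH U' _).2; exact: leq_trans UU Un.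
have near := near_step IHn IHf.
by split=> //; exact: far_of_near near IHf.
Qed.

(** Used for K5 with [x = y]: a second sink is chosen there, and its edge to [x] is put back
    afterwards. *)
Hypothesis P_addedge : forall U e A x y, symmetric e -> irreflexive e ->
  x \in U -> y \in U -> e x y -> P U e A x y -> P U e A x x.
Hypothesis P_K5 : forall U e x y, symmetric e -> irreflexive e -> #|U| = 5 ->
  {in U &, forall u v, u != v -> e u v} -> x \in U -> y \in U -> x != y -> P U e set0 x y.

(** [U :\ p] is connected and [X] has no neighbour in the rest but [q]; so [q] is adjacent to [X],
    and contracting [X] into [p] produces the edge [pq]. *)
Lemma cut_minor U e p q X : symmetric e -> p \in U -> q \in U -> p != q ->
  conn e (U :\ p) -> conn e (U :\ q) -> X \subset U :\: [set p; q] -> X != set0 ->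
  ~~ adj e X (U :\: [set p; q] :\: X) -> ~ has_K33 U e ->
  ~ has_K33 (U :\: X) (add_edge e p q).
Proof.
move=> se pU qU pq cp cq XU X0 nadj noK33 K33; apply: noK33.
have pX : p \notin X by apply/negP => /(subsetP XU); rewrite !inE eqxx.
have qX : q \notin X by apply/negP => /(subsetP XU); rewrite !inE eqxx orbT.
have cX : conn e (p |: X).
  have UE : U :\: [set p; q] = U :\ q :\ p.
    by apply/setP => u; rewrite !inE negb_or andbA.
  by apply: (@conn_side _ e (U :\ q)); rewrite -?UE // !inE pq.
have aq : adj e (p |: X) [set q].
  have /connP[_ cUp] := cp; have [|||u [v [uX vU vX euv]]] := cUp X.
  - apply/subsetP => u /(subsetP XU); rewrite !inE negb_or => /andP[/andP[-> _] ->] //.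
  - by [].
  - by apply: contraNneq qX => ->; rewrite !inE eq_sym pq.
  case: (eqVneq v q) => [vq|vq]; first by apply/adjP; exists u, v; rewrite vq !inE uX orbT eqxx -vq.
  case/negP: nadj; apply/adjP; exists u, v; split=> //.
  by move: vU; rewrite !inE (negPf vX) (negPf vq) orbF.
apply: absorb_K33 se _ _ _ _ cX _ K33.
- exact: subsetDl.
- by apply: subset_trans XU (subsetDl _ _).
- by rewrite inE pX.
- by apply: disjointI => u; rewrite inE => /andP[/negP].
move=> u v _ _ /orP[|]; first by constructor 1.
by rewrite eq_set2 => /orP[]/andP[/eqP-> /eqP->]; [constructor 2|constructor 3].
Qed.

Definition nice_free U : Prop := forall e x y, symmetric e -> irreflexive e ->
  ~ has_K33 U e -> x \in U -> y \in U -> x = y \/ e x y -> P U e set0 x y.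

Theorem K33_free_nice U : nice_free U.
Proof.
have [n] := ubnP #|U|; elim: n U => // n IHn U; rewrite ltnS => Un.
have IH U' t : t \in U -> t \notin U' -> U' \subset U -> nice_free U'.
  move=> tU tU' U'U; apply: IHn; apply: leq_trans Un; apply: proper_card.
  by apply/properP; split=> //; exists t.
move=> e x y se ie noK33 xU yU xy.
have sub U' : U' \subset U -> ~ has_K33 U' e.
  by move=> U'U K33; apply: noK33; exact: sub_K33 K33.
have U0 : U != set0 by apply/set0Pn; exists x.
case: (boolP (conn e U)) => [cU|]; last first.
  case/(not_conn U0) => X [XU X0 XnU nadj].
  have := @side_choose U set0 X e x y se xU yU xy; rewrite setD0 => -[] //.
  move=> Z [[ZU Z0 nZ] [t tU tZ] xZ yZ]; rewrite setU0 in tZ xZ yZ.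
  have [z zZ] := set0Pn _ Z0.
  apply: (@side_glue U set0 Z e set0 x y t t); rewrite ?sub0set ?setD0 ?setU0 //.
  - by rewrite inE tZ.
  - by rewrite inE tZ.
  - by left.
  - by apply: (IH Z t) => //; exact: sub.
  have tUZ : t \in U :\: Z by rewrite inE tZ.
  apply: (IH (U :\: Z) z) => //; first exact: (subsetP ZU).
  + by rewrite inE zZ.
  + exact: subsetDl.
  + by apply: sub; exact: subsetDl.
  + by left.
case: (boolP [exists p in U, (U :\ p != set0) && ~~ conn e (U :\ p)]) => [|nocut].
  case/exists_inP => p pU /andP[Up0]; case/(not_conn Up0) => X [XU X0 XnU nadj].
  have [Z [[ZU Z0 nZ] [t tU tZ] xZ yZ]] := @side_choose U [set p] X e x y se xU yU xy XU X0 XnU nadj.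
  have [z zZ] := set0Pn _ Z0; have ZU' : Z \subset U := subset_trans ZU (subsetDl _ _).
  have pZ : p \notin Z by apply/negP => /(subsetP ZU); rewrite !inE eqxx.
  have pUZ : p \in U :\: Z by rewrite inE pZ.
  have ZpU : Z :|: [set p] \subset U by rewrite subUset ZU' sub1set.
  apply: (@side_glue U [set p] Z e set0 x y p p); rewrite ?sub1set //; try exact: set21.
  - by left.
  - by apply: (IH _ t) => //; exact: sub.
  apply: (IH (U :\: Z) z) => //; first exact: (subsetP ZU').
  + by rewrite inE zZ.
  + exact: subsetDl.
  + by apply: sub; exact: subsetDl.
  + by left.
have c1 p z : p \in U -> z \in U -> z != p -> conn e (U :\ p).
  move=> pU zU zp; apply: contraR nocut => nc; apply/exists_inP; exists p => //.
  by rewrite nc andbT; apply/set0Pn; exists z; rewrite in_setD1 zp.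
case: (boolP [exists p in U, [exists q in U, [&& p != q, U :\: [set p; q] != set0 &
    ~~ conn e (U :\: [set p; q])]]]) => [|no2cut].
  case/exists_inP => p pU /exists_inP[q qU /and3P[pq Upq0]].
  case/(not_conn Upq0) => X [XU X0 XnU nadj].
  have [Z [[ZU Z0 nZ] [t tU tZ] xZ yZ]] := @side_choose U [set p; q] X e x y se xU yU xy XU X0 XnU nadj.
  have [z zZ] := set0Pn _ Z0; have ZU' : Z \subset U := subset_trans ZU (subsetDl _ _).
  have pZ : p \notin Z by apply/negP => /(subsetP ZU); rewrite !inE eqxx.
  have qZ : q \notin Z by apply/negP => /(subsetP ZU); rewrite !inE eqxx orbT.
  have cp : conn e (U :\ p) by apply: (c1 p q); rewrite // eq_sym.
  have cq : conn e (U :\ q) by apply: (c1 q p).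
  (* Both sides are taken with the edge [pq], since the attached side needs its two sinks adjacent;
     [P_mono] discards the edge again. *)
  pose e' := add_edge e p q.
  have se' : symmetric e' by move=> u v; rewrite /e' /add_edge se setUC.
  have ie' : irreflexive e'.
    move=> u; rewrite /e' /add_edge ie eq_set2 /=; apply/negP => /orP[]/andP[/eqP uE].
      by rewrite uE (negPf pq).
    by rewrite uE eq_sym (negPf pq).
  pose Y := U :\: [set p; q] :\: Z.
  have YU : Y \subset U :\: [set p; q] by exact: subsetDl.
  have ZpqE : Z :|: [set p; q] = U :\: Y.
    apply/setP => u; rewrite in_setU 3!in_setD negb_and negbK negb_and.
    case: (boolP (u \in Z)) => uZ /=; first by rewrite (subsetP ZU').
    case: (boolP (u \in [set p; q])) => upq /=.
      by move: upq; rewrite !inE => /orP[]/eqP->; rewrite ?pU ?qU.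
    by case: (u \in U).
  have nYZ : ~~ adj e Y (U :\: [set p; q] :\: Y).
    by rewrite /Y setDDr setDv set0U (setIidPr ZU) adj_sym.
  have tY : t \in Y.
    by move: tZ; rewrite inE negb_or => /andP[tZ tpq]; rewrite 2!in_setD tZ tpq.
  have K1 : ~ has_K33 (U :\: Y) e'.
    by apply: cut_minor => //; apply/set0Pn; exists t.
  have K2 : ~ has_K33 (U :\: Z) e' by exact: cut_minor.
  have pUZ : p \in U :\: Z by rewrite inE pZ.
  have qUZ : q \in U :\: Z by rewrite inE qZ.
  suff Pe' : P U e' set0 x y.
    by apply: P_mono Pe' se _ _ => [u v _ _ euv|u]; rewrite ?inE // /e' /add_edge euv.
  apply: (@side_glue U [set p; q] Z e' set0 x y p q) => //.
  - by rewrite subUset !sub1set pU.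
  - apply/adjP => -[u [v [uZ vR euv]]]; case/negP: nZ; apply/adjP; exists u, v; split=> //.
    case/orP: euv => //; rewrite eq_set2 => /orP[]/andP[/eqP uE _]; move: uZ; rewrite uE.
      by rewrite (negPf pZ).
    by rewrite (negPf qZ).
  - by right; rewrite !inE !eqxx orbT.
  - rewrite ZpqE; apply: (IH _ t) => //.
    + by rewrite inE tY.
    + exact: subsetDl.
    + by rewrite -ZpqE.
    + by rewrite -ZpqE.
    by case: xy => [|exy]; [left|right; rewrite /e' /add_edge exy].
  apply: (IH _ z) => //.
  - exact: (subsetP ZU').
  - by rewrite inE zZ.
  - exact: subsetDl.
  by right; rewrite /e' /add_edge eqxx orbT.
have c2 p q : p \in U -> q \in U -> p != q -> U :\ p :\ q != set0 -> conn e (U :\ p :\ q).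
  have -> : U :\ p :\ q = U :\: [set p; q].
    by apply/setP => u; rewrite !inE negb_or andbA [(u != q) && _]andbC.
  move=> pU qU pq Upq0; apply: contraR no2cut => nc; apply/exists_inP; exists p => //.
  by apply/exists_inP; exists q; rewrite // pq Upq0.
have K5_or : has_K5 U e \/ ~ has_K5 U e by exact: classic.
case: K5_or => [K5|noK5]; last exact: planar_nice.
have [card5 complete] := three_connected_K5 se noK33 cU c2 K5.
case: xy => [<-|exy]; last first.
  by apply: P_K5 => //; apply: contraTneq exy => ->; rewrite ie.
have [y' y'Ux] : exists y', y' \in U :\ x.
  by apply/set0Pn; rewrite -card_gt0; move: card5; rewrite (cardsD1 x) xU add1n => -[->].
move: y'Ux; rewrite in_setD1 => /andP[y'x y'U].
have exy' : e x y' by apply: complete => //; rewrite eq_sym.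
by apply: (P_addedge se ie xU y'U exy'); apply: P_K5 => //; rewrite eq_sym.
Qed.

End Induction.

Import GRing.Theory Num.Theory Order.TTheory.

(** * Coefficients of the graph polynomial *)

Section Coefficients.
Local Open Scope ring_scope.
Variable V : finType.
Implicit Types (l : seq (V * V)) (d m : {ffun V -> int}) (u v : V).

Definition unit_expo u : {ffun V -> int} := [ffun v => (v == u)%:Z].

(* Stated at type [int]: after [rewrite ffunE] the operations are those of an
   abstract [zmodType], which [lia] does not recognise. *)
Lemma expo_addE d m v : (d + m) v = d v + m v :> int.
Proof. by rewrite ffunE. Qed.

Lemma expo_subE d m v : (d - m) v = d v - m v :> int.
Proof. by rewrite !ffunE. Qed.

Lemma unit_expoE u v : unit_expo u v = (v == u)%:Z :> int.
Proof. by rewrite ffunE. Qed.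

Lemma sum_unit_expoE (s : seq V) v : uniq s ->
  (\sum_(u <- s) unit_expo u) v = (v \in s)%:Z :> int.
Proof.
move=> us; rewrite sum_ffunE; under eq_bigr do rewrite ffunE.
case: (boolP (v \in s)) => vs.
  rewrite (bigD1_seq v) //= eqxx big1 // => w /negPf.
  by rewrite eq_sym => ->.
by rewrite big1_seq // => w /= ws; case: eqVneq vs => // ->; rewrite ws.
Qed.

Definition expoE := (expo_subE, expo_addE, unit_expoE).

(* The coefficient of [\prod_v v ^+ d v] in [\prod_(a <- l) (a.1 - a.2)]. *)
Fixpoint coef l d : int :=
  if l is a :: l' then coef l' (d - unit_expo a.1) - coef l' (d - unit_expo a.2)
  else (d == 0)%:Z.

Lemma coef_cons_neq0 a l d : coef (a :: l) d != 0 ->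
  coef l (d - unit_expo a.1) != 0 \/ coef l (d - unit_expo a.2) != 0.
Proof.
rewrite /=; case: (eqVneq (coef l (d - unit_expo a.1)) 0) => [->|]; last by left.
by rewrite sub0r oppr_eq0; right.
Qed.

Lemma coef_bounds l d v : coef l d != 0 ->
  0 <= d v <= (count (fun a => (a.1 == v) || (a.2 == v)) l)%:Z.
Proof.
elim: l d => [|a l IH] d.
  by rewrite /=; case: (eqVneq d 0) => // -> _; rewrite ffunE.
case/coef_cons_neq0 => /IH; rewrite !ffunE /= (eq_sym v).
  by case: eqVneq => /= _; lia.
by rewrite orbC; case: eqVneq => /= _; lia.
Qed.

Lemma coef_ge0 l d v : coef l d != 0 -> 0 <= d v.
Proof. by move/(coef_bounds v)/andP=> []. Qed.

Lemma coef_negative l d v : d v < 0 -> coef l d = 0.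
Proof. by move=> dv; apply: contraTeq dv => /(coef_ge0 v); rewrite -leNgt. Qed.

Lemma coef_too_large l d v :
  (count (fun a => (a.1 == v) || (a.2 == v)) l)%:Z < d v -> coef l d = 0.
Proof. by move=> dv; apply: contraTeq dv => /(coef_bounds v)/andP[_]; rewrite -leNgt. Qed.

Lemma sum_unit_expo u : \sum_v unit_expo u v = 1.
Proof.
rewrite (bigD1 u) //= big1 ?addr0 ?ffunE ?eqxx // => v /negPf nvu.
by rewrite ffunE nvu.
Qed.

Lemma coef_total l d : coef l d != 0 -> \sum_v d v = (size l)%:Z.
Proof.
elim: l d => [|a l IH] d.
  by rewrite /=; case: (eqVneq d 0) => // -> _; rewrite big1 // => v _; rewrite ffunE.
have shift u : \sum_v (d - unit_expo u) v = \sum_v d v - 1.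
  rewrite -(sum_unit_expo u) -sumrB; apply: eq_bigr => v _; by rewrite !ffunE.
by case/coef_cons_neq0 => /IH; rewrite shift /=; lia.
Qed.

Lemma coef_cat_cons l1 l2 a d : coef (l1 ++ a :: l2) d =
  coef (l1 ++ l2) (d - unit_expo a.1) - coef (l1 ++ l2) (d - unit_expo a.2).
Proof.
elim: l1 d => [|b l1 IH] d //=.
by rewrite !IH ![d - unit_expo b.1 - _]addrAC ![d - unit_expo b.2 - _]addrAC !opprD !opprK addrACA.
Qed.

(** To remove a factor, expand it: one of the two resulting coefficients is nonzero, and its
    exponents are no larger. *)
Lemma coef_filter (q : pred (V * V)) l d : coef l d != 0 ->
  exists2 d', coef (filter q l) d' != 0 & forall v, d' v <= d v.
Proof.
suff: forall l1, coef (l1 ++ l) d != 0 ->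
    exists2 d', coef (l1 ++ filter q l) d' != 0 & forall v, d' v <= d v.
  by move/(_ [::]).
move=> l1.
elim: l l1 d => [|a l IH] l1 d; first by move=> nz; exists d.
move=> nz; rewrite [filter _ _]/=; case: (q a).
  by rewrite -cat_rcons; apply: IH; rewrite cat_rcons.
have [|] : coef (l1 ++ l) (d - unit_expo a.1) != 0 \/
           coef (l1 ++ l) (d - unit_expo a.2) != 0.
- by apply: (@coef_cons_neq0 a (l1 ++ l) d); rewrite /= -coef_cat_cons.
- case/IH=> d' nz' le'; exists d' => // v.
  by have := le' v; rewrite !ffunE; case: eqP => _ /=; lia.
case/IH=> d' nz' le'; exists d' => // v.
by have := le' v; rewrite !ffunE; case: eqP => _ /=; lia.
Qed.

(* The second list contributes nothing at the vertices of the first one, and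
   the total degree is fixed, so the exponents cannot be redistributed. *)
Lemma coef_glue (X : {set V}) l1 l2 d1 d2 :
  (forall a, a \in l1 -> (a.1 \in X) && (a.2 \in X)) ->
  (forall v, v \in X -> d2 v = 0) -> (forall v, v \notin X -> d1 v = 0) ->
  coef l2 d2 != 0 -> coef (l1 ++ l2) (d1 + d2) = coef l1 d1 * coef l2 d2.
Proof.
move=> l1X d2X + nz2; elim: l1 l1X d1 => [|a l1 IH] l1X d1 d1X /=.
  case: (eqVneq d1 0) => [->|nz1]; first by rewrite add0r mul1r.
  rewrite mul0r; apply: contraNeq nz1 => nz.
  have d1ge0 v : 0 <= d1 v.
    case: (boolP (v \in X)) => [vX|/d1X->//].
    by have := coef_ge0 v nz; rewrite ffunE (d2X v vX) addr0.
  have : \sum_v d1 v = 0.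
    have := coef_total nz; rewrite -(coef_total nz2).
    under eq_bigr do rewrite ffunE.
    by rewrite big_split /= => /(canRL (addrK _)); rewrite subrr.
  move/eqP; rewrite psumr_eq0 // => /allP d10.
  by apply/eqP/ffunP=> v; rewrite ffunE; apply/eqP/d10; rewrite mem_index_enum.
have [/andP[a1 a2] l1X'] : (a.1 \in X) && (a.2 \in X) /\
    forall b, b \in l1 -> (b.1 \in X) && (b.2 \in X).
  by split=> [|b bl]; apply: l1X; rewrite inE ?eqxx ?bl ?orbT.
rewrite ![d1 + d2 - _]addrAC !(IH l1X') ?mulrBl // => v vX; rewrite !ffunE d1X //.
  by case: eqVneq vX => // ->; rewrite a2.
by case: eqVneq vX => // ->; rewrite a1.
Qed.

(** The exponent of [v] equals its degree, so every edge at [v] must contribute [v]. *)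
Lemma coef_out_edges v (s : seq V) l d :
  (forall a, a \in l -> (a.1 != v) && (a.2 != v)) ->
  v \notin s -> d v = 0 ->
  coef ([seq (v, u) | u <- s] ++ l) (d + unit_expo v *+ size s) = coef l d.
Proof.
move=> lv + dv; elim: s => [|u s IH] /=; first by rewrite mulr0n addr0.
rewrite inE negb_or => /andP[nvu nvs].
rewrite mulrSr addrA addrK (IH nvs).
set c := coef _ (_ - unit_expo u); suff -> : c = 0 by rewrite subr0.
apply: (@coef_too_large _ _ v); rewrite count_cat count_map.
have -> : count (fun a => (a.1 == v) || (a.2 == v)) l = 0%N.
  by apply/eqP; rewrite -leqn0 leqNgt -has_count; apply/hasPn => a /lv; rewrite negb_or.
rewrite !ffunE ffunMnE !ffunE dv eqxx (negPf nvu) (_ : true%:Z = 1) // natz.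
have := count_size (preim (fun u0 => (v, u0)) (fun a => (a.1 == v) || (a.2 == v))) s.
by rewrite [nat_of_bool false]/=; move: (count _ _) => k; lia.
Qed.

(** The exponent 0 at [v] forces every edge listed at [v] to contribute its other end. *)
Lemma coef_in_edges v (s : seq V) l d :
  v \notin s -> d v = 0 ->
  coef ([seq (u, v) | u <- s] ++ l) (d + \sum_(u <- s) unit_expo u) = coef l d.
Proof.
move=> + dv; elim: s => [|u s IH] /=; first by rewrite big_nil addr0.
rewrite inE negb_or big_cons addrCA => /andP[nvu nvs].
rewrite addrAC subrr add0r (IH nvs) addrA.
set c := coef _ (_ - unit_expo v); suff -> : c = 0 by rewrite subr0.
apply: (@coef_negative _ _ v); rewrite !ffunE eqxx (negPf nvu) dv sum_ffunE big1_seq //.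
by move=> w /andP[_ ws]; rewrite ffunE; case: eqVneq nvs => // ->; rewrite ws.
Qed.

(** With exponent 1 at [v], exactly one edge [uv] contributes [v], and the unit that [u] would have
    spent on it is left for [l]. *)
Lemma coef_in_edges_one v (s : seq V) l d :
  (forall a, a \in l -> (a.1 != v) && (a.2 != v)) ->
  v \notin s -> d v = 0 ->
  coef ([seq (u, v) | u <- s] ++ l) (d + unit_expo v + \sum_(u <- s) unit_expo u) != 0 ->
  exists2 u, u \in s & coef l (d + unit_expo u) != 0.
Proof.
move=> lv + dv; elim: s => [|u s IH].
  rewrite big_nil addr0 => _; rewrite (@coef_too_large _ _ v) ?eqxx //.
  have -> : count (fun a => (a.1 == v) || (a.2 == v)) l = 0%N.
    by apply/eqP; rewrite -leqn0 leqNgt -has_count; apply/hasPn => a /lv; rewrite negb_or.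
  by rewrite !ffunE dv eqxx.
rewrite inE negb_or big_cons => /andP[nvu nvs] /coef_cons_neq0 /= [].
  rewrite addrCA addrAC subrr add0r => /(IH nvs)[w ws nz].
  by exists w; rewrite ?inE ?ws ?orbT.
rewrite [d + _ + _]addrAC addrK addrA coef_in_edges //.
  by exists u; rewrite ?inE ?eqxx.
by rewrite !ffunE dv (negPf nvu).
Qed.

Definition ends (a : V * V) : {set V} := [set a.1; a.2].

(** A nonzero coefficient comes from at least one choice of an end in each factor. Listing the
    chosen ends first changes all coefficients by a common sign. *)
Lemma coef_orient l d : coef l d != 0 ->
  exists l', [/\ map ends l' = map ends l, coef l' d != 0
               & \sum_(a <- l') unit_expo a.1 = d].
Proof.
move=> nz; suff [l' [endsE [b coefE] sumE]] : exists l', [/\ map ends l' = map ends l,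
    exists b : bool, forall d', coef l' d' = (-1) ^+ b * coef l d'
    & \sum_(a <- l') unit_expo a.1 = d].
  by exists l'; split; rewrite // coefE mulf_neq0 // signr_eq0.
elim: l d nz => [|a l IH] d.
  rewrite /=; case: (eqVneq d 0) => // -> _; exists [::]; rewrite big_nil; split=> //.
  by exists false => d'; rewrite mul1r.
case/coef_cons_neq0 => /IH [l' [endsE [b coefE] sumE]].
  exists (a :: l'); split; first by rewrite /= endsE.
    by exists b => d'; rewrite /= !coefE mulrBr.
  by rewrite big_cons sumE addrC subrK.
exists ((a.2, a.1) :: l'); split; first by rewrite /= endsE /ends setUC.
  by exists (~~ b) => d'; rewrite /= !coefE -mulrBr signrN mulNr -mulrN opprB.
by rewrite big_cons sumE addrC subrK.
Qed.

(** Expand around the term that takes [a.1] from every factor: [H] is the set of factors that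
    contribute [a.2] instead, each with a sign, and [d] is the resulting change of exponents. *)
Lemma coef_subsets l d : uniq l ->
  coef l (\sum_(a <- l) unit_expo a.1 + d) =
  \sum_(H : {set V * V} | H \subset [set a in l])
    (-1) ^+ #|H| * (\sum_(a in H) (unit_expo a.2 - unit_expo a.1) == d)%:Z.
Proof.
elim: l d => [|a l IH] d /=.
  move=> _; rewrite big_nil add0r (big_pred1 set0).
    by rewrite cards0 expr0 mul1r big_set0 eq_sym.
  have -> : [set a in [::]] = set0 :> {set V * V} by apply/setP=> b; rewrite !inE.
  by move=> H; rewrite /= subset0.
case/andP=> al ul; rewrite big_cons.
set S := \sum_(b <- l) _.
have -> : unit_expo a.1 + S + d - unit_expo a.1 = S + d by rewrite -[_ + S + d]addrA addrAC subrr add0r.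
have -> : unit_expo a.1 + S + d - unit_expo a.2 = S + (d - (unit_expo a.2 - unit_expo a.1)).
  by rewrite opprB [_ + S]addrC -!addrA; congr (_ + _); rewrite addrCA.
rewrite !{}IH // [RHS](bigID (fun H : {set _} => a \in H)) /= [RHS]addrC; congr (_ + _).
  apply: eq_bigl => H; apply/subsetP/andP.
    move=> Hl; split; last by apply: contra al => /Hl; rewrite inE.
    by apply/subsetP=> b /Hl; rewrite !inE => ->; rewrite orbT.
  move=> [/subsetP Hl aH] b bH; have := Hl b bH.
  by rewrite !inE; case: eqP bH aH => [->->//|].
rewrite -sumrN [RHS](reindex_onto (fun H => a |: H) (fun H => H :\ a)) /=.
  symmetry; apply: eq_big => H.
    rewrite setU11 andbT; apply/andP/subsetP.
      move=> [/subsetP Hl /eqP HE] b bH; have := Hl b.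
      rewrite !inE bH orbT => /(_ isT) /orP[/eqP ba|//].
      by move: bH; rewrite -HE ba !inE eqxx.
    move=> Hl; split.
      by apply/subsetP=> b; rewrite !inE => /orP[->//|/Hl]; rewrite inE => ->; rewrite orbT.
    by rewrite setU1K //; apply: contra al => /Hl; rewrite inE.
  case/andP=> /andP[_ _] /eqP HE.
  have aH : a \notin H by rewrite -HE !inE eqxx.
  rewrite cardsU1 aH exprS mulN1r mulNr big_setU1 //=; congr (- (_ * _)).
  by rewrite [in RHS]eq_sym subr_eq eq_sym addrC.
by move=> H /andP[_ aH]; rewrite setD1K.
Qed.

Lemma sum_fst_expo (H : {set V * V}) v :
  (\sum_(a in H) unit_expo a.1) v = (outdeg H v)%:Z.
Proof.
rewrite sum_ffunE (eq_bigr (fun a => (a.1 == v)%:Z)); last first.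
  by move=> a _; rewrite ffunE eq_sym.
rewrite /outdeg -sum1_card -natz natr_sum big_mkcond [RHS]big_mkcond /=.
by apply: eq_bigr => a _; rewrite !inE; case: (a \in H); case: eqP.
Qed.

Lemma sum_snd_expo (H : {set V * V}) v :
  (\sum_(a in H) unit_expo a.2) v = (indeg H v)%:Z.
Proof.
rewrite sum_ffunE (eq_bigr (fun a => (a.2 == v)%:Z)); last first.
  by move=> a _; rewrite ffunE eq_sym.
rewrite /indeg -sum1_card -natz natr_sum big_mkcond [RHS]big_mkcond /=.
by apply: eq_bigr => a _; rewrite !inE; case: (a \in H); case: eqP.
Qed.

Lemma balancedE (H : {set V * V}) :
  (\sum_(a in H) (unit_expo a.2 - unit_expo a.1) == 0) =
  [forall v, outdeg H v == indeg H v].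
Proof.
rewrite sumrB subr_eq0; apply/eqP/forallP => [E v|E].
  by rewrite -eqz_nat -sum_fst_expo -sum_snd_expo E.
by apply/ffunP=> v; rewrite sum_fst_expo sum_snd_expo (eqP (E v)).
Qed.

(* Alon-Tarsi: orientations with the outdegrees of [D] are obtained from [D] by
   reversing an Eulerian subdigraph, which changes the sign by its parity. *)
Lemma coef_EE_OE l : uniq l ->
  coef l (\sum_(a <- l) unit_expo a.1) =
  (EE [set a in l])%:Z - (OE [set a in l])%:Z.
Proof.
move=> ul; rewrite -[X in coef l X]addr0 coef_subsets //.
rewrite /EE /OE -!sum1_card -!natz !natr_sum.
rewrite (bigID (fun H : {set V * V} => odd #|H|)) /= addrC -sumrN.
congr (_ + _); rewrite big_mkcond [RHS]big_mkcond /=; apply: eq_bigr => H _;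
  rewrite !inE /eulerian_sub balancedE; case: (H \subset _) => //=;
  case Ho: (odd #|H|); rewrite ?andbF ?andbT //= -signr_odd Ho ?expr1 ?expr0;
  by case: ([forall v, _]).
Qed.

End Coefficients.

(** * Edge lists of a graph *)

Section EdgeLists.
Variable V : finType.
Implicit Types (l : seq (V * V)) (u v : V) (r R : rel V).

Definition edge_list r l : Prop :=
  [/\ uniq (map (@ends V) l), forall a, a \in l -> a.1 != a.2
    & forall u v, r u v = ([set u; v] \in map (@ends V) l)].

Lemma edge_list_mem r l a : edge_list r l -> a \in l -> r a.1 a.2.
Proof. by case=> _ _ -> al; apply/mapP; exists a. Qed.

Lemma edge_list_filter r l r' :
  edge_list r l -> (forall u v, r' u v -> r u v) -> symmetric r' ->
  edge_list r' [seq a <- l | r' a.1 a.2].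
Proof.
move=> [ul nl lE] sub sym; split.
- exact: subseq_uniq (map_subseq _ (filter_subseq _ _)) ul.
- by move=> a; rewrite mem_filter => /andP[_ /nl].
move=> u v; apply/idP/mapP => [r'uv|[a]].
  have := sub _ _ r'uv; rewrite lE => /mapP[a al /eqP E].
  exists a; last exact/eqP.
  rewrite mem_filter al andbT; move: E; rewrite eq_set2.
  by move=> /orP[]/andP[/eqP<- /eqP<-] //; rewrite sym.
rewrite mem_filter => /andP[r'a al] /eqP.
by rewrite eq_set2 => /orP[]/andP[/eqP-> /eqP->] //; rewrite sym.
Qed.

Lemma edge_list_cat r1 r2 r l1 l2 :
  edge_list r1 l1 -> edge_list r2 l2 ->
  (forall u v, ~~ (r1 u v && r2 u v)) -> (forall u v, r u v = r1 u v || r2 u v) ->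
  edge_list r (l1 ++ l2).
Proof.
move=> el1 el2 dis rE; have [u1 n1 E1] := el1; have [u2 n2 E2] := el2; split.
- rewrite map_cat cat_uniq u1 u2 andbT /=; apply/hasPn => _ /mapP[a al ->].
  rewrite /ends -E1; have := dis a.1 a.2.
  by rewrite (edge_list_mem el2 al) andbT.
- by move=> a; rewrite mem_cat => /orP[/n1|/n2].
by move=> u v; rewrite rE map_cat mem_cat E1 E2.
Qed.

(** The edges at [v] may be split freely between the two orientations, which affect only the sign of
    the coefficient. *)
Lemma edge_list_vertex v (s1 s2 : seq V) r r' l :
  edge_list r l -> symmetric r' ->
  (forall a b, r a b -> (a != v) && (b != v)) ->
  (forall a b, a != v -> b != v -> r' a b = r a b) ->
  (forall u, r' v u = (u \in s1 ++ s2)) -> v \notin s1 ++ s2 -> uniq (s1 ++ s2) ->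
  edge_list r' ([seq (v, u) | u <- s1] ++ [seq (u, v) | u <- s2] ++ l).
Proof.
move=> el sym rv r'r r'v vs us; have [ul nl lE] := el.
have sE : map (@ends V) ([seq (v, u) | u <- s1] ++ [seq (u, v) | u <- s2] ++ l) =
   [seq [set v; u] | u <- s1 ++ s2] ++ map (@ends V) l.
  rewrite !map_cat -catA -!map_comp; congr (_ ++ _ ++ _).
  by apply: eq_map => u /=; rewrite /ends setUC.
have memE a b : ([set a; b] \in [seq [set v; u] | u <- s1 ++ s2]) =
    ((a == v) && (b \in s1 ++ s2)) || ((b == v) && (a \in s1 ++ s2)).
  apply/mapP/orP => [[u us' /eqP]|[]/andP[/eqP-> bs]].
  - by rewrite eq_set2 => /orP[]/andP[/eqP-> /eqP->]; rewrite us' eqxx; [left|right].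
  - by exists b.
  - by exists a; rewrite // setUC.
split.
- rewrite sE cat_uniq ul andbT map_inj_in_uniq ?us /=.
    apply/hasPn => _ /mapP[a al ->]; rewrite /ends memE.
    by have /andP[/negPf-> /negPf->] := rv _ _ (edge_list_mem el al).
  move=> a b ai bi /eqP; rewrite eq_set2 eqxx /= => /orP[/eqP//|/andP[/eqP ab _]].
  by move: vs; rewrite ab bi.
- move=> a; rewrite !mem_cat => /or3P[/mapP[u us1 ->]|/mapP[u us2 ->]|/nl//] /=.
    by apply: contraNneq vs => ->; rewrite mem_cat us1.
  by apply: contraNneq vs => <-; rewrite mem_cat us2 orbT.
move=> a b; rewrite sE mem_cat memE -lE.
have nv c : r v c = false by apply/negP => /rv; rewrite eqxx.
have nv' c : r c v = false by apply/negP => /rv; rewrite eqxx andbF.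
case: (eqVneq a v) => [->|av]; case: (eqVneq b v) => [->|bv] /=.
- by rewrite nv r'v orbb orbF.
- by rewrite nv r'v !orbF.
- by rewrite nv' sym r'v !orbF.
by rewrite r'r.
Qed.

End EdgeLists.

(** * The invariant of the induction and its gluing *)

Section Nice.
Variable V : finType.
Implicit Types (l : seq (V * V)) (u v x y : V) (e r R : rel V) (U A : {set V}).
Local Open Scope ring_scope.

(** For [x = y] the last test excludes only a loop at [x], hence no edge of an irreflexive [e]. *)
Definition remaining U e R x y : rel V := fun u v =>
  [&& u \in U, v \in U, e u v, ~~ R u v & [set u; v] != [set x; y]].

Definition weight (wt : bool) R u : int := (wt && [exists v, R u v])%:Z.

Lemma weight_ge0 wt R u : 0 <= weight wt R u.
Proof. by []. Qed.

Lemma weight_mono wt R R' u : (forall v, R' u v -> R u v) ->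
  weight wt R' u <= weight wt R u.
Proof.
move=> sub; rewrite /weight; case: wt => //=.
case: existsP => [[v /sub Ruv]|//]; case: existsP => // - [].
by exists v.
Qed.

Variables (wt : bool) (good : rel V -> V -> V -> Prop) (bA bI : int).

(* [R] is the removed graph, empty, a matching or a forest according to [good]. A
   matched vertex loses one unit of its bound when [wt] is set. Exponents are
   nonnegative, so [x] and [y] are sinks. *)
Definition nice U e A x y : Prop :=
  exists R l d, [/\
    [/\ symmetric R, good R x y &
        forall u v, R u v -> [&& u \in U, v \in U, e u v & [set u; v] != [set x; y]]],
    edge_list (remaining U e R x y) l, coef l d != 0 &
    [/\ d x + weight wt R x <= 0 :> int, d y + weight wt R y <= 0 :> int,
        forall u, u \in A -> d u + weight wt R u <= bA :> int & forall u, d u <= bI]].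

Lemma remaining_sym U e R x y :
  symmetric e -> symmetric R -> symmetric (remaining U e R x y).
Proof.
move=> se sR u v; rewrite /remaining setUC se sR.
by case: (u \in U); case: (v \in U); rewrite ?andbF.
Qed.

Lemma nice_sink_deg R l d u : coef l d != 0 -> d u + weight wt R u <= 0 :> int ->
  d u = 0 /\ weight wt R u = 0.
Proof. by move=> /(coef_ge0 u); have := weight_ge0 wt R u; clear; lia. Qed.

Lemma unmatched R u v : wt -> weight wt R u = 0 -> R u v = false.
Proof.
rewrite /weight => -> /=; case: existsP => // nR _; apply/negP => Ruv.
by apply: nR; exists v.
Qed.

Lemma edge_list_supp U e R x y l d u :
  edge_list (remaining U e R x y) l -> coef l d != 0 -> u \notin U -> d u = 0.
Proof.
move=> el nz uU; have := coef_bounds u nz.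
have -> : count (fun a => (a.1 == u) || (a.2 == u)) l = 0%N; last by clear; lia.
apply/eqP; rewrite -leqn0 leqNgt -has_count; apply/hasPn => a.
move/(edge_list_mem el); rewrite /remaining => /and5P[a1 a2 _ _ _].
by apply: contra uU => /orP[]/eqP <-.
Qed.

Hypothesis good_sub : forall R R' x y,
  (forall u v, R' u v -> R u v) -> good R x y -> good R' x y.

Lemma nice_mono U e e' A A' x y : nice U e A x y -> symmetric e' ->
  (forall u v, u \in U -> v \in U -> e' u v -> e u v) ->
  (forall u, u \in A' -> u \in U -> u \in [set x; y] :|: A) -> 0 <= bA ->
  nice U e' A' x y.
Proof.
move=> [R [l [d [[sR gR RU] el nz [dx dy dA dI]]]]] se' sub A'A bA0.
pose R' := [rel u v | R u v && e' u v].
have sR' : symmetric R' by move=> u v /=; rewrite sR se'.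
have wR' u : weight wt R' u <= weight wt R u by apply: weight_mono => v /andP[].
have [d' nz' le'] := coef_filter (fun a => remaining U e' R' x y a.1 a.2) nz.
have el' : edge_list (remaining U e' R' x y)
    [seq a <- l | remaining U e' R' x y a.1 a.2].
  apply: edge_list_filter el _ (remaining_sym _ _ _ se' sR').
  move=> u v /and5P[uU vU e'uv nR' xy].
  by rewrite /remaining uU vU xy sub //= andbT; apply: contra nR' => /= ->.
exists R', [seq a <- l | remaining U e' R' x y a.1 a.2], d'; split=> //; split=> //.
- by apply: good_sub gR => u v /andP[].
- by move=> u v /andP[/RU /and4P[-> -> _ ->] ->].
- by have := le' x; have := wR' x; move: dx; clear; lia.
- by have := le' y; have := wR' y; move: dy; clear; lia.
- move=> u uA'; case: (boolP (u \in U)) => [uU|uU].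
    have := A'A u uA' uU; rewrite !inE => /orP[/orP[]/eqP->|/dA];
      [have := le' x; have := wR' x|have := le' y; have := wR' y|
       have := le' u; have := wR' u]; move: dx dy bA0; clear; lia.
  (* Outside [U] exponent and weight both vanish, so the bound extends to all of [A']. *)
  rewrite (edge_list_supp el' nz' uU) /weight.
  suff -> : [exists v, R' u v] = false by rewrite andbF.
  by apply/existsP => - [v /andP[/RU]]; rewrite (negPf uU).
by move=> u; have := le' u; have := dI u; clear; lia.
Qed.

Hypothesis good_glue : forall U1 U2 R1 R2 x y p q,
  (forall u v, R1 u v -> (u \in U1) && (v \in U1)) ->
  (forall u v, R2 u v -> (u \in U2) && (v \in U2)) ->
  (forall u, u \in U1 -> u \in U2 -> u \in [set p; q]) ->
  p = q \/ p \in U1 /\ q \in U1 ->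
  p \in U2 -> q \in U2 -> x \in U1 -> y \in U1 ->
  (wt -> forall v, R2 p v = false /\ R2 q v = false) ->
  symmetric R1 -> symmetric R2 -> ~~ R2 p q ->
  good R1 x y -> good R2 p q -> good (fun u v => R1 u v || R2 u v) x y.

(** An edge within both sides can only be [pq], which the second side lacks, and a shared vertex is
    a sink there. So the edge sets are disjoint and exponents never add up at a vertex. *)
Lemma nice_glue U1 U2 e A x y p q : symmetric e -> irreflexive e ->
  x \in U1 -> y \in U1 -> p \in U2 -> q \in U2 ->
  (forall u, u \in U1 -> u \in U2 -> u \in [set p; q]) ->
  p = q \/ p \in U1 /\ q \in U1 ->
  (forall u v, u \in U1 :\: U2 -> v \in U2 :\: U1 -> ~~ e u v) ->
  nice U1 e A x y -> nice U2 e A p q -> nice (U1 :|: U2) e A x y.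
Proof.
move=> se ie xU1 yU1 pU2 qU2 U12 pq1 nocross.
move=> [R1 [l1 [d1 [[sR1 gR1 RU1] el1 nz1 [dx1 dy1 dA1 dI1]]]]].
move=> [R2 [l2 [d2 [[sR2 gR2 RU2] el2 nz2 [dp dq dA2 dI2]]]]].
have [d2p w2p] := nice_sink_deg nz2 dp; have [d2q w2q] := nice_sink_deg nz2 dq.
(* Weight 0 at the sinks means that they are unmatched on the second side. *)
have R2pq : wt -> forall v, R2 p v = false /\ R2 q v = false.
  by move=> wt1 v; rewrite !unmatched.
have d2U1 u : u \in U1 -> d2 u = 0.
  move=> u1; case: (boolP (u \in U2)) => [u2|]; last exact: edge_list_supp el2 nz2.
  by have := U12 u u1 u2; rewrite !inE => /orP[]/eqP->.
have d1U1 u : u \notin U1 -> d1 u = 0 by exact: edge_list_supp el1 nz1.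
have shared u v : e u v -> u \in U1 -> v \in U1 -> u \in U2 -> v \in U2 ->
    [set u; v] = [set p; q].
  move=> euv u1 v1 u2 v2; apply/eqP; rewrite eq_set2; move: (U12 u u1 u2) (U12 v v1 v2) euv.
  by rewrite !inE => /orP[]/eqP-> /orP[]/eqP->; rewrite ?ie ?eqxx /= ?orbT.
have noR2 u v : R2 u v -> ~~ ((u \in U1) && (v \in U1)).
  move=> /RU2 /and4P[u2 v2 euv /negP npq]; apply/negP => /andP[u1 v1].
  by apply: npq; rewrite (shared u v).
pose R u v := R1 u v || R2 u v.
have w1 u : u \in U1 -> weight wt R u <= weight wt R1 u.
  move=> u1; case: wt R2pq => [/(_ isT) R2pq|//].
  apply: weight_mono => v /orP[//|R2uv]; have /RU2/and4P[u2 _ _ _] := R2uv.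
  have [pF qF] := R2pq v.
  by move: R2uv; have := U12 u u1 u2; rewrite !inE => /orP[]/eqP->; rewrite ?pF ?qF.
have w2 u : u \notin U1 -> weight wt R u <= weight wt R2 u.
  by move=> u1; apply: weight_mono => v /orP[/RU1|//]; rewrite (negPf u1).
exists R, (l1 ++ l2), (d1 + d2); split.
- split.
  + by move=> u v; rewrite /R sR1 sR2.
  + apply: (@good_glue U1 U2 _ _ _ _ p q) => //.
    * by move=> u v /RU1 /and4P[-> ->].
    * by move=> u v /RU2 /and4P[-> ->].
    * by apply/negP => /RU2/and4P[_ _ _]; rewrite eqxx.
  move=> u v /orP[/RU1|R2uv]; first by rewrite !inE => /and4P[-> -> -> ->].
  have /RU2 /and4P[u2 v2 -> _] := R2uv; rewrite !inE u2 v2 !orbT /=.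
  apply: contra (noR2 _ _ R2uv); rewrite eq_set2.
  by move=> /orP[]/andP[/eqP-> /eqP->]; rewrite xU1 yU1.
- apply: edge_list_cat el1 el2 _ _ => u v.
    apply/negP => /andP[/and5P[u1 v1 euv _ _] /and5P[u2 v2 _ _ /negP]].
    by apply; rewrite (shared u v).
  apply/and5P/orP.
    rewrite !inE /R negb_or => - [uU vU euv /andP[nR1 nR2] nxy].
    case: (boolP ((u \in U1) && (v \in U1))) => [/andP[u1 v1]|n1].
      by left; apply/and5P.
    right; have [u2 v2] : u \in U2 /\ v \in U2.
      move: uU vU n1 (nocross u v) (nocross v u); rewrite !inE (se v u) euv.
      by case: (u \in U1); case: (u \in U2); case: (v \in U1); case: (v \in U2) => //=;
        do ?[by move=> _ _ _ /(_ isT isT)]; move=> _ _ _ _ /(_ isT isT).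
    apply/and5P; split=> //; apply: contra n1; rewrite eq_set2.
    case: pq1 => [pq|[pU1 qU1]]; last by move=> /orP[]/andP[/eqP-> /eqP->]; rewrite pU1 qU1.
    by rewrite pq orbb => /andP[/eqP uE /eqP vE]; move: euv; rewrite uE vE ie.
  case=> /and5P[u1 v1 euv nR nxy]; split=> //; rewrite ?inE ?u1 ?v1 ?orbT //.
  + by rewrite /R negb_or nR /=; apply: contraTN (isT) => /noR2; rewrite u1 v1.
  + rewrite /R negb_or nR andbT; apply: contra nxy => /RU1 /and4P[u1' v1' _ _].
    by rewrite (shared u v).
  apply: contra nxy; rewrite eq_set2 => /orP[]/andP[/eqP uE /eqP vE];
    by rewrite (shared u v) // ?uE ?vE.
- rewrite (@coef_glue _ U1) ?mulf_neq0 // => a /(edge_list_mem el1) /and5P[-> ->] //.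
split.
- by have := w1 x xU1; rewrite expoE (d2U1 x xU1); move: dx1; clear; lia.
- by have := w1 y yU1; rewrite expoE (d2U1 y yU1); move: dy1; clear; lia.
- move=> u uA; rewrite expoE; have := dA1 u uA; have := dA2 u uA.
  case: (boolP (u \in U1)) => u1.
    by have := w1 u u1; rewrite (d2U1 u u1); clear; lia.
  by have := w2 u u1; rewrite (d1U1 u u1); clear; lia.
move=> u; rewrite expoE; case: (boolP (u \in U1)) => u1.
  by rewrite (d2U1 u u1) addr0.
by rewrite (d1U1 u u1) add0r.
Qed.

Hypothesis good_sink : forall R v x y z,
  good R z z -> (forall u, R v u = false) -> symmetric R -> v != z ->
  (x = v /\ y = v) \/ (x = v /\ y = z) -> good R x y.

(** All edges at [x] contribute their other end, which keeps [x] a sink. Each neighbour gains one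
    unit, and it had room since it was on the boundary. *)
Lemma nice_sink U e x y z : symmetric e -> irreflexive e ->
  x \in U -> z \in U -> e x z -> y = z \/ y = x -> bA + 1 <= bI :> int ->
  nice (U :\ x) e [set u | e x u] z z -> nice U e set0 x y.
Proof.
move=> se ie xU zU exz yE bAI [R [l [d [[sR gR RU] el nz [dz _ dA dI]]]]].
have [dz0 wz0] := nice_sink_deg nz dz.
have dx : d x = 0 by apply: edge_list_supp el nz _; rewrite !inE eqxx.
have Rx u : R x u = false by apply/negP => /RU; rewrite !inE eqxx.
have nxz : x != z by apply: contraTneq exz => ->; rewrite ie.
have wx : weight wt R x = 0.
  by rewrite /weight (_ : [exists v, _] = false) ?andbF //; apply/existsP => - [v]; rewrite Rx.
(* If [y = z], the edge [xz] is the deleted one and [z] stays a sink; if [y = x], no edge is deleted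
   and [z] gains a unit as well. *)
pose s := enum [set u in U | e x u && ((u != z) || (y == x))].
have xs : x \notin s by rewrite mem_enum inE ie andbF.
exists R, ([seq (u, x) | u <- s] ++ l), (d + \sum_(u <- s) unit_expo u).
have sumE u := sum_unit_expoE u (enum_uniq _ : uniq s).
have xyE u v : [set u; v] != [set z; z] = ~~ ((u == z) && (v == z)) by rewrite eq_set2 orbb.
split.
- split=> //.
  + by apply: good_sink gR Rx sR nxz _; case: yE => ->; [right|left].
  move=> u v /[dup] Ruv /RU; rewrite !inE => /and4P[/andP[ux ->] /andP[vx ->] -> _] /=.
  by rewrite eq_set2 (negPf ux) (negPf vx) andbF.
- have <- : [seq (x, u) | u <- [::]] ++ [seq (u, x) | u <- s] ++ l =
            [seq (u, x) | u <- s] ++ l by [].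
  apply: edge_list_vertex el _ _ _ _ _ _ => //=.
  + exact: remaining_sym.
  + by move=> a b /and5P[]; rewrite !inE => /andP[-> _] /andP[-> _].
  + move=> a b ax bx; rewrite /remaining !inE ax bx /= xyE eq_set2 (negPf ax) (negPf bx) andbF /=.
    case: (boolP (e a b)) => eab; rewrite ?andbF //=.
    suff -> : ~~ ((a == z) && (b == z)) by [].
    by apply/negP => /andP[/eqP aE /eqP bE]; move: eab; rewrite aE bE ie.
  + move=> u; rewrite /remaining mem_enum inE xU Rx /= eq_set2 eqxx /=.
    case: (boolP (e x u)) => exu; rewrite ?andbF //=.
    have ux : u != x by apply: contraTneq exu => ->; rewrite ie.
    by case: yE => ->; rewrite ?eqxx ?(negPf ux) ?orbT ?(eq_sym z) ?(negPf nxz) ?orbF ?andbT //=.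
  by rewrite enum_uniq.
- by rewrite coef_in_edges.
have zs : y = z -> z \notin s.
  by move=> yz; rewrite mem_enum inE eqxx yz eq_sym (negPf nxz) !andbF.
split.
- by rewrite expoE sumE dx wx (negPf xs).
- case: yE zs => [-> zs|-> _]; rewrite expoE sumE.
    by rewrite dz0 wz0 (negPf (zs erefl)).
  by rewrite dx wx (negPf xs).
- by move=> u; rewrite inE.
move=> u; rewrite expoE sumE; have := dI u; case: (boolP (u \in s)) => us /=; last by clear; lia.
have := dA u; rewrite inE; move: us; rewrite mem_enum inE => /and3P[_ -> _] /(_ isT).
by have := weight_ge0 wt R u; move: bAI; clear; lia.
Qed.

End Nice.

(** * Returning a boundary vertex, and the base cases *)

Section NiceVertex.
Variable V : finType.
Implicit Types (l : seq (V * V)) (u v x y : V) (e r R : rel V) (U A : {set V}).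
Local Open Scope ring_scope.
Variables (wt : bool) (good : rel V -> V -> V -> Prop) (bA bI : int).
Local Notation nice := (@nice V wt good bA bI).

(** As [x] has exponent 0, the restored edge can only contribute [y]. Then [y] has exponent 1 and
    weight 0, within either bound. *)
Lemma nice_addedge U e A x y : symmetric e -> irreflexive e ->
  (forall R, good R x y -> good R x x) -> 1 <= bA -> 1 <= bI ->
  x \in U -> y \in U -> e x y ->
  nice U e A x y -> nice U e A x x.
Proof.
move=> se ie gxx bA1 bI1 xU yU exy [R [l [d [[sR gR RU] el nz [dx dy dA dI]]]]].
have [dx0 wx0] := nice_sink_deg nz dx; have [dy0 wy0] := nice_sink_deg nz dy.
have nxy : x != y by apply: contraTneq exy => ->; rewrite ie.
have loop u v : e u v -> [set u; v] != [set x; x].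
  move=> euv; rewrite eq_set2 orbb; apply: contraTN euv => /andP[/eqP-> /eqP->].
  by rewrite ie.
have Rxy u v : [set u; v] = [set x; y] -> R u v = false.
  by move=> E; apply/negP => /RU /and4P[_ _ _]; rewrite E eqxx.
exists R, ([:: (y, x)] ++ l), (unit_expo y + d); split=> //.
- split=> // [|u v /RU /and4P[-> -> euv _]]; first exact: gxx gR.
  by rewrite euv loop.
- apply: (@edge_list_cat _ [rel u v | [set u; v] == [set x; y]] (remaining U e R x y)) => //.
  + split=> // [a|u v] /=; first by rewrite inE => /eqP -> /=; rewrite eq_sym.
    by rewrite inE /ends /= [[set y; x]]setUC.
  + by move=> u v; rewrite /remaining /=; case: eqP; rewrite ?andbF.
  move=> u v; rewrite /remaining /=; case: (eqVneq [set u; v] [set x; y]) => [E|_] /=.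
    have [uU vU euv] : [/\ u \in U, v \in U & e u v].
      by move/eqP: E; rewrite eq_set2 => /orP[]/andP[/eqP-> /eqP->] //; rewrite se.
    by rewrite Rxy // uU vU euv loop.
  by case: (boolP (e u v)) => euv; rewrite ?andbF ?loop //= !andbT.
- rewrite /= addrAC subrr add0r.
  set c := coef _ (_ - unit_expo x); suff -> : c = 0 by rewrite subr0.
  by apply: (@coef_negative _ _ _ x); rewrite !expoE eqxx (negPf nxy) dx0.
split; rewrite ?expo_addE ?unit_expoE.
- by rewrite (negPf nxy) dx0 wx0.
- by rewrite (negPf nxy) dx0 wx0.
- move=> u uA; rewrite !expoE; case: (eqVneq u y) => [->|_] /=.
    by rewrite dy0 wy0.
  by rewrite add0r; apply: dA.
move=> u; rewrite !expoE; case: (eqVneq u y) => [->|_] /=; first by rewrite dy0.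
by rewrite add0r.
Qed.

Lemma nice_single e A x : irreflexive e -> good (fun _ _ => false) x x ->
  0 <= bA -> 0 <= bI -> nice [set x] e A x x.
Proof.
move=> ie g0 bA0 bI0; exists (fun _ _ => false), [::], 0.
have w0 u : weight wt (fun _ _ => false) u = 0.
  by rewrite /weight (_ : [exists v, _] = false) ?andbF //; apply/existsP => - [].
split=> //.
- by split=> // u v; apply/negP => /and5P[]; rewrite !inE => /eqP-> /eqP->; rewrite ie.
- by rewrite /= eqxx.
by split=> [||u _|u]; rewrite ?w0 ffunE ?addr0.
Qed.

Lemma edge_list_remaining_vertex U e R R' x y v (s1 s2 : seq V) l :
  symmetric e -> irreflexive e -> symmetric R' -> v \in U -> v != x -> v != y ->
  edge_list (remaining (U :\ v) e R x y) l ->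
  (forall a b, a != v -> b != v -> R' a b = R a b) ->
  (forall u, (u \in s1 ++ s2) = [&& u \in U, e v u & ~~ R' v u]) -> uniq (s1 ++ s2) ->
  edge_list (remaining U e R' x y) ([seq (v, u) | u <- s1] ++ [seq (u, v) | u <- s2] ++ l).
Proof.
move=> se ie sR' vU vx vy el R'R sE us; apply: edge_list_vertex el _ _ _ _ _ us.
- exact: remaining_sym.
- by move=> a b /and5P[]; rewrite !inE => /andP[-> _] /andP[-> _].
- by move=> a b av bv; rewrite /remaining !inE av bv R'R.
- by move=> u; rewrite sE /remaining vU eq_set2 (negPf vx) (negPf vy) /= andbT.
by rewrite sE ie andbF.
Qed.

(** An edge to a vertex of exponent 0 must contribute [v]. *)
Lemma coef_to_sinks v (s : seq V) l (d : {ffun V -> int}) :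
  (forall u, u \in s -> (u != v) && (d u == 0)) ->
  coef ([seq (v, u) | u <- s] ++ l) (d + unit_expo v *+ size s) = coef l d.
Proof.
elim: s => [|u s IH] sd /=; first by rewrite mulr0n addr0.
have /andP[uv /eqP du] := sd u (mem_head _ _).
rewrite mulrSr addrA addrK IH => [|w ws]; last by apply: sd; rewrite inE ws orbT.
set c := coef _ (_ - unit_expo u); suff -> : c = 0 by rewrite subr0.
apply: (@coef_negative _ _ _ u); rewrite !expoE ffunMnE !expoE du (negPf uv) eqxx.
by rewrite mul0rn.
Qed.

(* The forest case: [v] sends an arc to [x] only, [vw] is put into the removed
   forest, and all other edges at [v] are oriented towards [v]. *)
Lemma nice_vertex_leaf U e A x y v w : symmetric e -> irreflexive e -> wt = false ->
  (forall R, symmetric R -> (forall u, R v u = false) -> v != x -> v != y -> v != w ->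
     good R x y -> good (add_edge R v w) x y) ->
  1 <= bA -> bA + 1 <= bI :> int ->
  v \in U -> x \in A -> y \in A -> v != x -> v != y -> w \in U ->
  (forall u, u \in U -> u \in A -> e v u -> u \in [set x; w]) ->
  nice (U :\ v) e (A :|: [set u | e v u]) x y -> nice U e A x y.
Proof.
move=> se ie wt0 gleaf bA1 bAI vU xA yA vx vy wU Nv.
move=> [R [l [d [[sR gR RU] el nz [dx dy dA dI]]]]].
have [dx0 wx0] := nice_sink_deg nz dx; have [dy0 wy0] := nice_sink_deg nz dy.
have dv : d v = 0 by apply: edge_list_supp el nz _; rewrite !inE eqxx.
have Rv u : R v u = false by apply/negP => /RU; rewrite !inE eqxx.
have W0 R' u : weight wt R' u = 0 by rewrite /weight wt0.
(* An edge is put into the forest only if [w] is a neighbour distinct from [x]; the edge to [x] is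
   in [s1]. *)
pose W := (e v w) && (w != x).
pose R' := if W then add_edge R v w else R.
have sR' : symmetric R' by rewrite /R'; case: ifP => // _; exact: add_edge_sym.
pose s1 := enum [set u in U | e v u && (u == x)].
pose s2 := enum [set u in U | [&& e v u, u != x & u != w]].
have mem1 u : (u \in s1) = (u \in U) && (e v u && (u == x)) by rewrite mem_enum inE.
have mem2 u : (u \in s2) = [&& u \in U, e v u, u != x & u != w] by rewrite mem_enum inE.
have size1 : (size s1)%:Z <= 1.
  rewrite -cardE lez_nat -(cards1 x) subset_leq_card //; apply/subsetP => u.
  by rewrite !inE => /andP[_ /andP[_ ->]].
have v1 : v \notin s1 by rewrite mem1 ie andbF.
have v2 : v \notin s2 by rewrite mem2 ie andbF.
have sumE u := sum_unit_expoE u (enum_uniq _ : uniq s2).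
pose T := d + \sum_(u <- s2) unit_expo u + unit_expo v *+ size s1.
have TE u : T u = d u + (u \in s2)%:Z + (if u == v then (size s1)%:Z else 0).
  rewrite /T expo_addE ffunMnE unit_expoE expo_addE sumE; congr (_ + _).
  by case: eqP => _ /=; rewrite ?mul0rn // natz.
(* The neighbours in [s2] lie outside [A], so they obeyed [bA] only on the smaller graph and may now
   rise to [bI]. *)
have A2 u : u \in A -> u \notin s2.
  move=> uA; rewrite mem2; apply/negP => /and4P[uU evu ux uw].
  by have := Nv u uU uA evu; rewrite !inE (negPf ux) (negPf uw).
exists R', ([seq (v, u) | u <- s1] ++ [seq (u, v) | u <- s2] ++ l), T; split.
- split=> //.
    rewrite /R'; case: ifP => // /andP[evw _]; apply: gleaf => //.
    by apply: contraTneq evw => <-; rewrite ie.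
  have RU' a b : R a b -> [&& a \in U, b \in U, e a b & [set a; b] != [set x; y]].
    by move=> /RU; rewrite !inE => /and4P[/andP[_ ->] /andP[_ ->] -> ->].
  rewrite /R'; case: ifP => // /andP[evw wx] a b /orP[/RU'//|].
  rewrite !eq_set2 => /orP[]/andP[/eqP-> /eqP->]; rewrite vU wU ?(se w) evw (negPf vx) (negPf vy) //=.
  by rewrite !andbF.
- apply: edge_list_remaining_vertex el _ _ _ => //.
  + move=> a b av bv; rewrite /R'; case: ifP => // _.
    by rewrite /add_edge eq_set2 (negPf av) (negPf bv) andbF /= orbF.
  + move=> u; rewrite mem_cat mem1 mem2; case: (boolP (u \in U)) => //= uU.
    case: (boolP (e v u)) => //= evu.
    have uv : (u == v) = false by apply: contraTF evu => /eqP->; rewrite ie.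
    rewrite /R' /W; case: (eqVneq u w) => [<-|uw].
      by rewrite evu /=; case: eqVneq => //= ux; rewrite ?Rv // /add_edge eqxx orbT.
    case: ifP => _; rewrite /add_edge Rv ?eq_set2 ?uv ?(negPf uw) ?andbF ?orbF /=; by case: eqP.
  rewrite cat_uniq !enum_uniq andbT /=; apply/hasPn => u; rewrite [_ \in s1]mem1 mem2.
  by case/and4P=> _ _ /negPf-> _; rewrite !andbF.
- rewrite coef_to_sinks ?coef_in_edges // => u; rewrite mem1 => /and3P[uU evu /eqP ux].
  by rewrite ux eq_sym vx expo_addE sumE dx0 (negPf (A2 x xA)).
split.
- by rewrite W0 TE eq_sym (negPf vx) dx0 (negPf (A2 x xA)).
- by rewrite W0 TE eq_sym (negPf vy) dy0 (negPf (A2 y yA)).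
- move=> u uA; rewrite W0 TE (negPf (A2 u uA)) !addr0; case: eqVneq => [->|_].
    by rewrite dv add0r; exact: le_trans size1 bA1.
  by have := dA u; rewrite inE uA W0 => /(_ isT); clear; lia.
move=> u; rewrite TE; case: (eqVneq u v) => [->|_].
  by rewrite dv (negPf v2); move: size1 bA1 bAI; clear => /=; lia.
case: (boolP (u \in s2)) => us; last by have := dI u => /=; clear; lia.
have := dA u; rewrite W0 !inE addr0; move: us; rewrite mem2 => /and4P[_ -> _ _].
by rewrite orbT => /(_ isT) /=; move: bAI; clear; lia.
Qed.

Lemma weight_add_edge R a b u : u != a -> u != b ->
  weight wt (add_edge R a b) u = weight wt R u.
Proof.
move=> ua ub; rewrite /weight; congr ((_ && _)%:Z); apply: eq_existsb => v.
by rewrite /add_edge eq_set2 (negPf ua) (negPf ub) orbF.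
Qed.

Lemma weight_le1 R u : weight wt R u <= 1.
Proof. by rewrite /weight; case: (_ && _). Qed.

(* With [vx] and [vw] both leaving [v] the coefficient is that of [d] minus
   those of [d + u - w]. If one of the latter is nonzero then [v w] is oriented
   towards [v] instead, which gives [u] one arc too many for the matching
   version; there [uv] is put into the matching, if [u] is not yet matched. *)
Lemma nice_vertex_two U e A x y v w : symmetric e -> irreflexive e ->
  (wt -> forall R u, symmetric R -> (forall z, R v z = false) ->
     (forall z, R u z = false) -> v != u -> good R x y -> good (add_edge R v u) x y) ->
  bA = 2 -> bI = (if wt then 3 else 4) ->
  v \in U -> x \in A -> y \in A -> v != x -> v != y -> w \in U ->
  (forall u, u \in U -> u \in A -> e v u -> u \in [set x; w]) ->
  nice (U :\ v) e (A :|: [set u | e v u]) x y -> nice U e A x y.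
Proof.
move=> se ie gmatch bA2 bIE vU xA yA vx vy wU Nv.
move=> [R [l [d [[sR gR RU] el nz [dx dy dA dI]]]]].
have [dx0 wx0] := nice_sink_deg nz dx; have [dy0 wy0] := nice_sink_deg nz dy.
have dv : d v = 0 by apply: edge_list_supp el nz _; rewrite !inE eqxx.
have Rv u : R v u = false by apply/negP => /RU; rewrite !inE eqxx.
have Rv' u : R u v = false by rewrite sR Rv.
have RU' a b : R a b -> [&& a \in U, b \in U, e a b & [set a; b] != [set x; y]].
  by move=> /RU; rewrite !inE => /and4P[/andP[_ ->] /andP[_ ->] -> ->].
have wv : weight wt R v = 0.
  by rewrite /weight (_ : [exists v, _] = false) ?andbF //; apply/existsP => - [u]; rewrite Rv.
pose W := e v w && (w != x).
pose s1 := enum [set u in U | e v u && (u == x)].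
pose sw := if W then [:: w] else [::].
pose s2 := enum [set u in U | [&& e v u, u != x & u != w]].
have mem1 u : (u \in s1) = (u \in U) && (e v u && (u == x)) by rewrite mem_enum inE.
have memw u : (u \in sw) = [&& e v u, u != x & u == w].
  rewrite /sw /W; case: (eqVneq u w) => [->|uw]; rewrite ?andbF ?andbT.
    by case: ifP => //; rewrite inE eqxx.
  by case: ifP => //; rewrite inE (negPf uw).
have mem2 u : (u \in s2) = [&& u \in U, e v u, u != x & u != w] by rewrite mem_enum inE.
have size1 : (size s1)%:Z <= 1.
  rewrite -cardE lez_nat -(cards1 x) subset_leq_card //; apply/subsetP => u.
  by rewrite !inE => /andP[_ /andP[_ ->]].
have v1 : v \notin s1 by rewrite mem1 ie andbF.
have v2 : v \notin s2 by rewrite mem2 ie andbF.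
have ev u : e v u -> u == v = false by move=> evu; apply: contraTF evu => /eqP->; rewrite ie.
have A2 u : u \in A -> u \notin s2.
  move=> uA; rewrite mem2; apply/negP => /and4P[uU evu ux uw].
  by have := Nv u uU uA evu; rewrite !inE (negPf ux) (negPf uw).
have dA2 u : u \in s2 -> d u + weight wt R u <= 2.
  by rewrite mem2 => /and4P[_ evu _ _]; rewrite -bA2; apply: dA; rewrite !inE evu orbT.
have lv a : a \in l -> (a.1 != v) && (a.2 != v).
  by move/(edge_list_mem el) => /and5P[]; rewrite !inE => /andP[-> _] /andP[-> _].
have us : uniq ((s1 ++ sw) ++ s2).
  rewrite cat_uniq cat_uniq !enum_uniq andbT; apply/andP; split; first (apply/and3P; split=> //).
  - apply/hasPn => u; rewrite memw [u \in mem s1]mem1 => /and3P[_ /negPf-> _].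
    by rewrite !andbF.
  - by rewrite /sw; case: ifP.
  apply/hasPn => u; rewrite mem2 => /and4P[_ _ /negPf ux /negPf uw].
  by apply/negP; rewrite /= mem_cat mem1 memw ux uw !andbF.
(* The cases without a new matching edge end alike: the edge to the sink [x] contributes [v], and
   only the exponents on the other edges differ. *)
have finish (T d' : {ffun V -> int}) :
    coef ([seq (v, u) | u <- sw] ++ [seq (u, v) | u <- s2] ++ l) d' != 0 ->
    T = d' + unit_expo v *+ size s1 -> d' x = 0 ->
    [/\ T x = 0, T y = 0, T v <= 2, forall u, u \in A -> u != v -> T u <= d u &
        forall u, T u <= bI] ->
    nice U e A x y.
  move=> nz' TE d'x [Tx Ty Tv TA TI].
  exists R, ([seq (v, u) | u <- s1 ++ sw] ++ [seq (u, v) | u <- s2] ++ l), T; split=> //.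
  - apply: edge_list_remaining_vertex el _ _ us => // u.
    rewrite !mem_cat mem1 memw mem2 Rv /= andbT.
    case: (eqVneq u x) => [->|ux]; rewrite ?andbF ?andbT ?orbF //=.
    rewrite ?andbF ?orFb; case: (eqVneq u w) => [->|uw]; rewrite ?andbF ?andbT ?orbF ?orFb //=.
    by rewrite wU.
  - rewrite map_cat -catA TE coef_to_sinks // => u; rewrite mem1 => /and3P[uU evu /eqP ux].
    by rewrite ux eq_sym vx d'x.
  split; rewrite ?Tx ?Ty ?wx0 ?wy0 // => u uA.
  case: (eqVneq u v) => [->|uv]; first by rewrite wv addr0 bA2.
  by have := TA u uA uv; have := dA u; rewrite inE uA => /(_ isT); clear; lia.
pose S := \sum_(u <- s2) unit_expo u.
have SE u : S u = (u \in s2)%:Z := sum_unit_expoE u (enum_uniq _).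
have nvE u k : (unit_expo v *+ k) u = if u == v then k%:Z else 0.
  by rewrite ffunMnE unit_expoE; case: eqP => _ /=; rewrite ?mul0rn // natz.
have d0 u : 0 <= d u := coef_ge0 u nz.
have noW : ~~ W -> nice U e A x y.
  move=> nW; apply: (finish (d + S + unit_expo v *+ size s1) (d + S)) => //.
  - by rewrite /sw (negPf nW) /= coef_in_edges.
  - by rewrite expo_addE SE dx0 (negPf (A2 x xA)).
  split=> [|||u uA uv|u]; rewrite !expoE SE nvE.
  - by rewrite dx0 eq_sym (negPf vx) (negPf (A2 x xA)).
  - by rewrite dy0 eq_sym (negPf vy) (negPf (A2 y yA)).
  - by rewrite eqxx dv (negPf v2); move: size1; clear => /=; lia.
  - by rewrite (negPf uv) (negPf (A2 u uA)) !addr0.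
  case: (eqVneq u v) => [->|uv]; first by rewrite dv (negPf v2); move: bIE size1; clear; case: (wt) => /=; lia.
  case: (boolP (u \in s2)) => us2 /=; last by have := dI u; clear; lia.
  by have := dA2 u us2; have := weight_ge0 wt R u; move: bIE; clear; case: (wt) => /=; lia.
case: (boolP W) => [|/noW//] /andP[evw wx] {noW}.
have swE : sw = [:: w] by rewrite /sw /W evw wx.
have wv' := ev w evw.
have w2 : w \notin s2 by rewrite mem2 eqxx !andbF.
pose c := coef ([seq (u, v) | u <- s2] ++ l) (d - unit_expo w + unit_expo v + S).
case: (eqVneq c 0) => [c0|].
  apply: (finish (d + S + unit_expo v + unit_expo v *+ size s1) (d + S + unit_expo v)) => //.
  - rewrite swE /= addrK coef_in_edges //.
    by rewrite [d + S + _]addrAC (_ : _ - unit_expo w = d - unit_expo w + unit_expo v + S)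
      -?/c ?c0 ?subr0 // -!addrA; congr (_ + _); rewrite [RHS]addrCA; congr (_ + _); rewrite addrC.
  - by rewrite !expoE SE dx0 (negPf (A2 x xA)) eq_sym (negPf vx).
  split=> [|||u uA uv|u]; rewrite !expoE SE nvE.
  - by rewrite dx0 eq_sym (negPf vx) (negPf (A2 x xA)).
  - by rewrite dy0 eq_sym (negPf vy) (negPf (A2 y yA)).
  - by rewrite eqxx dv (negPf v2) /=; move: size1; clear; lia.
  - by rewrite (negPf uv) (negPf (A2 u uA)) !addr0.
  case: (eqVneq u v) => [->|uv] /=; first by rewrite dv (negPf v2) /=; move: bIE size1; clear; case: (wt) => /=; lia.
  case: (boolP (u \in s2)) => us2 /=; last by have := dI u; clear; lia.
  by have := dA2 u us2; have := weight_ge0 wt R u; move: bIE; clear; case: (wt) => /=; lia.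
rewrite /c /S => /coef_in_edges_one[] //.
  by rewrite !expoE dv eq_sym wv'.
move=> t t2 nzt; have := t2; rewrite mem2 => /and4P[tU evt tx tw].
have tA : t \notin A by apply: contraL t2 => /A2.
have xt : (x == t) = false by apply: contraNF tA => /eqP<-.
have yt : (y == t) = false by apply: contraNF tA => /eqP<-.
have tv := ev t evt.
have vt : (v == t) = false by rewrite eq_sym.
have xv : (x == v) = false by rewrite eq_sym (negPf vx).
have yv : (y == v) = false by rewrite eq_sym (negPf vy).
have wt' : (w == t) = false by rewrite eq_sym (negPf tw).
(* In the first case treated [t] gains two units. Its exponent was at most 2, which suffices for the
   bound 4; if [t] is matched, it was at most 1, which suffices for 3. *)
case: (boolP (wt && (weight wt R t == 0))) => [/andP[wt1 /eqP Rt0]|matched]; last first.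
  pose d' := d + unit_expo t + S.
  apply: (finish (d' + unit_expo v *+ size s1) d') => //.
  - rewrite swE /=.
    have -> : d' - unit_expo w = d - unit_expo w + unit_expo t + S by rewrite /d' addrAC [d + _ - _]addrAC.
    rewrite coef_in_edges ?oppr_eq0 //; last by rewrite !expoE dv vt eq_sym wv'.
    set c' := coef _ (d' - unit_expo v); suff -> : c' = 0 by rewrite sub0r oppr_eq0.
    by apply: (@coef_negative _ _ _ v); rewrite !expoE SE dv vt (negPf v2) eqxx.
  - by rewrite !expoE SE dx0 (negPf (A2 x xA)) xt.
  split=> [|||u uA uv|u]; rewrite !expoE SE nvE.
  - by rewrite dx0 xv xt (negPf (A2 x xA)).
  - by rewrite dy0 yv yt (negPf (A2 y yA)).
  - by rewrite eqxx dv vt (negPf v2) /=; move: size1; clear; lia.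
  - have -> : (u == t) = false by apply: contraNF tA => /eqP<-.
    by rewrite (negPf uv) (negPf (A2 u uA)) !addr0.
  case: (eqVneq u v) => [->|uv] /=; first by rewrite dv vt (negPf v2) /=; move: bIE size1; clear; case: (wt) => /=; lia.
  case: (eqVneq u t) => [->|ut] /=.
    rewrite t2 /=; have := dA2 t t2; have := weight_ge0 wt R t; move: matched bIE.
    by rewrite negb_and; clear; case: (wt) => /=; lia.
  case: (boolP (u \in s2)) => us2 /=; last by have := dI u; clear; lia.
  by have := dA2 u us2; have := weight_ge0 wt R u; move: bIE; clear; case: (wt) => /=; lia.
(* Putting [vt] into the matching saves one unit at [t]. The weight that [v] acquires is affordable,
   since [v] keeps at most the arc to [x]. *)
pose s2' := rem t s2.
have us2' : uniq s2' by rewrite rem_uniq ?enum_uniq.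
have mem2' u : (u \in s2') = (u != t) && (u \in s2) by rewrite mem_rem_uniq ?enum_uniq.
have v2' : v \notin s2' by rewrite mem2' (negPf v2) andbF.
pose S' := \sum_(u <- s2') unit_expo u.
have SE' u : S' u = ((u != t) && (u \in s2))%:Z by rewrite -mem2' -sum_unit_expoE.
pose d' := d + unit_expo t + S'; pose T := d' + unit_expo v *+ size s1.
have Rt z : R t z = false by apply: (@unmatched _ wt).
pose R' := add_edge R v t.
have RvE u : e v u -> R' v u = (u == t).
  by move=> evu; rewrite /R' /add_edge Rv eq_set2 eqxx vt /= orbF.
exists R', ([seq (v, u) | u <- s1 ++ sw] ++ [seq (u, v) | u <- s2'] ++ l), T; split.
- split; first exact: add_edge_sym.
    by apply: gmatch => //; rewrite vt.
  move=> a b /orP[/RU'//|].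
  by rewrite !eq_set2 => /orP[]/andP[/eqP-> /eqP->];
    rewrite vU tU ?(se t) evt (negPf vx) (negPf vy) //= !andbF.
- apply: edge_list_remaining_vertex el _ _ _ => //.
  + exact: add_edge_sym.
  + by move=> a b av bv; rewrite /R' /add_edge eq_set2 (negPf av) (negPf bv) andbF /= orbF.
  + move=> u; rewrite !mem_cat mem1 memw mem2' mem2.
    case: (boolP (e v u)) => evu; rewrite ?andbF //= RvE //.
    case: (eqVneq u t) => [->|ut] /=; first by rewrite (negPf tx) (negPf tw) !andbF.
    case: (eqVneq u x) => [->|ux]; rewrite ?andbF ?andbT ?orbF //=.
    by case: (eqVneq u w) => [->|uw]; rewrite ?andbF ?andbT ?orbF ?orFb ?wU.
  move: us; rewrite !(cat_uniq (s1 ++ sw)) us2' => /and3P[-> /hasPn h _].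
  by rewrite andbT; apply/hasPn => u; rewrite mem2' => /andP[_ /h].
- rewrite map_cat -catA coef_to_sinks; last first.
    move=> u; rewrite mem1 => /and3P[uU evu /eqP ux].
    by rewrite ux eq_sym vx !expoE SE' dx0 xt (negPf (A2 x xA)) andbF.
  rewrite swE /=.
  have -> : d' - unit_expo w = d - unit_expo w + unit_expo t + S' by rewrite /d' addrAC [d + _ - _]addrAC.
  rewrite coef_in_edges //; last by rewrite !expoE dv vt eq_sym wv'.
  set c' := coef _ (d' - unit_expo v); suff -> : c' = 0 by rewrite sub0r oppr_eq0.
  by apply: (@coef_negative _ _ _ v); rewrite !expoE SE' dv vt (negPf v2) eqxx.
have TE u : T u = d u + (u == t)%:Z + ((u != t) && (u \in s2))%:Z + (if u == v then (size s1)%:Z else 0).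
  by rewrite !expoE SE' nvE.
split.
- by rewrite weight_add_edge ?xv ?xt // wx0 TE dx0 xt xv (negPf (A2 x xA)).
- by rewrite weight_add_edge ?yv ?yt // wy0 TE dy0 yt yv (negPf (A2 y yA)).
- move=> u uA; case: (eqVneq u v) => [->|uv].
    by rewrite TE dv vt (negPf v2) eqxx /=; have := weight_le1 R' v; move: bA2 size1; clear; lia.
  have ut : u != t by apply: contraNneq tA => <-.
  rewrite weight_add_edge // TE (negPf ut) (negPf (A2 u uA)) (negPf uv) /=.
  by have := dA u; rewrite inE uA => /(_ isT); clear; lia.
move=> u; rewrite TE; case: (eqVneq u v) => [->|uv].
  by rewrite dv vt (negPf v2) /=; move: bIE size1; clear; case: (wt) => /=; lia.
case: (eqVneq u t) => [->|ut] /=.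
  by have := dA2 t t2; have := weight_ge0 wt R t; rewrite bIE wt1; clear; lia.
case: (boolP (u \in s2)) => us2 /=; last by have := dI u; clear; lia.
by have := dA2 u us2; have := weight_ge0 wt R u; move: bIE; clear; case: (wt) => /=; lia.
Qed.

Lemma nice_sym U e A x y : (forall R, good R x y -> good R y x) ->
  nice U e A x y -> nice U e A y x.
Proof.
move=> gs [R [l [d [[sR gR RU] [ul nl lE] nz [dx dy dA dI]]]]].
exists R, l, d; split=> //.
- by split=> // [|u v]; [exact: gs | rewrite [[set y; x]]setUC; exact: RU].
by split=> // u v; rewrite -lE /remaining [[set y; x]]setUC.
Qed.

Definition stacked (U : {set V}) e R x y : Prop := exists l d,
  [/\ edge_list (remaining U e R x y) l, coef l d != 0, d x = 0 /\ d y = 0 & forall u, d u <= bI].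

Lemma stacked_pair e R x y : irreflexive e -> 0 <= bI -> stacked [set x; y] e R x y.
Proof.
move=> ie bI0; exists [::], 0; split; [|by rewrite /= eqxx|by rewrite !ffunE|].
  split=> // u v; apply/negP => /and5P[]; rewrite !in_set2 => uxy vxy euv _ /negP; apply.
  rewrite eq_set2.
  by case/orP: uxy euv => /eqP->; case/orP: vxy => /eqP->; rewrite ?ie ?eqxx ?orbT.
by move=> u; rewrite ffunE.
Qed.

(** All edges from [v] to [U] contribute [v], so the old coefficient survives and only the back
    degree of [v] has to be bounded. *)
Lemma stacked_add U e R x y v : symmetric e -> irreflexive e -> symmetric R ->
  v \notin U -> v != x -> v != y -> #|[set u in U | e v u && ~~ R v u]|%:Z <= bI ->
  stacked U e R x y -> stacked (v |: U) e R x y.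
Proof.
move=> se ie sR vU vx vy cardN [l [d [el nz [dx dy] dI]]].
pose s := enum [set u in U | e v u && ~~ R v u].
have sE u : (u \in s) = [&& u \in U, e v u & ~~ R v u] by rewrite mem_enum inE.
have vs : v \notin s by rewrite sE ie andbF.
have dv : d v = 0 := edge_list_supp el nz vU.
have dE u : (d + unit_expo v *+ size s) u = if u == v then (size s)%:Z else d u.
  rewrite expo_addE ffunMnE unit_expoE; case: eqVneq => [->|_] /=; last by rewrite mul0rn addr0.
  by rewrite dv add0r natz.
exists ([seq (v, u) | u <- s] ++ [seq (u, v) | u <- [::]] ++ l), (d + unit_expo v *+ size s).
split.
- apply: (@edge_list_remaining_vertex _ e R) => //.
  + exact: setU11.
  + by rewrite setU1K.
  + move=> u; rewrite cats0 sE in_setU1; case: (eqVneq u v) => [->|_] //=.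
    by rewrite ie andbF.
  by rewrite cats0 enum_uniq.
- rewrite coef_out_edges // => a /(edge_list_mem el) /and5P[a1 a2 _ _ _].
  by apply/andP; split; apply: contraNneq vU => <-.
- by rewrite !dE ![_ == v]eq_sym (negPf vx) (negPf vy).
by move=> u; rewrite dE; case: eqP => _ //; rewrite -cardE.
Qed.

Lemma nice_stacked U e R x y : symmetric R -> good R x y ->
  (forall u v, R u v -> [&& u \in U, v \in U, e u v & [set u; v] != [set x; y]]) ->
  weight wt R x = 0 -> weight wt R y = 0 ->
  stacked U e R x y -> nice U e set0 x y.
Proof.
move=> sR gR RU wx wy [l [d [el nz [dx dy] dI]]]; exists R, l, d; split=> //.
by split=> // [||u]; rewrite ?dx ?dy ?wx ?wy // inE.
Qed.

End NiceVertex.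

(** * One induction for all three kinds of removed graph *)

Section Assembly.
Variable V : finType.
Implicit Types (e R : rel V) (U A W : {set V}) (u v w x y z p q : V).
Variables (wt : bool) (good : rel V -> V -> V -> Prop) (bA bI : int).

Definition glueable : Prop := forall U1 U2 R1 R2 x y p q,
  (forall u v, R1 u v -> (u \in U1) && (v \in U1)) ->
  (forall u v, R2 u v -> (u \in U2) && (v \in U2)) ->
  (forall u, u \in U1 -> u \in U2 -> u \in [set p; q]) ->
  p = q \/ p \in U1 /\ q \in U1 ->
  p \in U2 -> q \in U2 -> x \in U1 -> y \in U1 ->
  (wt -> forall v, R2 p v = false /\ R2 q v = false) ->
  symmetric R1 -> symmetric R2 -> ~~ R2 p q ->
  good R1 x y -> good R2 p q -> good (fun u v => R1 u v || R2 u v) x y.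

(** What differs between the three bounds is left as hypotheses: closure properties of [good], the
    return of a boundary vertex, and K5. *)
Lemma free_nice e x :
  (forall R R' x y, (forall u v, R' u v -> R u v) -> good R x y -> good R' x y) ->
  (forall R x y, good R x y -> good R y x) ->
  glueable ->
  (forall R v x y z, good R z z -> (forall u, R v u = false) -> symmetric R -> v != z ->
     (x = v /\ y = v) \/ (x = v /\ y = z) -> good R x y) ->
  (forall R x y, good R x y -> good R x x) ->
  (forall x, good (fun _ _ => false) x x) ->
  (1 <= bA)%R -> (bA + 1 <= bI :> int)%R ->
  (forall U e A x y v w, symmetric e -> irreflexive e ->
     v \in U -> x \in A -> y \in A -> v != x -> v != y -> w \in U ->
     (forall u, u \in U -> u \in A -> e v u -> u \in [set x; w]) ->
     nice wt good bA bI (U :\ v) e (A :|: [set u | e v u]) x y ->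
     nice wt good bA bI U e A x y) ->
  (forall U e x y, symmetric e -> irreflexive e -> #|U| = 5 ->
     {in U &, forall u v, u != v -> e u v} -> x \in U -> y \in U -> x != y ->
     nice wt good bA bI U e set0 x y) ->
  symmetric e -> irreflexive e -> ~ has_K33 [set: V] e ->
  nice wt good bA bI [set: V] e set0 x x.
Proof.
move=> gsub gsym gglue gsink gadd gempty bA1 bAI vstep K5 se ie nK.
have bA0 : (0 <= bA)%R by apply: le_trans bA1.
have bI1 : (1 <= bI)%R by move: bA1 bAI; clear; lia.
have bI0 : (0 <= bI)%R by apply: le_trans bI1.
apply: (@K33_free_nice V (@nice V wt good bA bI)) => //; last by left.
- by move=> U e' A x' y' _; apply: nice_sym => R; exact: gsym.
- by move=> U e1 e2 A A' x' y' N s2 sub AA; exact: nice_mono gsub _ _ _ _ _ _ _ N s2 sub AA bA0.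
- move=> U1 U2 e' A x' y' p q se' ie' *; exact: (@nice_glue V wt good bA bI gglue U1 U2 e' A x' y' p q).
- move=> U e' x' y' z se' ie' *; exact: (@nice_sink V wt good bA bI gsink U e' x' y' z).
- move=> e' A x' ie'; exact: nice_single.
- move=> U e' A x' y' se' ie' *; apply: (@nice_addedge V wt good bA bI U e' A x' y') => // R; exact: gadd.
Qed.

End Assembly.

(** * From bag models to minors *)

Section MinorSteps.
Variable V : finType.
Implicit Types (S B X Y Z : {set V}) (E : {set {set V}}) (u v w x y : V).

Definition edge E : rel V := fun u v => [set u; v] \in E.

Lemma edge_sym E : symmetric (edge E).
Proof. by move=> u v; rewrite /edge setUC. Qed.

Lemma edge_irr E : simple_edges E -> irreflexive (edge E).
Proof. by move=> sE u; apply/negP => /sE; rewrite setUid cards1. Qed.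

Definition K33_model S E (f : bool * 'I_3 -> {set V}) : Prop :=
  [/\ forall i, conn (edge E) (f i), forall i, f i \subset S,
      forall i j, i != j -> [disjoint f i & f j]
    & forall i j, i.1 != j.1 -> adj (edge E) (f i) (f j)].

Lemma K33_model_of S E : has_K33 S (edge E) -> exists f, K33_model S E f.
Proof.
move=> [s1 [s2 [z1 z2 /and3P[/allP cs /allP sS /(pairwiseP set0) ds] /allrelP adj12]]].
pose s (b : bool) := if b then s2 else s1.
have mem_s (i : bool * 'I_3) : nth set0 (s i.1) i.2 \in s i.1.
  by apply: mem_nth; rewrite /s; case: i.1; rewrite ?z1 ?z2.
have mem_cat_s (i : bool * 'I_3) : nth set0 (s i.1) i.2 \in s1 ++ s2.
  by have := mem_s i; rewrite mem_cat /s; case: i.1 => ->; rewrite ?orbT.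
pose pos (i : bool * 'I_3) := (if i.1 then 3 + i.2 else i.2 : nat).
have posE (i : bool * 'I_3) : nth set0 (s i.1) i.2 = nth set0 (s1 ++ s2) (pos i).
  rewrite nth_cat z1 /pos /s; case: i.1; last by rewrite ltn_ord.
  by rewrite addnC ltnNge leq_addl /= addnK.
have pos_lt (i : bool * 'I_3) : pos i \in gtn (size (s1 ++ s2)).
  rewrite inE size_cat z1 z2 /pos; case: i.1; first by rewrite ltn_add2l.
  exact: leq_trans (ltn_ord _) _.
have pos_inj : injective pos.
  move=> [[] i] [[] j]; rewrite /pos /= => eij.
  - by congr (_, _); apply/val_inj/eqP; rewrite -(eqn_add2l 3) eij.
  - by have := ltn_ord j; rewrite -eij ltnNge leq_addr.
  - by have := ltn_ord i; rewrite eij ltnNge leq_addr.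
  by congr (_, _); apply/val_inj.
exists (fun i : bool * 'I_3 => nth set0 (s i.1) i.2); split=> [i|i|i j ij|i j].
- exact: cs.
- exact: sS.
- rewrite !posE; case: (ltngtP (pos i) (pos j)) => [lt|lt|/pos_inj E'].
  + exact: ds (pos_lt i) (pos_lt j) lt.
  + by rewrite disjoint_sym; exact: ds (pos_lt j) (pos_lt i) lt.
  by rewrite E' eqxx in ij.
have := mem_s i; have := mem_s j; rewrite /s; case: i.1; case: j.1 => // jm im _.
  by rewrite adj_sym; [exact: adj12|exact: edge_sym].
exact: adj12.
Qed.

Definition reaches_K33 S E : Prop := exists P, minor_of P (S, E) /\ is_K33 P.

Lemma reaches_step S E S' E' : minor_step (S, E) (S', E') ->
  reaches_K33 S' E' -> reaches_K33 S E.
Proof.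
by move=> st [P [PM K]]; exists P; split=> //; apply: rt_trans PM; apply: rt_step.
Qed.

Definition K33_edges (g : bool * 'I_3 -> V) : {set {set V}} :=
  [set [set g x; g y] | x in [set: bool * 'I_3], y in [set y : bool * 'I_3 | y.1 != x.1]].

Lemma reaches_K33_edges (g : bool * 'I_3 -> V) E : injective g -> K33_edges g \subset E ->
  reaches_K33 (g @: [set: bool * 'I_3]) E.
Proof.
move=> ginj; have [n] := ubnP #|E :\: K33_edges g|; elim: n E => // n IH E; rewrite ltnS => En KE.
case: (set_0Vmem (E :\: K33_edges g)) => [E0|[d dE]].
  exists (g @: [set: bool * 'I_3], E); split; first exact: rt_refl.
  exists g; split=> //; split=> //=; apply/eqP; rewrite eqEsubset KE andbT.
  by rewrite -setD_eq0 E0 eqxx.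
have := dE; rewrite inE => /andP[dK dE']; apply: (reaches_step (DelEdge _ dE')).
apply: IH; last by apply/subsetD1P.
apply: leq_trans En; apply: proper_card; apply/properP; split; first exact: setSD (subsetDl _ _).
by exists d; rewrite // !inE eqxx andbF.
Qed.

Lemma reaches_singletons (g : bool * 'I_3 -> V) S E : injective g ->
  (forall d, d \in E -> d \subset S) -> (forall i, g i \in S) -> K33_edges g \subset E ->
  reaches_K33 S E.
Proof.
move=> ginj; have [n] := ubnP #|S|; elim: n S E => // n IH S E; rewrite ltnS => Sn ES gS KE.
case: (set_0Vmem (S :\: g @: [set: bool * 'I_3])) => [S0|[r]].
  have -> : S = g @: [set: bool * 'I_3]; last exact: reaches_K33_edges.
  apply/eqP; rewrite eqEsubset -setD_eq0 S0 eqxx /=.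
  by apply/subsetP => _ /imsetP[i _ ->].
rewrite inE => /andP[rg rS]; have gr i : g i != r.
  by apply: contraNneq rg => <-; apply: imset_f.
apply: (reaches_step (DelVertex E rS)); apply: IH.
- by apply: leq_trans Sn; rewrite [X in _ < X](cardsD1 r) rS.
- by move=> d; rewrite inE => /andP[/ES dS rd]; apply/subsetD1P.
- by move=> i; rewrite in_setD1 gr gS.
apply/subsetP => d dK; rewrite inE (subsetP KE) //; case/imset2P: dK => i j _ _ ->.
by rewrite !inE negb_or ![r == _]eq_sym !gr.
Qed.

Definition contracted S E u v : {set {set V}} := [set d in E | v \notin d] :|:
  [set [set u; w] | w in [set w in S | ([set v; w] \in E) && (w != u)]].

Section Contraction.
Variables (S : {set V}) (E : {set {set V}}) (u v : V).
Hypotheses (sE : simple_edges E) (ES : forall d, d \in E -> d \subset S)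
  (uvE : [set u; v] \in E) (uv : u != v).

Let proj t := if t == v then u else t.

Lemma contracted_edge a b : edge E a b -> proj a != proj b ->
  edge (contracted S E u v) (proj a) (proj b).
Proof.
rewrite /edge /proj => abE.
have inS : (a \in S) && (b \in S) by have := ES abE; rewrite subUset !sub1set.
have star w : w \in S -> [set v; w] \in E -> w != u -> [set u; w] \in contracted S E u v.
  move=> wS vwE wu; rewrite inE; apply/orP; right; apply/imsetP; exists w => //.
  by rewrite inE wS vwE.
have [aS bS] := andP inS.
case: (eqVneq a v) => [av|av]; case: (eqVneq b v) => [bv|bv]; rewrite ?eqxx // => ne.
- by apply: star; rewrite -?av // eq_sym.
- by rewrite setUC; apply: star; rewrite // -bv setUC.
by rewrite !inE abE negb_or ![v == _]eq_sym av bv.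
Qed.

Lemma contracted_simple : simple_edges (contracted S E u v).
Proof.
move=> d; rewrite inE => /orP[|/imsetP[w]]; first by rewrite inE => /andP[/sE].
by rewrite inE => /and3P[_ _ wu] ->; rewrite cards2 eq_sym wu.
Qed.

Lemma contracted_within d : d \in contracted S E u v -> d \subset S :\ v.
Proof.
have [uS vS] : u \in S /\ v \in S.
  by have := ES uvE; rewrite subUset !sub1set => /andP[].
rewrite inE => /orP[|/imsetP[w]]; first by rewrite inE => /andP[/ES dS vd]; apply/subsetD1P.
rewrite inE => /and3P[wS vwE wu] ->; rewrite subUset !sub1set !in_setD1 uv uS wS /= andbT.
by apply: contraTneq vwE => ->; apply/negP => /sE; rewrite setUid cards1.
Qed.

Let proj_in B t : (v \in B -> u \in B) -> t \in B -> proj t \in B :\ v.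
Proof.
rewrite /proj => vuB tB; case: eqP => [tv|/eqP tv]; rewrite in_setD1 ?tv ?tB //.
by rewrite uv vuB // -tv.
Qed.

(** A cut of [B :\ v] is pulled back to [B] by putting [v] on the side of [u]; an edge across it
    projects to an edge across the original cut. *)
Lemma contracted_conn B : (v \in B -> u \in B) -> conn (edge E) B ->
  conn (edge (contracted S E u v)) (B :\ v).
Proof.
move=> vuB /connP[B0 cB]; apply/connP; split=> [|Z ZB Z0 ZnB].
  by have [b bB] := set0Pn _ B0; apply/set0Pn; exists (proj b); exact: proj_in.
have vZ : v \notin Z by apply/negP => /(subsetP ZB); rewrite in_setD1 eqxx.
pose Z' := if (u \in Z) && (v \in B) then v |: Z else Z.
have inZ' t : t \in Z' -> (t \in B) && (proj t \in Z).
  rewrite /Z' /proj; case: ifP => [/andP[uZ vB]|_].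
    rewrite in_setU1 => /orP[/eqP->|tZ]; first by rewrite eqxx vB uZ.
    have := subsetP ZB t tZ; rewrite in_setD1 => /andP[/negPf-> ->] //.
  by move=> tZ; have := subsetP ZB t tZ; rewrite in_setD1 => /andP[/negPf-> ->].
have outZ' t : t \in B -> t \notin Z' -> proj t \notin Z.
  rewrite /Z' /proj => tB; case: ifP => [/andP[uZ vB]|nuv].
    by rewrite in_setU1 negb_or => /andP[/negPf->].
  case: eqP => // tv _; apply/negP => uZ; move: nuv; by rewrite uZ -tv tB.
have [|||a [b [aZ bB bZ eab]]] := cB Z'.
- by apply/subsetP => t /inZ'/andP[].
- have [z zZ] := set0Pn _ Z0; apply/set0Pn; exists z; rewrite /Z'.
  by case: ifP => // _; rewrite in_setU1 zZ orbT.
- apply: contra ZnB => /eqP Z'B; rewrite eqEsubset ZB; apply/subsetP => t.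
  rewrite in_setD1 => /andP[tv tB]; have := inZ' t; rewrite Z'B tB => /(_ isT) /= .
  by rewrite /proj (negPf tv).
have [aB paZ] := andP (inZ' a aZ); have pbZ := outZ' b bB bZ.
exists (proj a), (proj b); split=> //; first exact: proj_in.
by apply: contracted_edge => //; apply: contraNneq pbZ => <-.
Qed.

Lemma contracted_model f i : K33_model S E f -> u \in f i -> v \in f i ->
  K33_model (S :\ v) (contracted S E u v) (fun j => f j :\ v).
Proof.
move=> [cf fS df af] ui vi.
have vu j : v \in f j -> u \in f j.
  move=> vj; case: (eqVneq i j) => [<-//|/df]; rewrite disjoint_subset => /subsetP/(_ v vi).
  by rewrite inE vj.
have dis j k : j != k -> [disjoint f j :\ v & f k :\ v].
  by move=> jk; apply: disjointWl (subsetDl _ _) _; apply: disjointWr (subsetDl _ _) _; exact: df.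
split=> [j|j|//|j k jk]; first exact: contracted_conn (vu j) (cf j).
  exact: setSD.
have /adjP[a [b [aj bk eab]]] := af j k jk; apply/adjP; exists (proj a), (proj b).
have pa := proj_in (vu j) aj; have pb := proj_in (vu k) bk; split=> //.
apply: contracted_edge => //; apply: contraTneq pa => ->; apply/negP => pj.
have /dis : j != k by apply: contraNneq jk => ->.
by rewrite disjoint_subset => /subsetP/(_ _ pj); rewrite inE pb.
Qed.

End Contraction.

(** A bag with several vertices has an inner edge, whose contraction keeps the model and shrinks the
    graph. Once all bags are single vertices, deletions leave exactly K33. *)
Lemma reaches_of_model S E f : simple_edges E -> (forall d, d \in E -> d \subset S) ->
  K33_model S E f -> reaches_K33 S E.
Proof.
have [n] := ubnP #|S|; elim: n S E f => // n IH S E f; rewrite ltnS => Sn sE ES mf.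
have [cf fS df af] := mf.
case: (boolP [exists i, 1 < #|f i|]) => [/existsP[i]|].
  have [u ui] := set0Pn _ (conn0 (cf i)).
  move=> fi1; have /connP[_ ci] := cf i; have [|||u' [v [+ vi vu euv]]] := ci [set u].
  - by rewrite sub1set.
  - by apply/set0Pn; exists u; rewrite inE.
  - by apply: contraTneq fi1 => <-; rewrite cards1.
  rewrite inE => /eqP u'u; rewrite {}u'u in euv; rewrite inE eq_sym in vu.
  apply: (reaches_step (Contract S euv vu)); apply: (IH _ _ (fun j => f j :\ v)).
  - by apply: leq_trans Sn; rewrite [X in _ < X](cardsD1 v) (subsetP (fS i)).
  - exact: contracted_simple.
  - exact: contracted_within.
  by apply: (contracted_model _ _ mf ui vi).
rewrite negb_exists => /forallP f1.
have ex (i : bool * 'I_3) : exists u, f i == [set u].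
  have [u ui] := set0Pn _ (conn0 (cf i)); exists u; rewrite eq_sym eqEcard sub1set ui cards1.
  by have := f1 i; rewrite -leqNgt.
pose g i := xchoose (ex i); have fg i : f i = [set g i] := eqP (xchooseP (ex i)).
apply: (@reaches_singletons g) => //.
- move=> i j gij; apply: contraTeq isT => /df.
  by rewrite !fg gij -setI_eq0 setIid => /eqP/setP/(_ (g j)); rewrite !inE eqxx.
- by move=> i; have := fS i; rewrite fg sub1set.
apply/subsetP => _ /imset2P[i j _ + ->]; rewrite inE eq_sym => ij.
by have /adjP[a [b []]] := af i j ij; rewrite !fg !inE => /eqP-> /eqP->.
Qed.

Lemma no_K33 E : simple_edges E -> K33_minor_free E -> ~ has_K33 [set: V] (edge E).
Proof.
move=> sE free /K33_model_of[f mf]; apply: free.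
by have [P [PM K]] := reaches_of_model sE (fun d _ => subsetT d) mf; exists P.
Qed.

End MinorSteps.

(** * The three bounds *)

Section Instances.
Variable V : finType.
Implicit Types (e R : rel V) (U A W : {set V}) (u v w x y z p q : V).

Definition no_removed R x y : Prop := forall u v, R u v = false.
Definition matching_removed R x y : Prop := forall u v v', R u v -> R u v' -> v = v'.

Lemma pick_K5 U x y : #|U| = 5 -> x \in U -> y \in U -> x != y ->
  exists z1 z2 z3, [/\ U = z3 |: (z2 |: (z1 |: [set x; y])),
    [/\ z1 != x, z1 != y, z2 != x & z2 != y], [/\ z3 != x, z3 != y & z2 != z1] &
    z3 != z1 /\ z3 != z2].
Proof.
move=> c5 xU yU xy.
have next (W : {set V}) n : W \subset U -> #|W| = n -> n < 5 -> exists2 z, z \in U & z \notin W.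
  move=> WU Wn n5; have /properP[_ [z]] : W \proper U.
    by rewrite properEcard WU Wn c5.
  by exists z.
have xyU : [set x; y] \subset U by rewrite subUset !sub1set xU.
have [//|//|z1 z1U n1] := next [set x; y] 2 xyU; first by rewrite cards2 xy.
have [|||z2 z2U n2] := next (z1 |: [set x; y]) 3.
- by rewrite subUset sub1set z1U.
- by rewrite cardsU1 n1 cards2 xy.
- by [].
have [|||z3 z3U n3] := next (z2 |: (z1 |: [set x; y])) 4.
- by rewrite !subUset !sub1set z1U z2U xU.
- by rewrite cardsU1 n2 cardsU1 n1 cards2 xy.
- by [].
exists z1, z2, z3; split.
- apply/eqP; rewrite eq_sym eqEcard !subUset !sub1set z1U z2U z3U xU yU /= c5.
  by rewrite cardsU1 n3 cardsU1 n2 cardsU1 n1 cards2 xy.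
- by move: n1 n2; rewrite !inE !negb_or => /andP[-> ->] /and3P[_ -> ->].
- by move: n2 n3; rewrite !inE !negb_or => /and3P[-> _ _] /and4P[_ _ -> ->].
by move: n3; rewrite !inE !negb_or => /and4P[-> -> _ _].
Qed.

Lemma stacked_K5 (bI : int) U e R x y z1 z2 z3 : symmetric e -> irreflexive e -> symmetric R ->
  U = z3 |: (z2 |: (z1 |: [set x; y])) ->
  [/\ z1 != x, z1 != y, z2 != x & z2 != y] -> [/\ z3 != x, z3 != y & z2 != z1] ->
  z3 != z1 /\ z3 != z2 ->
  (0 <= bI)%R ->
  (#|[set u in [set x; y] | e z1 u && ~~ R z1 u]|%:Z <= bI)%R ->
  (#|[set u in z1 |: [set x; y] | e z2 u && ~~ R z2 u]|%:Z <= bI)%R ->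
  (#|[set u in z2 |: (z1 |: [set x; y]) | e z3 u && ~~ R z3 u]|%:Z <= bI)%R ->
  stacked bI U e R x y.
Proof.
move=> se ie sR -> [z1x z1y z2x z2y] [z3x z3y z21] [z31 z32] bI0 c1 c2 c3.
have z1N : z1 \notin [set x; y] by rewrite !inE negb_or z1x.
have z2N : z2 \notin z1 |: [set x; y] by rewrite !inE !negb_or z21 z2x.
have z3N : z3 \notin z2 |: (z1 |: [set x; y]) by rewrite !inE !negb_or z31 z32 z3x.
apply: stacked_add => //; apply: stacked_add => //; apply: stacked_add => //.
exact: stacked_pair.
Qed.

Lemma card_subset_seq (N : {set V}) (s : seq V) : {subset N <= s} -> #|N| <= size s.
Proof.
move=> sub; rewrite cardE; apply: uniq_leq_size; first exact: enum_uniq.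
by move=> z; rewrite mem_enum; exact: sub.
Qed.

Lemma nice_five e x : symmetric e -> irreflexive e -> ~ has_K33 [set: V] e ->
  nice false no_removed 2 4 [set: V] e set0 x x.
Proof.
move=> se ie nK; apply: free_nice => //.
- by move=> R R' x0 y0 sub R0 u v; apply/negP => /sub; rewrite R0.
- move=> U1 U2 R1 R2 x' y' p q _ _ _ _ _ _ _ _ _ _ _ _ R10 R20 u v.
  by rewrite R10 R20.
- by move=> U e' A x' y' v w *; exact: (@nice_vertex_two V false no_removed 2 4 U e' A x' y' v w).
move=> U e' x' y' se' ie' c5 complete xU yU xy.
have [z1 [z2 [z3 [UE Z1 Z2 Z3]]]] := pick_K5 c5 xU yU xy.
(* K5 without [x'y'], built up from these two by [z1], [z2], [z3], has back degrees 2, 3, 4. *)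
apply: (@nice_stacked _ _ _ _ _ _ _ (fun _ _ => false)) => //.
apply: (stacked_K5 se' ie' _ UE Z1 Z2 Z3) => //; rewrite lez_nat.
- apply: (@leq_trans 2) => //; apply: (@card_subset_seq _ [:: x'; y']) => u.
  by rewrite !inE => /andP[].
- apply: (@leq_trans 3) => //; apply: (@card_subset_seq _ [:: z1; x'; y']) => u.
  by rewrite !inE => /andP[].
apply: (@card_subset_seq _ [:: z2; z1; x'; y']) => u.
by rewrite !inE => /andP[].
Qed.

Lemma add_edge_eq R (a b : V) u v : add_edge R a b u v =
  R u v || ((u == a) && (v == b) || (u == b) && (v == a)).
Proof. by rewrite /add_edge eq_set2. Qed.

Lemma nice_four e x : symmetric e -> irreflexive e -> ~ has_K33 [set: V] e ->
  nice true matching_removed 2 3 [set: V] e set0 x x.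
Proof.
move=> se ie nK; apply: free_nice => //.
- by move=> R R' x0 y0 sub mR u v v' /sub r1 /sub r2; exact: mR r1 r2.
(* A vertex matched on both sides would be [p] or [q], but these are unmatched on the second
   side. *)
- move=> U1 U2 R1 R2 x' y' p q R1U R2U U12 _ _ _ _ _ /(_ isT) R2pq _ _ _ m1 m2 u v v'.
  have no a b c : R1 a b -> R2 a c -> v = v'.
    move=> /R1U /andP[a1 _] R2ac; have /R2U /andP[a2 _] := R2ac.
    have [pF qF] := R2pq c; move: R2ac.
    by have := U12 a a1 a2; rewrite !inE => /orP[]/eqP->; rewrite ?pF ?qF.
  by case/orP=> r1; case/orP=> r2; [exact: m1 r1 r2|exact: no r1 r2|exact: no r2 r1|exact: m2 r1 r2].
- move=> U e' A x' y' v w *; apply: (@nice_vertex_two V true matching_removed 2 3 U e' A x' y' v w) => //.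
  move=> _ R u sR Rv Ru vu mR a b b'; rewrite !add_edge_eq.
  have Rv' c : R c v = false by rewrite sR.
  have Ru' c : R c u = false by rewrite sR.
  case: (eqVneq a v) => [->|av].
    by rewrite !Rv (negPf vu) /= !orbF => /eqP-> /eqP->.
  case: (eqVneq a u) => [->|au].
    by rewrite !Ru /= => /eqP-> /eqP->.
  by rewrite /= !orbF; exact: mR.
move=> U e' x' y' se' ie' c5 complete xU yU xy.
have [z1 [z2 [z3 [UE Z1 Z2 Z3]]]] := pick_K5 c5 xU yU xy.
have [z1x z1y z2x z2y] := Z1; have [z3x z3y z21] := Z2; have [z31 z32] := Z3.
(* Only [z3], with back degree 4, exceeds the bound 3; matching it to [z2] repairs this. *)
pose R := add_edge (fun _ _ => false) z3 z2.
have sR : symmetric R by exact: add_edge_sym.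
have inU : [/\ z1 \in U, z2 \in U & z3 \in U] by rewrite UE !inE !eqxx !orbT.
have [z1U z2U z3U] := inU.
apply: (@nice_stacked _ _ _ _ _ _ _ R) => //.
- move=> u v v'; rewrite /R !add_edge_eq /=.
  by case/orP=> /andP[/eqP-> /eqP->]; rewrite !eqxx ?(negPf z32) ?[z2 == z3]eq_sym ?(negPf z32) ?orbF //= => /eqP.
- move=> u v; rewrite /R add_edge_eq /= => /orP[]/andP[/eqP-> /eqP->];
    rewrite z2U z3U complete //= ?eq_set2 ?(negPf z2x) ?(negPf z2y) ?(negPf z3x) ?(negPf z3y) //.
  by rewrite eq_sym.
- by rewrite /weight (_ : [exists v, _] = false) ?andbF //; apply/existsP => - [v];
    rewrite /R add_edge_eq ![x' == _]eq_sym (negPf z2x) (negPf z3x).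
- by rewrite /weight (_ : [exists v, _] = false) ?andbF //; apply/existsP => - [v];
    rewrite /R add_edge_eq ![y' == _]eq_sym (negPf z2y) (negPf z3y).
apply: (stacked_K5 se' ie' _ UE Z1 Z2 Z3) => //; rewrite lez_nat.
- apply: (@leq_trans 2) => //; apply: (@card_subset_seq _ [:: x'; y']) => u.
  by rewrite !inE => /andP[].
- apply: (@card_subset_seq _ [:: z1; x'; y']) => u.
  by rewrite !inE => /andP[].
apply: (@card_subset_seq _ [:: z1; x'; y']) => u.
rewrite inE [R _ _]add_edge_eq !inE eqxx /= => /and3P[+ _].
by rewrite negb_or => /orP[/eqP->|//]; rewrite eqxx.
Qed.

End Instances.

(** * Forests by edge counts, and the third bound *)

Section Forests.
Variable V : finType.
Implicit Types (e R : rel V) (U A W : {set V}) (u v w x y z p q : V).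

Definition inner_arcs R W : {set V * V} := [set a | [&& a.1 \in W, a.2 \in W & R a.1 a.2]].

(* [inner_arcs] has both directions of each edge: at most [#|W| - 1] edges inside [W]. *)
Definition forest R : Prop := forall W, W != set0 -> #|inner_arcs R W| + 2 <= 2 * #|W|.

Lemma forest_sub R R' : (forall u v, R' u v -> R u v) -> forest R -> forest R'.
Proof.
move=> sub fR W W0; apply: leq_trans (fR W W0); rewrite leq_add2r subset_leq_card //.
by apply/subsetP => a; rewrite !inE => /and3P[-> -> /sub].
Qed.

Lemma forest_empty : forest (fun _ _ => false).
Proof.
move=> W; rewrite -card_gt0 => W0; rewrite (_ : inner_arcs _ _ = set0) ?cards0.
  by rewrite add0n -{1}[2]muln1 leq_mul2l.
by apply/setP => a; rewrite !inE !andbF.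
Qed.

(** A set containing the new leaf [v] has one vertex and at most one edge more than the set without
    it. *)
Lemma forest_leaf R v w : (forall u, R v u = false) -> symmetric R -> v != w ->
  forest R -> forest (add_edge R v w).
Proof.
move=> Rv sR vw fR W W0; case: (boolP (v \in W)) => vW; last first.
  apply: leq_trans (fR W W0); rewrite leq_add2r subset_leq_card //.
  apply/subsetP => a; rewrite !inE add_edge_eq => /and3P[a1 a2].
  rewrite a1 a2 => /orP[//|/orP[]/andP[/eqP aE /eqP bE]].
    by move: a1; rewrite aE (negPf vW).
  by move: a2; rewrite bE (negPf vW).
have subW : inner_arcs (add_edge R v w) W \subset inner_arcs R (W :\ v) :|:
    (if w \in W then [set (v, w); (w, v)] else set0).
  apply/subsetP => -[a b]; rewrite !inE add_edge_eq /= => /and3P[aW bW].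
  case/orP=> [Rab|].
    have -> : a != v by apply: contraTneq Rab => ->; rewrite Rv.
    have -> : b != v by apply: contraTneq Rab => ->; rewrite sR Rv.
    by rewrite aW bW Rab.
  case/orP=> /andP[/eqP aE /eqP bE]; move: aW bW; rewrite aE bE => aW bW;
    rewrite ?aW ?bW !inE !xpair_eqE !eqxx ?orbT //.
have cW : #|W| = (#|W :\ v|).+1 by rewrite (cardsD1 v) vW.
(* If [W] is only the vertex [v], the new edge does not fit inside; this case is kept apart because
   the count fails for the empty set. *)
have c2 : #|if w \in W then [set (v, w); (w, v)] else set0| <= 2 * (W :\ v != set0).
  case: ifP => wW; last by rewrite cards0.
  have -> : W :\ v != set0 by apply/set0Pn; exists w; rewrite !inE eq_sym vw.
  by rewrite muln1 cards2; case: eqP.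
have le := leq_trans (subset_leq_card subW) (leq_card_setU _ _).
have {c2}le := leq_trans le (leq_add (leqnn _) c2).
case: (eqVneq (W :\ v) set0) cW le => [->|W0'] cW le.
  have arcs0 : inner_arcs R set0 = set0 by apply/setP => a; rewrite !inE.
  by move: le cW; rewrite arcs0 !cards0 /= muln0; clear; lia.
by have := fR _ W0'; move: le cW => /=; clear; lia.
Qed.

(** The deleted edge counts as a forest edge, so [x] and [y] are not joined within [R]. A side glued
    along [pq] then cannot close a cycle with a path between [p] and [q] on the other side. *)
Definition forest_removed R x y : Prop := forest (if x == y then R else add_edge R x y).

Lemma forest_removed_sub R R' x y : (forall u v, R' u v -> R u v) ->
  forest_removed R x y -> forest_removed R' x y.
Proof.
rewrite /forest_removed => sub; case: eqP => _; apply: forest_sub => // u v.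
by rewrite /add_edge => /orP[/sub->|->]; rewrite ?orbT.
Qed.

Lemma forest_of_removed R x y : forest_removed R x y -> forest R.
Proof.
rewrite /forest_removed; case: eqP => _ //; apply: forest_sub => u v.
by rewrite /add_edge => ->.
Qed.

(** Add the counts for the parts of [W] in the two sides. Their overlap lies in [p], [q]; an overlap
    of two vertices costs one edge too many, which the edge [pq] counted only in [r2] makes up
    for. *)
Lemma forest_glue : glueable false (@forest_removed).
Proof.
move=> U1 U2 R1 R2 x y p q R1U R2U U12 pq pU2 qU2 xU1 yU1 _ sR1 sR2 nR2pq f1 f2.
have [r1 [r2 [r1E r2E]]] : exists r1 r2, r1 = (if x == y then R1 else add_edge R1 x y) /\
    r2 = (if p == q then R2 else add_edge R2 p q) by do 2 eexists.
rewrite /forest_removed -r1E in f1; rewrite /forest_removed -r2E in f2.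
have r1U u v : r1 u v -> (u \in U1) && (v \in U1).
  rewrite r1E; case: eqP => _; first exact: R1U.
  by rewrite add_edge_eq => /orP[/R1U//|/orP[]/andP[/eqP-> /eqP->]]; rewrite xU1 yU1.
have sub12 : forall u v, (if x == y then (fun u v => R1 u v || R2 u v)
     else add_edge (fun u v => R1 u v || R2 u v) x y) u v -> r1 u v || R2 u v.
  by move=> u v; rewrite r1E /add_edge; case: (x == y) => //; rewrite -!orbA; case: (R1 u v) => //=; rewrite orbC.
rewrite /forest_removed; apply: forest_sub sub12 _ => W W0.
have split : inner_arcs (fun u v => r1 u v || R2 u v) W \subset
    inner_arcs r1 (W :&: U1) :|: inner_arcs R2 (W :&: U2).
  apply/subsetP => a; rewrite !inE => /and3P[-> ->] /= /orP[r|r].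
    by have /andP[-> ->] := r1U _ _ r; rewrite r.
  by have /andP[-> ->] := R2U _ _ r; rewrite r orbT.
have le := leq_trans (subset_leq_card split) (leq_card_setU _ _).
have arcs0 R : inner_arcs R set0 = set0 by apply/setP => a; rewrite !inE.
have sub2 : #|inner_arcs R2 (W :&: U2)| <= #|inner_arcs r2 (W :&: U2)|.
  rewrite subset_leq_card //; apply/subsetP => a; rewrite !inE => /and3P[-> -> h] /=.
  by rewrite r2E /add_edge; case: (p == q); rewrite h.
have cardU : #|W :&: U1| + #|W :&: U2| <= #|W| + #|W :&: U1 :&: (W :&: U2)|.
  rewrite -cardsUI leq_add2r subset_leq_card //.
  by rewrite subUset !subsetIl.
have le1 : #|W :&: U1| <= #|W| by rewrite subset_leq_card // subsetIl.
have le2 : #|W :&: U2| <= #|W| by rewrite subset_leq_card // subsetIl.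
have Wpos : 0 < #|W| by rewrite card_gt0.
case: (eqVneq (W :&: U1) set0) => [W1|W1].
  rewrite W1 arcs0 cards0 in le.
  case: (eqVneq (W :&: U2) set0) => [W2|W2].
    by rewrite W2 arcs0 cards0 in le; move: le Wpos; clear; lia.
  by have := f2 _ W2; move: le sub2 le2; clear; lia.
have h1 := f1 _ W1.
case: (eqVneq (W :&: U2) set0) => [W2|W2].
  by rewrite W2 arcs0 cards0 in le; move: le h1 le1; clear; lia.
have h2 := f2 _ W2.
have interpq : W :&: U1 :&: (W :&: U2) \subset [set p; q].
  by apply/subsetP => u; rewrite !inE => /andP[/andP[_ u1] /andP[_ u2]]; have := U12 u u1 u2; rewrite !inE.
case: (boolP ((p != q) && ([set p; q] \subset W))) => [/andP[npq]|small].
  rewrite subUset !sub1set => /andP[pW qW].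
  have : #|inner_arcs R2 (W :&: U2)| + 2 <= #|inner_arcs r2 (W :&: U2)|.
    have two : #|[set (p, q); (q, p)]| = 2 by rewrite cards2 xpair_eqE negb_and npq.
    have dis : [disjoint inner_arcs R2 (W :&: U2) & [set (p, q); (q, p)]].
      apply/pred0P => a; apply/negP => /andP[/=]; rewrite !inE => /and3P[_ _ R2a].
      by case/orP=> /eqP aE; move: nR2pq R2a; rewrite aE /= ?(sR2 q) => /negPf->.
    rewrite -two -cardsUI (disjoint_setI0 dis) cards0 addn0.
    apply: subset_leq_card; apply/subsetP => a; rewrite in_setU => /orP[].
      by rewrite !inE => /and3P[-> -> h]; rewrite r2E /add_edge; case: (p == q); rewrite h.
    rewrite !inE r2E (negPf npq) /= add_edge_eq => /orP[]/eqP->;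
      by rewrite /= pW qW pU2 qU2 !eqxx ?orbT.
  have : #|W :&: U1 :&: (W :&: U2)| <= 2.
    by apply: leq_trans (subset_leq_card interpq) _; rewrite cards2; case: eqP.
  by move: le h1 h2 cardU; clear; lia.
have : #|W :&: U1 :&: (W :&: U2)| <= 1.
  case: (eqVneq p q) small => [pq' _|npq] /=.
    by apply: leq_trans (subset_leq_card interpq) _; rewrite pq' setUid cards1.
  rewrite subUset !sub1set negb_and => small.
  have [z inz] : exists z, W :&: U1 :&: (W :&: U2) \subset [set z].
    case/orP: small => nW; [exists q|exists p]; apply/subsetP => u uI;
      have := subsetP interpq u uI; rewrite !inE => /orP[]/eqP uE //; rewrite ?uE ?eqxx //;
      by move: uI; rewrite !inE uE (negPf nW).
  by apply: leq_trans (subset_leq_card inz) _; rewrite cards1.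
by move: le h1 h2 sub2 cardU; clear; lia.
Qed.

Lemma nice_three e x : symmetric e -> irreflexive e -> ~ has_K33 [set: V] e ->
  nice false forest_removed 1 2 [set: V] e set0 x x.
Proof.
move=> se ie nK; apply: free_nice => //.
- by move=> R R' x0 y0; exact: forest_removed_sub.
- move=> R x0 y0; rewrite /forest_removed [y0 == x0]eq_sym; case: eqP => _ //.
  by apply: forest_sub => u v; rewrite /add_edge [[set y0; x0]]setUC.
- exact: forest_glue.
- move=> R v x0 y0 z; rewrite {1}/forest_removed eqxx => fR Rv sR vz.
  rewrite /forest_removed; case=> -[-> ->]; first by rewrite eqxx.
  by rewrite (negPf vz); exact: forest_leaf.
- by move=> R x0 y0 /forest_of_removed; rewrite /forest_removed eqxx.
- by move=> x0; rewrite /forest_removed eqxx; exact: forest_empty.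
- move=> U e' A x' y' v w *; apply: (@nice_vertex_leaf V false forest_removed 1 2 U e' A x' y' v w) => //.
  move=> R sR Rv vx vy vw; rewrite /forest_removed; case: eqP => _.
    exact: forest_leaf.
  move=> fR; apply: forest_sub (@forest_leaf _ v w _ _ vw fR).
  + by move=> a b; rewrite /add_edge -!orbA [X in _ || X]orbC.
  + by move=> u; rewrite add_edge_eq Rv (negPf vx) (negPf vy).
  exact: add_edge_sym.
move=> U e' x' y' se' ie' c5 complete xU yU xy.
have [z1 [z2 [z3 [UE Z1 Z2 Z3]]]] := pick_K5 c5 xU yU xy.
have [z1x z1y z2x z2y] := Z1; have [z3x z3y z21] := Z2; have [z31 z32] := Z3.
have [x1 y1 x2 y2] : [/\ x' != z1, y' != z1, x' != z2 & y' != z2] by split; rewrite eq_sym.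
have [x3 y3 z12] : [/\ x' != z3, y' != z3 & z1 != z2] by split; rewrite eq_sym.
have [z13 z23] : z1 != z3 /\ z2 != z3 by split; rewrite eq_sym.
pose R0 : rel V := fun _ _ => false.
(* The path [x'], [z3], [z2], [z1] lowers the back degrees of [z2] and [z3] from 3 and 4 to 2, and
   stays a path when [x'y'] is added. *)
pose R := add_edge (add_edge (add_edge R0 z3 x') z2 z3) z1 z2.
have sR0 : symmetric R0 by [].
have sR : symmetric R by do 3!apply: add_edge_sym.
have RE a b : R a b = ((a == z3) && (b == x') || (a == x') && (b == z3)) ||
   ((a == z2) && (b == z3) || (a == z3) && (b == z2)) ||
   ((a == z1) && (b == z2) || (a == z2) && (b == z1)) by rewrite /R !add_edge_eq.
have [z1U z2U z3U] : [/\ z1 \in U, z2 \in U & z3 \in U] by rewrite UE !inE !eqxx !orbT.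
apply: (@nice_stacked _ _ _ _ _ _ _ R) => //.
- rewrite /forest_removed (negPf xy).
  pose F1 := add_edge R0 y' x'; pose F2 := add_edge F1 z3 x'; pose F3 := add_edge F2 z2 z3.
  have s1 : symmetric F1 by exact: add_edge_sym.
  have s2 : symmetric F2 by exact: add_edge_sym.
  have s3 : symmetric F3 by exact: add_edge_sym.
  have f1 : forest F1 by apply: forest_leaf => //; [rewrite eq_sym | exact: forest_empty].
  have f2 : forest F2.
    by apply: forest_leaf => // u; rewrite /F1 add_edge_eq (negPf z3x) (negPf z3y).
  have f3 : forest F3.
    by apply: forest_leaf => // u; rewrite /F2 /F1 !add_edge_eq (negPf z2x) (negPf z2y) (negPf z23).
  have f4 : forest (add_edge F3 z1 z2).
    by apply: forest_leaf => // u; rewrite /F3 /F2 /F1 !add_edge_eq (negPf z1x) (negPf z1y) (negPf z13) (negPf z12).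
  apply: forest_sub f4 => a b; rewrite /R /F3 /F2 /F1 /add_edge [[set y'; x']]setUC.
  by case: ([set a; b] == [set x'; y']); rewrite ?orbT ?orbF.
- move=> u v; rewrite RE -!orbA => h.
  suff [uU vU uv xyn] : [/\ u \in U, v \in U, u != v & [set u; v] != [set x'; y']].
    by rewrite uU vU complete.
  by move: h; rewrite eq_set2 => /or4P[||| /or3P[||]] /andP[/eqP-> /eqP->];
    split; rewrite // ?(negPf z1x) ?(negPf z1y) ?(negPf z2x) ?(negPf z2y) ?(negPf z3x) ?(negPf z3y) ?andbF.
apply: (stacked_K5 se' ie' _ UE Z1 Z2 Z3) => //; rewrite lez_nat.
- apply: (@card_subset_seq _ _ [:: x'; y']) => u.
  by rewrite !inE => /andP[].
- apply: (@card_subset_seq _ _ [:: x'; y']) => u.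
  rewrite inE => /and3P[+ _ nR]; rewrite in_setU1 in_set2 !inE => /orP[/eqP uE|//].
  by move: nR; rewrite uE RE !eqxx ?orbT.
apply: (@card_subset_seq _ _ [:: z1; y']) => u.
rewrite !inE => /and3P[/or4P[]/eqP uE _ nR]; rewrite ?uE ?eqxx ?orbT //.
  by move: nR; rewrite uE RE !eqxx ?orbT.
by move: nR; rewrite uE RE !eqxx ?orbT.
Qed.

(* Every vertex of a cycle has two arcs inside it, to its neighbours on the cycle. *)
Lemma forest_no_cycle R (s : seq V) : symmetric R -> forest R ->
  uniq s -> 2 < size s -> ~~ cycle R s.
Proof.
move=> sR fR us s2; apply/negP => cyc.
pose W := [set z in s].
have cW : #|W| = size s by rewrite cardsE; exact/card_uniqP.
have W0 : W != set0 by rewrite -card_gt0 cW; apply: leq_trans s2.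
pose A1 := [set (z, next s z) | z in W]; pose A2 := [set (next s z, z) | z in W].
have c1 : #|A1| = size s by rewrite card_imset ?cW // => a b [].
have c2 : #|A2| = size s by rewrite card_imset ?cW // => a b [].
(* Length at least three keeps the forward and backward arcs distinct, so there are twice as many
   arcs as vertices. *)
have next2 z : z \in s -> next s (next s z) != z.
  move=> zs; have [i s' rs] := rot_to zs; rewrite -!(next_rot i us) rs.
  have : uniq (z :: s') by rewrite -rs rot_uniq.
  have : 2 < size (z :: s') by rewrite -rs size_rot.
  case: s' {rs} => [|a [|b t]] //= _; rewrite eqxx !inE !negb_or.
  by case/and3P=> /and3P[za zb _] _ _; rewrite [a == z]eq_sym (negPf za) eqxx eq_sym zb.
have dis : [disjoint A1 & A2].
  apply/pred0P => a; apply/negP => /andP[/= /imsetP[z + ->] /imsetP[z' _ [zE z'E]]].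
  by rewrite inE => /next2; rewrite z'E -zE eqxx.
have := fR W W0; rewrite leqNgt => /negP; apply.
have sub : A1 :|: A2 \subset inner_arcs R W.
  rewrite subUset; apply/andP; split; apply/subsetP => _ /imsetP[z + ->]; rewrite !inE /= => zs;
    rewrite mem_next zs /= ?(sR (next s z)); exact: next_cycle cyc zs.
have := subset_leq_card sub; rewrite cardsU (disjoint_setI0 dis) cards0 subn0 c1 c2 cW.
by rewrite mul2n -addnn => le; apply: leq_ltn_trans le _; rewrite addn2 ltnS leqnSn.
Qed.

End Forests.

(** * Alon-Tarsi orientations *)

Section AlonTarsi.
Variable V : finType.
Implicit Types (e R : rel V) (E : {set {set V}}) (l : seq (V * V)) (u v x : V).

Lemma AT_le_ok E k : AT_ok E k -> AT E <= k.
Proof.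
move=> ok; rewrite /AT leqNgt; apply/negP => lt.
have k_lt : k < #|V|.+2.
  by apply: leq_trans lt _; rewrite -[X in _ <= X](size_iota 0) find_size.
by have := before_find 0 lt; rewrite nth_iota // add0n ok.
Qed.

Lemma uniq_map_inj (T T' : eqType) (f : T -> T') (s : seq T) a b :
  uniq (map f s) -> a \in s -> b \in s -> f a = f b -> a = b.
Proof.
elim: s => //= c s IH /andP[cs us]; rewrite !inE.
case/orP=> [/eqP->|aS] /orP[/eqP->|bS] // fab.
- by case/negP: cs; rewrite fab map_f.
- by case/negP: cs; rewrite -fab map_f.
exact: IH.
Qed.

(** Reorienting the listed edges makes [d] the sequence of outdegrees; the coefficient is then the
    difference of the two Eulerian counts. *)
Lemma AT_le_coef E l d k : simple_edges E -> edge_list (edge E) l -> (coef l d != 0)%R ->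
  (forall v, d v <= k%:Z)%R -> AT E <= k.+1.
Proof.
move=> sE [ul _ lE] nz dk; apply: AT_le_ok.
have [l' [ends' nz' sumd]] := coef_orient nz.
have ul' : uniq (map (@ends V) l') by rewrite ends'.
have memE u v : ([set u; v] \in E) = ([set u; v] \in map (@ends V) l') by rewrite ends' -lE.
have uniq_l' := map_uniq ul'.
apply/existsP; exists [set a in l']; apply/and3P; split.
- apply/andP; split.
    apply/forallP => u; apply/forallP => v; apply/implyP; rewrite inE => uv.
    by rewrite memE; apply/mapP; exists (u, v).
  apply/forallP => u; apply/forallP => v; apply/implyP => /andP[]; rewrite memE.
  case/mapP=> a al /eqP; rewrite eq_set2 !inE => aE uv.
  have both : ~~ (((u, v) \in l') && ((v, u) \in l')).
    apply/negP => /andP[uvl vul]; move: uv.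
    have /eqP := uniq_map_inj ul' uvl vul (setUC _ _).
    by rewrite xpair_eqE => /andP[->].
  have one : ((u, v) \in l') || ((v, u) \in l').
    by move: aE al; case: a => a b /= /orP[]/andP[/eqP-> /eqP->] ->; rewrite ?orbT.
  by move: both one; case: (_ \in l'); case: (_ \in l').
- rewrite -eqz_nat -subr_eq0 -coef_EE_OE // sumd.
  exact: nz'.
rewrite ltnS; apply/bigmax_leqP => v _.
rewrite -lez_nat -sum_fst_expo.
rewrite (_ : (\sum_(a in [set a in l']) unit_expo a.1 = d)%R) //.
rewrite -sumd (big_uniq _ uniq_l') /=.
by apply: eq_bigl => a; rewrite inE.
Qed.

Lemma simple_sub E E' : E' \subset E -> simple_edges E -> simple_edges E'.
Proof. by move=> /subsetP sub sE e /sub; exact: sE. Qed.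

Definition edges_of E R : {set {set V}} :=
  [set f in E | [exists u, exists v, (f == [set u; v]) && R u v]].

Lemma mem_edges_of E R u v : symmetric R -> ([set u; v] \in edges_of E R) = ([set u; v] \in E) && R u v.
Proof.
move=> sR; rewrite inE; congr (_ && _); apply/existsP/idP => [[a /existsP[b]]|Ruv].
  by rewrite eq_set2 => /andP[/orP[]/andP[/eqP-> /eqP->]]; rewrite // sR.
by exists u; apply/existsP; exists v; rewrite eqxx.
Qed.

Lemma AT_le_remaining E R x l d k : simple_edges E -> symmetric R ->
  edge_list (remaining [set: V] (edge E) R x x) l -> (coef l d != 0)%R ->
  (forall v, d v <= k%:Z)%R -> AT (E :\: edges_of E R) <= k.+1.
Proof.
move=> sE sR [ul nl lE] nz dk; apply: (AT_le_coef _ _ nz dk).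
  by apply: simple_sub sE; exact: subsetDl.
split=> // u v; rewrite -lE /remaining /edge !in_setT in_setD mem_edges_of //=.
case: (boolP ([set u; v] \in E)) => uvE; rewrite ?andbF //= andbT.
(* Equal sinks delete no edge, since an edge has two elements. *)
suff -> : [set u; v] != [set x; x] by rewrite andbT.
by apply: contraTneq uvE => ->; apply/negP => /sE; rewrite setUid cards1.
Qed.

End AlonTarsi.

Theorem theorem1p2 (V : finType) (E : {set {set V}}) :
  simple_edges E -> K33_minor_free E ->
  [/\ AT E <= 5,
      (exists M : {set {set V}}, M \subset E /\
         (forall e f, e \in M -> f \in M -> e != f -> [disjoint e & f]) /\
         AT (E :\: M) <= 4)
    & (exists F : {set {set V}}, F \subset E /\
         ~ (exists s : seq V, [/\ uniq s, 2 < size s &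
                                  cycle (fun x y => [set x; y] \in F) s]) /\
         AT (E :\: F) <= 3)].
Proof.
move=> sE free; have nK := no_K33 sE free.
have se := edge_sym E; have ie := edge_irr sE.
(* An empty graph has no vertex to serve as sink, but then the list searched by [AT] has length
   2. *)
case: (pickP (mem [set: V])) => [x _|V0]; last first.
  have ATV (E' : {set {set V}}) : AT E' <= 2.
    apply: leq_trans (find_size _ _) _; rewrite size_iota.
    by rewrite (eq_card0 (A := mem V)) // => v; have := V0 v; rewrite !inE.
  split; first exact: leq_trans (ATV _) _.
    exists set0; split; first exact: sub0set.
    by split=> [e f|]; [rewrite inE | exact: leq_trans (ATV _) _].
  exists set0; split; first exact: sub0set.
  split; last exact: leq_trans (ATV _) _.
  by case=> -[|v s] [] // _ _ _; have := V0 v; rewrite !inE.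
split.
- have [R [l [d [[sR R0 _] el nz [_ _ _ dI]]]]] := @nice_five V (edge E) x se ie nK.
  have -> : E = E :\: edges_of E R.
    apply/setP => f; rewrite in_setD; case: (boolP (f \in edges_of E R)) => //.
    by rewrite inE => /andP[_ /existsP[u /existsP[v]]]; rewrite R0 andbF.
  exact: (AT_le_remaining sE sR el nz dI).
- have [R [l [d [[sR mR _] el nz [_ _ _ dI]]]]] := @nice_four V (edge E) x se ie nK.
  exists (edges_of E R); split; first by apply/subsetP => f; rewrite inE => /andP[].
  split; last exact: (AT_le_remaining sE sR el nz dI).
  move=> f g; rewrite !inE => /andP[_ /existsP[a /existsP[b /andP[/eqP-> Rab]]]].
  move=> /andP[_ /existsP[c /existsP[h /andP[/eqP-> Rch]]]]; apply: contraR.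
  have Rba : R b a by rewrite sR. have Rhc : R h c by rewrite sR.
  rewrite -setI_eq0 => /set0Pn[t]; rewrite !inE => /andP[/orP[]/eqP tE /orP[]/eqP tE'];
    rewrite eq_set2 -tE -tE' eqxx /=; move: Rab Rba Rch Rhc; rewrite -tE -tE'.
  + by move=> Rab _ Rch _; rewrite (mR _ _ _ Rab Rch) eqxx.
  + by move=> Rab _ _ Rhc; rewrite (mR _ _ _ Rab Rhc) eqxx orbT.
  + by move=> _ Rba Rch _; rewrite (mR _ _ _ Rba Rch) eqxx ?andbT ?orbT.
  by move=> _ Rba _ Rhc; rewrite (mR _ _ _ Rba Rhc) eqxx ?andbT ?orbT.
have [R [l [d [[sR fR RU] el nz [_ _ _ dI]]]]] := @nice_three V (edge E) x se ie nK.
exists (edges_of E R); split; first by apply/subsetP => f; rewrite inE => /andP[].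
split; last exact: (AT_le_remaining sE sR el nz dI).
case=> s [us s2 cyc].
case/negP: (forest_no_cycle sR (forest_of_removed fR) us s2).
by apply: sub_cycle cyc => u v; rewrite mem_edges_of // => /andP[].
Qed.
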